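(* Let $\mathrm{M}$ be a loopless matroid on a finite set $E$ with lattice of flats $\mathcal{L}$, let $\mathcal{G}$ be a building set with $(\mathrm{M},\mathcal{G})$ irreducible, and let $\vartriangleleft$ be a total order on $E$ such that $(\mathrm{M},\mathcal{G})$ is $\vartriangleleft$-complete. Let $V=\mathcal{G}\setminus\big(C_\vartriangleleft(\hat0,\hat1)\cup\{\text{atoms of }\mathcal{L}\}\big)$ and \[ \Gamma_\vartriangleleft(\mathrm{M},\mathcal{G})=\{\mathrm{Des}(\mathcal{S}) : \mathcal{S}\in\mathcal{N}(\mathrm{M},\mathcal{G})^{\max}_{\mathrm{stable}}\}\subseteq\mathcal{P}(V). \] Then $\Gamma_\vartriangleleft(\mathrm{M},\mathcal{G})$ is a simplicial complex (a family of subsets closed under taking subsets), and for every $i\geqslant0$ the number of its members of cardinality $i$ equals the coefficient $\gamma_i$ of $t^i$ in the $\gamma$-polynomial of the Chow polynomial $\mathrm{H}(\mathrm{M},\mathcal{G})(t)$.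
   Context: $\mathcal{L}$ is ordered by inclusion, $\hat0=\varnothing$, $\hat1=E$, $F\vee G=\operatorname{cl}_{\mathrm{M}}(F\cup G)$, $F\vee e=\operatorname{cl}_{\mathrm{M}}(F\cup\{e\})$. A building set is $\mathcal{G}\subseteq\mathcal{L}\setminus\{\hat0\}$ such that for every $F\neq\hat0$ the join map $\prod_{G\in\max\mathcal{G}_{\leqslant F}}[\hat0,G]\to[\hat0,F]$ is a poset isomorphism ($\max\mathcal{G}_{\leqslant F}$ = maximal elements of $\{G\in\mathcal{G}:G\leqslant F\}$); irreducible means $E\in\mathcal{G}$. $\mathcal{S}\subseteq\mathcal{G}$ is nested if for every antichain $A\subseteq\mathcal{S}$ and every $\{S_1,\dots,S_k\}\subseteq A$, $k\geqslant2$, $S_1\vee\dots\vee S_k\notin\mathcal{G}$; maximal nested sets are inclusion-maximal ones. Chow ring $\mathrm{CH}(\mathrm{M},\mathcal{G})=\mathbb{Q}[x_G:G\in\mathcal{G}]/(I+J)$ with $I$ generated by $x_{G_1}\cdots x_{G_k}$ for non-nested $\{G_1,\dots,G_k\}$ and $J$ by $\sum_{G\in\mathcal{G},G\geqslant a}x_G$ for atoms $a$; $\mathrm{H}(\mathrm{M},\mathcal{G})(t)=\sum_i\dim\mathrm{CH}^i t^i$ is palindromic of degree $d$, $\mathrm{H}=\sum_i\gamma_it^i(1+t)^{d-2i}$, and $\sum_i\gamma_it^i$ is its $\gamma$-polynomial. $C_\vartriangleleft(F,G)$ for flats $F\leqslant G$: with $G\setminus F=\{e_1\vartriangleleft\dots\vartriangleleft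 e_k\}$, $F_i=\operatorname{cl}_{\mathrm{M}}(F\cup\{e_1,\dots,e_i\})$, $C_\vartriangleleft(F,G)=\{F,F_1,\dots,F_k\}$. With $\mathcal{G}_F=\{F\vee H:H\in\mathcal{G}\}\setminus\{F\}$, $\mathcal{G}_F^G=\mathcal{G}_F\cap[F,G]$, $\vartriangleleft$-complete means $C_\vartriangleleft(F,G)\subseteq\mathcal{G}_F^G\cup\{F\}$ for all flats $F$ and $G\in\mathcal{G}$ with $F\leqslant G$. For a maximal nested set $\mathcal{S}$ and $G\in\mathcal{S}$: $J^G=\bigvee\{H\in\mathcal{S}:H<G\}$, which satisfies $\operatorname{rk}G-\operatorname{rk}J^G=1$; $\lambda_{\mathcal{S}}(G)=\min_\vartriangleleft\{e:J^G\vee e=G\}$; for $G$ not maximal in $\mathcal{S}$, $p(G)$ is the unique minimum of $\{H\in\mathcal{S}:H>G\}$ (children of $H$ are the $G$ with $p(G)=H$). $G$ is a descent if it is not maximal in $\mathcal{S}$ and $\lambda_{\mathcal{S}}(p(G))\vartriangleleft\lambda_{\mathcal{S}}(G)$; a bottom descent if moreover minimal in $\mathcal{S}$; a double descent if a descent, not minimal in $\mathcal{S}$, all of whose children are descents. $\mathrm{Des}(\mathcal{S})$ = set of descents; $\mathcal{N}(\mathrm{M},\mathcal{G})^{\max}_{\mathrm{stable}}$ = maximal nested sets without bottom or double descents. *)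

(* Defs.v *)
From HB Require Import structures.
From mathcomp Require Import all_boot all_order all_algebra.
Set Implicit Arguments. Unset Strict Implicit. Unset Printing Implicit Defensive.
Import Order.TTheory GRing.Theory Num.Theory.

Record matroid (T : finType) := Matroid {
  mrank : {set T} -> nat;
  mrank_card : forall X, mrank X <= #|X|;
  mrank_mono : forall X Y : {set T}, X \subset Y -> mrank X <= mrank Y;
  mrank_submod : forall X Y : {set T},
      mrank (X :|: Y) + mrank (X :&: Y) <= mrank X + mrank Y }.

Section Matroids.
Variables (T : finType) (M : matroid T).

Definition loopless : Prop := forall e : T, mrank M [set e] = 1.

Definition cl (X : {set T}) : {set T} := [set e | mrank M (e |: X) == mrank M X].
Definition flat (X : {set T}) : bool := cl X == X.
Definition join_fam (A : {set {set T}}) : {set T} := cl (\bigcup_(X in A) X).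
Definition atoms : {set {set T}} := [set X | flat X & mrank M X == 1].

Variable BG : {set {set T}}.

Definition maxle (F : {set T}) : {set {set T}} :=
  [set G in BG | (G \subset F) &&
     [forall G' in BG, ((G' \subset F) && (G \subset G')) ==> (G' == G)]].

(* elements of prod_{G in max G_{<=F}} [hat0, G], encoded as finite functions
   that are set0 outside max G_{<=F} *)
Definition in_prod (F : {set T}) (phi : {ffun {set T} -> {set T}}) : bool :=
  [forall G, if G \in maxle F then flat (phi G) && (phi G \subset G)
             else phi G == set0].

Definition join_map (F : {set T}) (phi : {ffun {set T} -> {set T}}) : {set T} :=
  cl (\bigcup_(G in maxle F) phi G).

Definition building_set : Prop :=
  (forall G, G \in BG -> flat G /\ G != set0) /\
  forall F, flat F -> F != set0 ->
    (forall phi, in_prod F phi -> join_map F phi \subset F) /\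
    (forall X, flat X -> X \subset F -> exists2 phi, in_prod F phi & join_map F phi = X) /\
    (* order embedding for the product order (hence injective) *)
    (forall phi psi, in_prod F phi -> in_prod F psi ->
       (forall G, G \in maxle F -> phi G \subset psi G) <->
       join_map F phi \subset join_map F psi).

Definition antichain (A : {set {set T}}) : bool :=
  [forall X in A, forall Y in A, (X \subset Y) ==> (X == Y)].

Definition nested (S : {set {set T}}) : bool :=
  (S \subset BG) &&
  [forall A : {set {set T}}, (antichain A && (A \subset S)) ==>
     [forall B : {set {set T}}, ((B \subset A) && (2 <= #|B|)) ==>
        (join_fam B \notin BG)]].

Definition max_nested (S : {set {set T}}) : bool :=
  nested S && [forall S' : {set {set T}}, (nested S' && (S \subset S')) ==> (S' == S)].

(* Chow ring CH(M, G) = Q[x_G : G in BG] / (I + J), graded pieces      *)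
(* Monomials of degree <= i in each variable are finite functions
   {set T} -> 'I_i.+1 (exponent of x_G); the degree-i homogeneous part of
   Q[x_G : G in BG] is spanned by the monomials of total degree i supported
   on BG.  Polynomials are represented by their coefficient functions. *)
Definition monom (i : nat) := {ffun {set T} -> 'I_i.+1}.
Definition hpoly (i : nat) := {ffun monom i -> rat^o}.

Definition valid_monom (i : nat) (m : monom i) : bool :=
  (\sum_(H : {set T}) (m H : nat) == i) &&
  [forall H : {set T}, (H \notin BG) ==> ((m H : nat) == 0)].

Definition delta (i : nat) (m : monom i) : hpoly i :=
  [ffun m' => ((m' == m)%:R)%R].

Definition Pgens (i : nat) : seq (hpoly i) :=
  [seq delta m | m <- enum [pred m : monom i | valid_monom m]].

(* degree-i part of I: monomials divisible by x_{G1}...x_{Gk} for some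
   non-nested {G1,...,Gk} subset of BG *)
Definition Igens (i : nat) : seq (hpoly i) :=
  [seq delta m | m <- enum [pred m : monom i | valid_monom m &&
      [exists N : {set {set T}}, [&& N \subset BG, ~~ nested N &
          [forall G in N, 0 < (m G : nat)]]]]].

(* degree-i part of J: m' * (sum_{G in BG, G >= a} x_G) for atoms a and
   monomials m' of degree i - 1 *)
Definition Jgens (i : nat) : seq (hpoly i) :=
  if i is j.+1 then
    [seq [ffun m : monom j.+1 =>
            (\sum_(G in BG | a \subset G)
               ([forall H, (m H : nat) == (m' H : nat) + (H == G)] : nat))%:R%R]
     | a : {set T} <- enum atoms, m' : monom j <- enum [pred m' : monom j | valid_monom m']]
  else [::].

Definition dimCH (i : nat) : nat :=
  (\dim (<<Pgens i>>%VS) - \dim (<<Igens i ++ Jgens i>>%VS))%N.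

Variable lt : rel T.

Definition strict_total_order : Prop :=
  (forall x, ~~ lt x x) /\
  (forall x y z, lt x y -> lt y z -> lt x z) /\
  (forall x y, x != y -> lt x y || lt y x).

(* C_<|(F, G) = {F, F_1, ..., F_k}, F_i = cl(F u {e_1, ..., e_i}) *)
Definition Cchain (F G : {set T}) : {set {set T}} :=
  F |: [set cl (F :|: [set e in G :\: F | (e == x) || lt e x]) | x in G :\: F].

Definition GF (F : {set T}) : {set {set T}} := [set cl (F :|: H) | H in BG] :\ F.
Definition GFG (F G : {set T}) : {set {set T}} :=
  [set X in GF F | (F \subset X) && (X \subset G)].

Definition complete : Prop :=
  forall F G, flat F -> G \in BG -> F \subset G ->
    Cchain F G \subset GFG F G :|: [set F].

Definition JG (S : {set {set T}}) (G : {set T}) : {set T} :=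
  join_fam [set H in S | H \proper G].

Definition is_lambda (S : {set {set T}}) (G : {set T}) (e : T) : bool :=
  (cl (JG S G :|: [set e]) == G) &&
  [forall e', (cl (JG S G :|: [set e']) == G) ==> ((e == e') || lt e e')].

Definition is_parent (S : {set {set T}}) (G H : {set T}) : bool :=
  [&& H \in S, G \proper H &
      [forall H' in S, (G \proper H') ==> (H \subset H')]].

Definition is_minimal (S : {set {set T}}) (G : {set T}) : bool :=
  ~~ [exists H in S, H \proper G].

Definition descent (S : {set {set T}}) (G : {set T}) : bool :=
  (G \in S) &&
  [exists H, exists a, exists b,
     [&& is_parent S G H, is_lambda S H a, is_lambda S G b & lt a b]].

Definition bottom_descent S G : bool := descent S G && is_minimal S G.

Definition double_descent S G : bool :=
  [&& descent S G, ~~ is_minimal S G &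
      [forall G' in S, is_parent S G' G ==> descent S G']].

Definition Des (S : {set {set T}}) : {set {set T}} := [set G in S | descent S G].

Definition stable_max_nested (S : {set {set T}}) : bool :=
  max_nested S &&
  [forall G in S, ~~ bottom_descent S G && ~~ double_descent S G].

Definition Gamma : {set {set {set T}}} :=
  [set Des S | S in [set S : {set {set T}} | stable_max_nested S]].

Definition Vset : {set {set T}} := BG :\: (Cchain set0 setT :|: atoms).

End Matroids.

Definition nfaces (U : finType) (K : {set {set U}}) (i : nat) : nat :=
  #|[set D in K | #|D| == i]|.

(* Main.v *)
Require Import Defs.
From HB Require Import structures.
From mathcomp Require Import all_boot all_order all_algebra.
From mathcomp Require Import mpoly.
From mathcomp Require Import zify ring.
Set Implicit Arguments. Unset Strict Implicit. Unset Printing Implicit Defensive.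

(* The Chow ring has the Feichtner-Yuzvinsky basis of standard monomials [x^c]: the support of
   [c] is nested and [c G < rk G - rk J^G].  They span because
   [prod_(A child of G) x_A * (sum_(H >= G) x_H) ^ (rk G - rk J^G)] lies in [I + J] and rewriting
   with it increases the weight [sum_G c G * rk G].  They are independent because, in the variables
   [h_G = - sum_(H >= G) x_H], declaring a monomial to have value 1 or 0 according to a
   dragon Hall-Rado condition in every interval [[J^G, G]] defines functionals killing [I + J],
   and evaluating them on the [h^c] gives a unitriangular matrix.

   On the combinatorial side, every nested set containing [E] lies in a unique maximal nested set
   whose new members are not descents, and by completeness a node of a maximal nested set has at
   most one child that is not a descent.  Hence a standard monomial is the same as a maximal nested
   set with a word of zeros and ones along each of its ascending paths: the word of a path ending
   in a descent starts with 1 and ends with 0, and the word of the path ending in [E] starts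
   with 1.  Such words exist exactly on stable maximal nested sets, and there the remaining
   [d - 2 |Des S|] letters are free, which gives [sum_S t^|Des S| (1 + t)^(d - 2 |Des S|)].
   A maximal nested set is the completion of its descents, so [Des] is injective; removing some
   descents and completing again keeps the other ones, because completeness turns being a descent
   into a condition on minima of blocks that grow. *)

(** * Closure and flats *)

(** The variables h_G turn the generators of J into single variables: up to sign, h_a is the
    generator of the atom a, and the Hall-Rado condition gives value 0 to every monomial divisible
    by it. The obstacle is then I, whose generators are no longer monomials. For an antichain A with
    join B in the building set, the product of the h_F - h_B over F in A expands into an alternating
    sum over subsets of A, and a matroid exchange argument finds an element of A that can be toggled
    without changing any value, so the sum vanishes. Since h_F - h_B is minus the sum of the x_H
    with H above F but not above B, the generators of I follow by induction on ranks.

    The exponent d - 2 |Des S| is a count of nodes. Ascending nodes inject into their parents, so a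
    maximal nested set has |Des S| + 1 nodes without ascending child. On a stable set these must
    carry 1, the |Des S| descents must carry 0, and rk E - (2 |Des S| + 1) nodes are left. One unit
    is added to the exponent of E beforehand, so a monomial of degree i gives i + 1 ones in all. *)

Section MatroidClosure.
Variables (T : finType) (M : matroid T).
Implicit Types (A X Y Z F G : {set T}) (e : T).
Local Notation rk := (mrank M).
Local Notation cl := (cl M).
Local Notation flat := (flat M).

Lemma rk_set0 : rk set0 = 0.
Proof. by apply/eqP; rewrite -leqn0 -(cards0 T); apply: mrank_card. Qed.

Lemma rk_subU1 e X : rk (e |: X) <= (rk X).+1.
Proof.
have := mrank_submod M [set e] X; have := mrank_card M [set e].
rewrite cards1; lia.
Qed.

Lemma rk_submod_rel X Z Y : Y \subset X -> Y \subset Z -> rk (X :|: Z) + rk Y <= rk X + rk Z.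
Proof.
move=> YX YZ; have := mrank_submod M X Z.
have := @mrank_mono _ M Y (X :&: Z); rewrite subsetI YX YZ => /(_ isT); lia.
Qed.

Lemma cl_ext X : X \subset cl X.
Proof. by apply/subsetP => e eX; rewrite inE (setUidPr _) // sub1set. Qed.

Lemma rk_addU X A : A \subset cl X -> rk (X :|: A) = rk X.
Proof.
have [n cA] := ubnP #|A|; elim: n A cA => // n IH A cA AX.
case: (set_0Vmem A) => [->|[e eA]]; first by rewrite setU0.
have IHA : rk (X :|: A :\ e) = rk X.
  apply: IH; first by have := cardsD1 e A; rewrite eA; lia.
  by apply: subset_trans AX; apply: subsetDl.
have := rk_submod_rel (X := X :|: A :\ e) (Z := e |: X) (Y := X) (subsetUl _ _) (subsetUr _ _).
have /eqP -> : rk (e |: X) == rk X by have := subsetP AX e eA; rewrite inE.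
rewrite IHA; have -> : (X :|: A :\ e) :|: (e |: X) = X :|: A.
  by apply/setP => x; rewrite !inE; case: eqP => [->|_]; rewrite ?eA ?orbT //; case: (x \in X); rewrite ?orbT ?orbF.
by have := @mrank_mono _ M X (X :|: A) (subsetUl _ _); lia.
Qed.

Lemma rk_cl X : rk (cl X) = rk X.
Proof. by rewrite -(rk_addU (subxx (cl X))) (setUidPr (cl_ext X)). Qed.

Lemma cl_mono X Y : X \subset Y -> cl X \subset cl Y.
Proof.
move=> XY; apply/subsetP => e; rewrite !inE => /eqP eX.
have := rk_submod_rel (X := e |: X) (Z := Y) (Y := X) (subsetUr _ _) XY.
rewrite eX -setUA (setUidPr XY).
by have := @mrank_mono _ M Y (e |: Y) (subsetUr _ _); lia.
Qed.

Lemma flat_cl X : flat (cl X).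
Proof.
apply/eqP/eqP; rewrite eqEsubset cl_ext andbT; apply/subsetP => e; rewrite !inE rk_cl => /eqP eX.
have := @mrank_mono _ M (e |: X) (e |: cl X) (setUS _ (cl_ext X)).
by have := @mrank_mono _ M X (e |: X) (subsetUr _ _); lia.
Qed.

Lemma flatE F : flat F -> cl F = F. Proof. by move/eqP. Qed.

Lemma cl_min X F : flat F -> X \subset F -> cl X \subset F.
Proof. by move=> /flatE fF /cl_mono; rewrite fF. Qed.

Lemma flat_eq F G : flat F -> F \subset G -> rk G <= rk F -> F = G.
Proof.
move=> fF FG r; apply/eqP; rewrite eqEsubset FG /=; apply/subsetP => e eG.
rewrite -(flatE fF) inE.
have := @mrank_mono _ M (e |: F) G; rewrite subUset sub1set eG FG => /(_ isT).
by have := @mrank_mono _ M F (e |: F) (subsetUr _ _); lia.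
Qed.

Lemma flat_rk_lt F G : flat F -> F \proper G -> rk F < rk G.
Proof.
move=> fF pFG; rewrite ltnNge; apply/negP => /(flat_eq fF (proper_sub pFG)) FG.
by rewrite FG properxx in pFG.
Qed.

Lemma rk_addflat F e : flat F -> e \notin F -> rk (e |: F) = (rk F).+1.
Proof.
move=> fF eF; apply/eqP; rewrite eqn_leq rk_subU1 /=; apply: flat_rk_lt => //.
apply/properP; split; first exact: subsetUr.
by exists e => //; rewrite !inE eqxx.
Qed.

Lemma cl_clU X Y : cl (cl X :|: Y) = cl (X :|: Y).
Proof.
apply/eqP; rewrite eqEsubset; apply/andP; split; last by apply/cl_mono/setSU/cl_ext.
apply: cl_min; first exact: flat_cl.
by rewrite subUset cl_mono ?subsetUl //= (subset_trans (subsetUr X Y)) ?cl_ext.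
Qed.


(** A basis of [G] relative to [F]. Its length becomes the exponent in the relation that rewrites
    non-standard monomials. *)
Lemma flat_basis_over F G : flat F -> flat G -> F \subset G ->
  exists2 s : seq T, size s = rk G - rk F & {subset s <= G} /\ cl (F :|: [set x in s]) = G.
Proof.
move=> fF fG FG; have [n lt] := ubnP (rk G - rk F); elim: n F lt fF FG => // n IH F lt fF FG.
have [FeqG|] := eqVneq F G.
  exists [::]; first by rewrite FeqG subnn.
  split => //; suff -> : [set x in [::]] = set0 :> {set T} by rewrite setU0 FeqG flatE.
  by apply/setP => x; rewrite !inE.
rewrite eqEsubset FG /= => /subsetPn [e eG eF].
have re := rk_addflat fF eF.
have sub : cl (e |: F) \subset G by apply: cl_min => //; rewrite subUset sub1set eG FG.
have rG := mrank_mono M sub; rewrite rk_cl re in rG.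
have [|s ss [sG cs]] := IH (cl (e |: F)) _ (flat_cl _) sub; first by rewrite rk_cl re; lia.
exists (e :: s); first by rewrite /= ss rk_cl re; lia.
split; first by move=> x; rewrite inE => /orP [/eqP->|/sG].
rewrite -[RHS]cs cl_clU; congr cl; apply/setP => x; rewrite !inE.
by case: (x == e); case: (x \in F); rewrite ?orbT.
Qed.

Section Loopless.
Hypothesis ll : loopless M.

Lemma flat0 : flat set0.
Proof.
rewrite /flat eqEsubset cl_ext andbT; apply/subsetP => e.
by rewrite inE setU0 rk_set0 ll.
Qed.

Lemma cl0 : cl set0 = set0. Proof. exact: flatE flat0. Qed.

Lemma rk_gt0 X : X != set0 -> 0 < rk X.
Proof.
case/set0Pn => e eX; rewrite -(ll e); apply: mrank_mono; by rewrite sub1set.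
Qed.

Lemma rk_cl1 e : rk (cl [set e]) = 1. Proof. by rewrite rk_cl ll. Qed.
Lemma mem_cl1 e : e \in cl [set e]. Proof. by rewrite (subsetP (cl_ext _)) ?set11. Qed.

Lemma cl1_sub e F : flat F -> (cl [set e] \subset F) = (e \in F).
Proof.
move=> fF; apply/idP/idP => [/subsetP|eF]; first by apply; exact: mem_cl1.
by apply: cl_min => //; rewrite sub1set.
Qed.

Lemma flat_sub_cl1 F e : flat F -> F != set0 -> F \subset cl [set e] -> F = cl [set e].
Proof. by move=> fF F0 Fe; apply: flat_eq => //; rewrite rk_cl1 rk_gt0. Qed.

End Loopless.
End MatroidClosure.

(** * Factors of flats and nested sets *)

Section BuildingSets.
Variables (T : finType) (M : matroid T) (BG : {set {set T}}).
Hypotheses (ll : loopless M) (bs : building_set M BG).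
Implicit Types (X Y Z F G H K C : {set T}) (S A B N : {set {set T}}) (e : T).
Implicit Types (phi psi : {ffun {set T} -> {set T}}).
Local Notation rk := (mrank M).
Local Notation cl := (cl M).
Local Notation flat := (flat M).
Local Notation nested := (nested M BG).

Lemma BG_flat G : G \in BG -> flat G. Proof. by case: bs => h _ /h []. Qed.
Lemma BG_neq0 G : G \in BG -> G != set0. Proof. by case: bs => h _ /h []. Qed.

Lemma maxleP F K : reflect [/\ K \in BG, K \subset F &
    forall G, G \in BG -> G \subset F -> K \subset G -> G = K] (K \in maxle BG F).
Proof.
rewrite inE; apply: (iffP and3P) => [[KB KF /forall_inP h]|[KB KF h]]; split=> //.
- by move=> G GB GF KG; apply/eqP; apply: (implyP (h G GB)); rewrite GF KG.
- by apply/forall_inP => G GB; apply/implyP => /andP [GF KG]; rewrite (h G).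
Qed.

Lemma exists_factor F G : G \in BG -> G \subset F -> exists2 K, K \in maxle BG F & G \subset K.
Proof.
move=> GB GF.
have PG : [&& G \in BG, G \subset F & G \subset G] by rewrite GB GF subxx.
case: (@arg_maxnP _ G (fun K => [&& K \in BG, K \subset F & G \subset K]) (fun K => #|K|) PG).
move=> K /and3P [KB KF GK] Kmax; exists K => //; apply/maxleP; split=> // H HB HF KH.
apply/esym/eqP; rewrite eqEcard KH; apply: Kmax; rewrite HB HF; exact: subset_trans KH.
Qed.

Section Factors.
Variable F : {set T}.
Hypotheses (fF : flat F) (F0 : F != set0).

Lemma in_prodP (phi : {ffun {set T} -> {set T}}) :
  reflect ((forall G, G \in maxle BG F -> flat (phi G) /\ phi G \subset G) /\
           (forall G, G \notin maxle BG F -> phi G = set0)) (in_prod M BG F phi).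
Proof.
apply: (iffP forallP) => [h|[h1 h2] G].
  split=> G GF; first by have := h G; rewrite GF => /andP.
  by have := h G; rewrite (negPf GF) => /eqP.
case: ifPn => GF; first by apply/andP; apply: h1.
by rewrite h2.
Qed.

Lemma join_map_le phi psi : in_prod M BG F phi -> in_prod M BG F psi ->
  join_map M BG F phi \subset join_map M BG F psi ->
  forall G, G \in maxle BG F -> phi G \subset psi G.
Proof. by move=> p q; case: bs => _ /(_ F fF F0) [_ [_ /(_ phi psi p q) []]] _ h /h. Qed.

Lemma sub_join_map phi G : G \in maxle BG F -> phi G \subset join_map M BG F phi.
Proof. by move=> GF; apply: subset_trans (cl_ext _ _); apply: bigcup_sup. Qed.

Lemma join_map_flat phi : flat (join_map M BG F phi).
Proof. exact: flat_cl. Qed.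

Definition one_factor K X : {ffun {set T} -> {set T}} :=
  [ffun G => if G == K then X else set0].

Lemma one_factor_in K X : K \in maxle BG F -> flat X -> X \subset K ->
  in_prod M BG F (one_factor K X).
Proof.
move=> KF fX XK; apply/in_prodP; split=> G; rewrite ffunE; case: eqP => [->|_] //.
- by rewrite flat0 // sub0set.
- by rewrite KF.
Qed.

Lemma join_one_factor K X : K \in maxle BG F -> flat X ->
  join_map M BG F (one_factor K X) = X.
Proof.
move=> KF fX; rewrite /join_map -[RHS](flatE fX); congr (Defs.cl M _).
apply/eqP; rewrite eqEsubset; apply/andP; split.
  by apply/bigcupsP => G _; rewrite ffunE; case: eqP; rewrite ?sub0set.
by apply: (bigcup_max K) => //; rewrite ffunE eqxx.
Qed.

(** Otherwise [cl [set e]] would be the join of two families, one concentrated at [K] and one at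
    [K']; comparing them at [K] through the order embedding makes it empty. *)
Lemma factor_disjoint K K' e : K \in maxle BG F -> K' \in maxle BG F ->
  e \in K -> e \in K' -> K = K'.
Proof.
move=> KF KF' eK eK'; apply/eqP; apply/negPn/negP => neq.
have [[KB _ _] [KB' _ _]] := (maxleP _ _ KF, maxleP _ _ KF').
have a1 : cl [set e] \subset K by rewrite cl1_sub // BG_flat.
have a2 : cl [set e] \subset K' by rewrite cl1_sub // BG_flat.
have := @join_map_le (one_factor K (cl [set e])) (one_factor K' (cl [set e])).
rewrite !one_factor_in ?flat_cl // !join_one_factor ?flat_cl // => /(_ isT isT (subxx _) K KF).
rewrite !ffunE eqxx (negPf neq) subset0 => /eqP h.
by have := mem_cl1 M e; rewrite h inE.
Qed.

Lemma join_map_sub phi : in_prod M BG F phi -> join_map M BG F phi \subset F.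
Proof. by case: bs => _ /(_ F fF F0) [h _] /h. Qed.

Lemma factor_cover e : e \in F -> exists2 K, K \in maxle BG F & e \in K.
Proof.
move=> eF; have aF : cl [set e] \subset F by rewrite cl1_sub.
have [phi p pa] : exists2 phi, in_prod M BG F phi & join_map M BG F phi = cl [set e].
  by case: bs => _ /(_ F fF F0) [_ [h _]]; apply: h => //; exact: flat_cl.
case: (boolP [exists K in maxle BG F, phi K != set0]) => [/exists_inP [K KF nz]|].
  exists K => //; have [/(_ K KF) [fK sK] _] := in_prodP _ p.
  have := sub_join_map phi KF; rewrite pa => /(flat_sub_cl1 ll fK nz) h.
  by rewrite (subsetP sK) // h mem_cl1.
rewrite negb_exists_in => /forall_inP h.
have := mem_cl1 M e; rewrite -pa /join_map big1 ?cl0 ?inE // => K /h; rewrite negbK => /eqP //.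
Qed.

(** Closing the union adds nothing: an [e] in the join lies in one factor [K], and the order
    embedding, applied to the family that is the atom of [e] at [K], puts [e] into [phi K]. This is
    why joins of nested families can be handled as plain unions. *)
Lemma join_map_cup phi : in_prod M BG F phi ->
  join_map M BG F phi = \bigcup_(K in maxle BG F) phi K.
Proof.
move=> p; apply/eqP; rewrite eqEsubset cl_ext andbT; apply/subsetP => e eX.
have [K KF eK] := factor_cover (subsetP (join_map_sub p) e eX).
have fK : flat K by apply: BG_flat; case/maxleP: KF.
apply/bigcupP; exists K => //.
have aK : cl [set e] \subset K by rewrite cl1_sub.
have := @join_map_le _ phi (one_factor_in KF (flat_cl _ _) aK) p.
rewrite join_one_factor ?flat_cl // cl1_sub ?join_map_flat // => /(_ eX K KF).
by rewrite ffunE eqxx => /subsetP; apply; apply: mem_cl1.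
Qed.

Lemma flat_bigcup_factors phi : in_prod M BG F phi -> flat (\bigcup_(K in maxle BG F) phi K).
Proof. by move=> /join_map_cup <-; apply: join_map_flat. Qed.

Lemma cover_factors : F = \bigcup_(K in maxle BG F) K.
Proof.
apply/eqP; rewrite eqEsubset; apply/andP; split.
  by apply/subsetP => e /factor_cover [K KF eK]; apply/bigcupP; exists K.
by apply/bigcupsP => K /maxleP [].
Qed.

(* Since the join map is a bijection, a factor is recovered from any spanning
   family of flats each lying below one factor. *)
Lemma factor_join A : (forall C, C \in A -> exists2 K, K \in maxle BG F & C \subset K) ->
  F \subset cl (\bigcup_(C in A) C) ->
  forall K, K \in maxle BG F -> K = cl (\bigcup_(C in A | C \subset K) C).
Proof.
move=> hA FA K KF.
pose phi := [ffun G => if G \in maxle BG F then cl (\bigcup_(C in A | C \subset G) C) else set0].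
have p : in_prod M BG F phi.
  apply/in_prodP; split=> G GF; rewrite ffunE ?GF ?(negPf GF) //; split; first exact: flat_cl.
  by apply: cl_min; [apply: BG_flat; case/maxleP: GF | apply/bigcupsP => C /andP []].
have q : in_prod M BG F [ffun G => if G \in maxle BG F then G else set0].
  apply/in_prodP; split=> G GF; rewrite ffunE ?GF ?(negPf GF) //; split=> //.
  by apply: BG_flat; case/maxleP: GF.
have : join_map M BG F [ffun G => if G \in maxle BG F then G else set0] \subset join_map M BG F phi.
  apply: subset_trans (join_map_sub q) _; apply: subset_trans FA _.
  apply: cl_min; first exact: join_map_flat.
  apply/bigcupsP => C CA; have [G GF CG] := hA C CA.
  apply: subset_trans (sub_join_map phi GF); rewrite ffunE GF.
  by apply: subset_trans (cl_ext _ _); apply: (bigcup_max C); rewrite ?CA.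
move=> /(join_map_le q p) /(_ K KF); rewrite !ffunE KF => h.
apply/eqP; rewrite eqEsubset h /=; apply: cl_min; first by apply: BG_flat; case/maxleP: KF.
by apply/bigcupsP => C /andP [].
Qed.

End Factors.

Lemma atom_BG e : cl [set e] \in BG.
Proof.
have fa := flat_cl M [set e].
have a0 : cl [set e] != set0 by apply/set0Pn; exists e; apply: mem_cl1.
have [K /maxleP [KB Ka _] eK] := factor_cover fa a0 (mem_cl1 M e).
by rewrite -(flat_sub_cl1 ll (BG_flat KB) (BG_neq0 KB) Ka).
Qed.

(** Both sets lie below factors of the join that share [e], hence below the same factor, which is
    then the whole join. *)
Lemma BG_cup G H e : G \in BG -> H \in BG -> e \in G -> e \in H -> cl (G :|: H) \in BG.
Proof.
move=> GB HB eG eH; set F := cl _.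
have GF : G \subset F by apply: subset_trans (cl_ext _ _); apply: subsetUl.
have HF : H \subset F by apply: subset_trans (cl_ext _ _); apply: subsetUr.
have F0 : F != set0 by apply/set0Pn; exists e; apply: (subsetP GF).
have [K KF GK] := exists_factor GB GF; have [K' KF' HK'] := exists_factor HB HF.
have E : K = K'.
  by apply: (factor_disjoint (flat_cl _ _) F0 KF KF' (e := e)); [apply: (subsetP GK) | apply: (subsetP HK')].
case/maxleP: (KF) => KB KsF _; suff -> : F = K by [].
apply/eqP; rewrite eqEsubset KsF andbT; apply: cl_min; first exact: BG_flat.
by rewrite subUset GK E HK'.
Qed.

Lemma antichainP A :
  reflect (forall X Y, X \in A -> Y \in A -> X \subset Y -> X = Y) (antichain A).
Proof.
apply: (iffP forall_inP) => [h X Y XA YA XY|h X XA].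
  by apply/eqP; apply: (implyP (forall_inP (h X XA) Y YA)).
by apply/forall_inP => Y YA; apply/implyP => /h ->.
Qed.

Lemma antichain_sub A B : B \subset A -> antichain A -> antichain B.
Proof.
move=> /subsetP BA /antichainP h; apply/antichainP => X Y XB YB; apply: h; exact: BA.
Qed.

Lemma nestedP S : reflect (S \subset BG /\ forall B, B \subset S -> antichain B ->
    2 <= #|B| -> join_fam M B \notin BG) (nested S).
Proof.
apply: (iffP andP) => [[SB /forallP h]|[SB h]]; split=> //.
  move=> B BS aB cB; have := h B; rewrite aB BS /= => /forallP /(_ B).
  by rewrite subxx cB.
apply/forallP => A; apply/implyP => /andP [aA AS]; apply/forallP => B.
apply/implyP => /andP [BA cB]; apply: h => //; first exact: subset_trans AS.
exact: antichain_sub aA.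
Qed.

Lemma nonnestedP S : S \subset BG -> ~~ nested S ->
  exists B, [/\ B \subset S, antichain B, 2 <= #|B| & join_fam M B \in BG].
Proof.
move=> SB; rewrite /nested SB /= negb_forall => /existsP [A].
rewrite negb_imply => /andP [/andP [aA AS]]; rewrite negb_forall => /existsP [B].
rewrite negb_imply negbK => /andP [/andP [BA cB] BB]; exists B; split=> //.
  exact: subset_trans AS.
exact: antichain_sub aA.
Qed.

Section Nested.
Variable S : {set {set T}}.
Hypothesis nS : nested S.

Lemma nested_BG G : G \in S -> G \in BG.
Proof. by have [/subsetP h _] := nestedP S nS; apply: h. Qed.

Lemma nested_flat G : G \in S -> flat G. Proof. by move/nested_BG/BG_flat. Qed.
Lemma nested_neq0 G : G \in S -> G != set0. Proof. by move/nested_BG/BG_neq0. Qed.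

Lemma nested_sub N : N \subset S -> nested N.
Proof.
move=> NS; have [SB h] := nestedP S nS; apply/nestedP; split.
  exact: subset_trans SB.
move=> B BN; apply: h; exact: subset_trans NS.
Qed.

Lemma nested_cmp G H e : G \in S -> H \in S -> e \in G -> e \in H -> (G \subset H) || (H \subset G).
Proof.
move=> GS HS eG eH; apply/negPn; rewrite negb_or; apply/negP => /andP [n1 n2].
have neq : G != H by apply/eqP => E; rewrite E subxx in n1.
have [_ /(_ [set G; H])] := nestedP S nS.
rewrite subUset !sub1set GS HS cards2 neq => /(_ isT) h.
suff : join_fam M [set G; H] \in BG.
  apply/negP; apply: h => //; apply/antichainP => X Y; rewrite !inE.
  by move=> /orP [] /eqP -> /orP [] /eqP -> //; rewrite ?(negPf n1) ?(negPf n2).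
rewrite /join_fam bigcup_setU !big_set1.
by apply: (BG_cup (e := e)); rewrite ?nested_BG.
Qed.

(** A factor [K] of the join is itself the join of the members of [A] below it. As [K] is in the
    building set, nestedness forbids two or more such members, so there is exactly one and it equals
    [K]. *)
Lemma antichain_factors A : A \subset S -> antichain A -> A != set0 ->
  maxle BG (join_fam M A) \subset A /\ join_fam M A = \bigcup_(C in A) C.
Proof.
move=> AS aA A0; set F := join_fam M A.
have fF : flat F by apply: flat_cl.
have CF C : C \in A -> C \subset F by move=> CA; apply: subset_trans (cl_ext _ _); apply: bigcup_sup.
have F0 : F != set0.
  case/set0Pn: A0 => C CA; have /nested_neq0/set0Pn [e eC] := subsetP AS C CA.
  by apply/set0Pn; exists e; apply: (subsetP (CF _ CA)).
have h := factor_join fF F0 (A := A) _ (subxx _).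
have mA : maxle BG F \subset A.
  apply/subsetP => K KF.
  have KE : K = join_fam M [set C in A | C \subset K].
    rewrite /join_fam {1}(h _ _ KF) => [|C CA].
      by congr (Defs.cl M _); apply: eq_bigl => C; rewrite inE.
    by apply: exists_factor; rewrite ?CF ?nested_BG ?(subsetP AS).
  have [KB _ _] := maxleP _ _ KF.
  have [_ /(_ [set C in A | C \subset K])] := nestedP S nS; rewrite -KE KB.
  have sA : [set C in A | C \subset K] \subset A by apply/subsetP => C; rewrite inE => /andP [].
  move=> /(_ (subset_trans sA AS) (antichain_sub sA aA)); rewrite /=.
  case: (set_0Vmem [set C in A | C \subset K]) => [E|[C CK]].
    by move: (BG_neq0 KB); rewrite KE E /join_fam big_set0 cl0 // eqxx.
  case: ltnP => [_ /(_ isT) //|c1 _].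
  have E : [set C in A | C \subset K] = [set C].
    by apply/esym/eqP; rewrite eqEcard sub1set CK cards1.
  rewrite KE E /join_fam big_set1 flatE; first by apply: (subsetP sA).
  by apply: nested_flat; apply: (subsetP AS); apply: (subsetP sA).
split=> //; apply/eqP; rewrite eqEsubset; apply/andP; split; last by apply/bigcupsP.
rewrite {1}(cover_factors fF F0); apply/bigcupsP => K KF; apply: bigcup_sup.
exact: (subsetP mA).
Qed.

Definition max_elts A := [set C in A | [forall C' in A, (C \subset C') ==> (C' == C)]].

Lemma max_eltsP A C : C \in A -> exists2 C', C' \in max_elts A & C \subset C'.
Proof.
move=> CA; have P0 : (C \in A) && (C \subset C) by rewrite CA subxx.
case: (@arg_maxnP _ C (fun K => (K \in A) && (C \subset K)) (fun K => #|K|) P0).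
move=> K /andP [KA CK] Kmax; exists K => //; rewrite inE KA; apply/forall_inP => H HA.
apply/implyP => KH; rewrite eq_sym eqEcard KH; apply: Kmax.
by rewrite HA (subset_trans CK).
Qed.

Lemma max_elts_sub A : max_elts A \subset A.
Proof. by apply/subsetP => C; rewrite inE => /andP []. Qed.

Lemma max_elts_antichain A : antichain (max_elts A).
Proof.
apply/antichainP => X Y; rewrite !inE => /andP [XA /forall_inP h] /andP [YA _] XY.
by have := h Y YA; rewrite XY => /eqP.
Qed.

Lemma bigcup_max_elts A : \bigcup_(C in max_elts A) C = \bigcup_(C in A) C.
Proof.
apply/eqP; rewrite eqEsubset; apply/andP; split; apply/bigcupsP => C CA.
  by apply: bigcup_sup; apply: (subsetP (max_elts_sub A)).
by have [C' C'A CC'] := max_eltsP CA; apply: (bigcup_max C').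
Qed.

Lemma nested_bigcup_factors A : A \subset S -> A != set0 ->
  [/\ flat (\bigcup_(C in A) C), \bigcup_(C in A) C != set0 &
      maxle BG (\bigcup_(C in A) C) \subset A].
Proof.
move=> AS A0; rewrite -bigcup_max_elts.
have m0 : max_elts A != set0.
  by case/set0Pn: A0 => C /max_eltsP [C' h _]; apply/set0Pn; exists C'.
have [h <-] := antichain_factors (subset_trans (max_elts_sub A) AS) (max_elts_antichain A) m0.
split; first exact: flat_cl.
  case/set0Pn: m0 => C Cm; have CS := subsetP AS C (subsetP (max_elts_sub A) C Cm).
  case/set0Pn: (nested_neq0 CS) => e eC; apply/set0Pn; exists e.
  by apply: (subsetP (cl_ext _ _)); apply/bigcupP; exists C.
exact: subset_trans (max_elts_sub A).
Qed.

Lemma nested_bigcup_flat A : A \subset S -> flat (\bigcup_(C in A) C).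
Proof.
move=> AS; have [->|A0] := eqVneq A set0; first by rewrite big_set0 flat0.
by case: (nested_bigcup_factors AS A0).
Qed.

(** This is how nestedness is mostly used: the factors of the union belong to [A], and an element of
    the building set lies below one factor. *)
Lemma nested_BG_bigcup A Y : A \subset S -> Y \in BG -> Y \subset \bigcup_(C in A) C ->
  exists2 C, C \in A & Y \subset C.
Proof.
move=> AS YB; have [->|A0] := eqVneq A set0.
  by rewrite big_set0 subset0 => Y0; move: (BG_neq0 YB); rewrite Y0.
case: (nested_bigcup_factors AS A0) => _ _ mA /(exists_factor YB) [K KF YK].
by exists K => //; apply: (subsetP mA).
Qed.

(** [X] is the factor of the join that contains [Y]. Any other factor is a union of members of [A]
    and, being in the building set, is one of them. *)
Lemma nested_cl_add A Y : A \subset S -> Y \in BG ->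
  exists X, [/\ X \in BG, Y \subset X, cl (\bigcup_(C in A) C :|: Y) = \bigcup_(C in A) C :|: X &
    maxle BG (\bigcup_(C in A) C :|: X) \subset X |: A].
Proof.
move=> AS YB; set J := \bigcup_(C in A) C; set F := cl _.
have fF : flat F by apply: flat_cl.
have JF : J \subset F by apply: subset_trans (cl_ext _ _); apply: subsetUl.
have YF : Y \subset F by apply: subset_trans (cl_ext _ _); apply: subsetUr.
have CF C : C \in A -> C \subset F by move=> CA; apply: subset_trans JF; apply: bigcup_sup.
have F0 : F != set0.
  by case/set0Pn: (BG_neq0 YB) => e eY; apply/set0Pn; exists e; apply: (subsetP YF).
have [X XF YX] := exists_factor YB YF.
have [XB XsF _] := maxleP _ _ XF.
have mA : maxle BG F \subset X |: A.
  apply/subsetP => K KF; rewrite in_setU1; case: eqP => //= /eqP KX.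
  have [KB _ _] := maxleP _ _ KF.
  pose AK := [set C in A | C \subset K].
  have AKS : AK \subset S.
    by apply: subset_trans AS; apply/subsetP => C; rewrite inE => /andP [].
  have KE : K = \bigcup_(C in AK) C.
    rewrite -[RHS](flatE (M := M)); last exact: nested_bigcup_flat.
    have -> : \bigcup_(C in AK) C = \bigcup_(C in X |: A | C \subset K) C.
      apply: eq_bigl => C; rewrite !inE; case: (C =P X) => [->|] //=.
      case: (X \in A) => //=; last first.
        apply/esym/negP => XK; move/eqP: KX; apply.
        case/set0Pn: (BG_neq0 XB) => e eX.
        by apply: (factor_disjoint fF F0 KF XF (e := e)) => //; apply: (subsetP XK).
    apply: (factor_join fF F0) => // [C|].
      rewrite in_setU1 => /orP [/eqP ->|CA]; first by exists X.
      by apply: exists_factor; rewrite ?CF ?nested_BG ?(subsetP AS).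
    apply: cl_mono; rewrite bigcup_setU big_set1 setUC; exact: setSU.
  have [|C] := nested_BG_bigcup AKS KB; first by rewrite -KE.
  rewrite inE => /andP [CA CK] KC; suff -> : K = C by [].
  by apply/eqP; rewrite eqEsubset KC CK.
have FE : F = J :|: X.
  apply/eqP; rewrite eqEsubset subUset JF XsF !andbT.
  rewrite {1}(cover_factors fF F0); apply/bigcupsP => K /(subsetP mA).
  rewrite in_setU1 => /orP [/eqP ->|KA]; first exact: subsetUr.
  by apply: subset_trans (subsetUl _ _); apply: bigcup_sup.
by exists X; split=> //; rewrite -FE.
Qed.

(** [G] is a factor of its union with the members of [A], so shrinking that coordinate to a smaller
    flat leaves a flat. Adding a basis of [X] one element at a time therefore raises both ranks by
    one at each step. *)
Lemma nested_disjoint_rk A G X : A \subset S -> G \in S -> [disjoint G & \bigcup_(C in A) C] ->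
  flat X -> X \subset G ->
  flat (X :|: \bigcup_(C in A) C) /\ rk (X :|: \bigcup_(C in A) C) = rk X + rk (\bigcup_(C in A) C).
Proof.
move=> AS GS dis fX XG; set Z := \bigcup_(C in A) C.
have GA : G |: A \subset S by rewrite subUset sub1set GS AS.
have GA0 : G |: A != set0 by apply/set0Pn; exists G; apply: setU11.
have [fF F0 mF] := nested_bigcup_factors GA GA0.
move: fF F0 mF; rewrite bigcup_setU big_set1 -/Z => fF F0 mF.
have GF : G \in maxle BG (G :|: Z).
  have [K KF GK] := exists_factor (nested_BG GS) (subsetUl G Z).
  case: (eqVneq K G) => [E|KG]; first by rewrite -{1}E.
  have := subsetP mF K KF; rewrite in_setU1 (negPf KG) /= => KA.
  case/set0Pn: (nested_neq0 GS) => e eG; case/negP: (negbT (disjointFr dis eG)).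
  by apply/bigcupP; exists K => //; apply: (subsetP GK).
have fl Y : flat Y -> Y \subset G -> flat (Y :|: Z).
  move=> fY YG.
  pose phi := [ffun K => if K == G then Y else if K \in maxle BG (G :|: Z) then K else set0].
  have p : in_prod M BG (G :|: Z) phi.
    apply/in_prodP; split=> K KF; rewrite ffunE; case: eqP => [E|_].
    - by rewrite E.
    - by rewrite KF; split=> //; apply: BG_flat; case/maxleP: KF.
    - by rewrite {1}E GF in KF.
    - by rewrite (negPf KF).
  have := flat_bigcup_factors fF F0 p; rewrite (bigD1 G) //= ffunE eqxx.
  suff -> : \bigcup_(K in maxle BG (G :|: Z) | K != G) phi K = Z by [].
  apply/eqP; rewrite eqEsubset; apply/andP; split.
    apply/bigcupsP => K /andP [KF KG]; rewrite ffunE (negPf KG) KF.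
    have := subsetP mF K KF; rewrite in_setU1 (negPf KG) /= => KA; exact: bigcup_sup.
  apply/subsetP => e eZ; have [|K KF eK] := factor_cover fF F0 (e := e); first by rewrite inE eZ orbT.
  have KG : K != G.
    by apply/eqP => E; move: (disjointFl dis eZ); rewrite -E eK.
  by apply/bigcupP; exists K; rewrite ?KF ?KG // ffunE (negPf KG) KF.
split; first exact: fl.
have [n] := ubnP (rk X); elim: n X fX XG => // n IH X fX XG ltn.
have [->|X0] := eqVneq X set0; first by rewrite set0U rk_set0.
have [s ss [sX cs]] := flat_basis_over (flat0 ll) fX (sub0set _).
rewrite rk_set0 subn0 set0U in ss cs.
have rX : 0 < rk X by apply: rk_gt0.
case: s ss sX cs => [|e s] /= ss sX cs; first by rewrite -ss in rX.
set X' := cl [set x in s].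
have eX : e \in X by apply: sX; rewrite inE eqxx.
have X'X : X' \subset X.
  by apply: cl_min => //; apply/subsetP => x; rewrite inE => xs; apply: sX; rewrite inE xs orbT.
have cX : cl (e |: X') = X.
  rewrite setUC cl_clU -[RHS]cs; congr (Defs.cl M _); apply/setP => x; rewrite !inE.
  by rewrite orbC.
have fX' : flat X' by apply: flat_cl.
have eX' : e \notin X'.
  apply/negP => eX'.
  have : rk X <= size s.
    rewrite -cX rk_cl (setUidPr _) ?sub1set // rk_cl (leq_trans (mrank_card _ _)) //.
    by rewrite cardsE card_size.
  by rewrite -ss ltnn.
have rX' : rk X = (rk X').+1 by rewrite -(rk_addflat fX' eX') -cX rk_cl.
have eZ : e \notin Z.
  by apply/negP => eZ; move: (disjointFl dis eZ); rewrite (subsetP XG).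
have IH' : rk (X' :|: Z) = rk X' + rk Z by apply: IH => //; [apply: subset_trans XG | rewrite rX' in ltn].
have fZ' := fl _ fX' (subset_trans X'X XG).
have -> : X :|: Z = cl (e |: (X' :|: Z)).
  apply/eqP; rewrite eqEsubset; apply/andP; split.
    rewrite subUset -{1}cX; apply/andP; split; first by apply: cl_mono; rewrite setUA subsetUl.
    by apply: subset_trans (cl_ext _ _); rewrite setUA subsetUr.
  apply: cl_min; first exact: fl.
  by rewrite !subUset sub1set !inE eX subsetUr (subset_trans X'X) ?subsetUl.
rewrite rk_cl rk_addflat //; last by rewrite inE negb_or eX'.
by rewrite IH' rX'.
Qed.

End Nested.
End BuildingSets.

(** * The forest of a nested set *)

Section Forest.
Variables (T : finType) (M : matroid T) (BG : {set {set T}}).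
Hypotheses (ll : loopless M) (bs : building_set M BG) (topBG : setT \in BG).
Implicit Types (X Y Z F G H K C P Q : {set T}) (S A B N : {set {set T}}) (e : T).
Local Notation rk := (mrank M).
Local Notation cl := (cl M).
Local Notation flat := (flat M).
Local Notation nested := (nested M BG).
Local Notation max_nested := (max_nested M BG).

Definition below S G := [set H in S | H \proper G].
(** The flat [J^G]: for nested [S] the union is already closed, see [JG_lower]. *)
Definition lower S G := \bigcup_(H in below S G) H.
(** In a maximal nested set these are the elements whose join with [J^G] is [G], so the label of [G]
    is the minimum of its block. *)
Definition block S G := G :\: lower S G.

Lemma below_sub S G : below S G \subset S.
Proof. by apply/subsetP => H; rewrite inE => /andP []. Qed.

Lemma lower_sub S G : lower S G \subset G.
Proof. by apply/bigcupsP => H; rewrite inE => /andP [_ /proper_sub]. Qed.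

Lemma sub_lower S G H : H \in S -> H \proper G -> H \subset lower S G.
Proof. by move=> HS HG; apply: bigcup_sup; rewrite inE HS. Qed.

Lemma lowerS N S G : N \subset S -> lower N G \subset lower S G.
Proof.
move=> /subsetP NS; apply/bigcupsP => H; rewrite inE => /andP [HN HG].
by apply: sub_lower => //; apply: NS.
Qed.

Lemma nested_setT S : nested S -> nested (setT |: S).
Proof.
move=> nS; have [SB h] := nestedP _ _ _ nS; apply/nestedP; split.
  by rewrite subUset sub1set topBG.
move=> B BS aB cB; apply: h => //; apply/subsetP => X XB.
have := subsetP BS X XB; rewrite in_setU1 => /orP [/eqP E|//].
have : B \subset [set setT].
  apply/subsetP => Y YB; rewrite inE; apply/eqP; have/antichainP := aB; apply => //.
  by rewrite -E.
by move/subset_leq_card; rewrite cards1 leqNgt cB.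
Qed.

Section NestedForest.
Variable S : {set {set T}}.
Hypothesis nS : nested S.

Lemma lower_flat G : flat (lower S G).
Proof. exact: (nested_bigcup_flat ll bs nS (below_sub S G)). Qed.

Lemma block_neq0 G : G \in S -> block S G != set0.
Proof.
move=> GS; apply/negP; rewrite setD_eq0 => h.
have [C] := nested_BG_bigcup ll bs nS (below_sub S G) (nested_BG nS GS) h.
by rewrite inE => /andP [_ /properP [_ [e eG eC]]] /subsetP /(_ e eG); rewrite (negPf eC).
Qed.

Lemma lower_proper G : G \in S -> lower S G \proper G.
Proof.
move=> GS; rewrite properE lower_sub /=; have := block_neq0 GS.
by rewrite setD_eq0.
Qed.

Lemma rk_lower G : G \in S -> rk (lower S G) < rk G.
Proof. by move=> GS; apply: flat_rk_lt (lower_flat _) (lower_proper GS). Qed.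

Lemma JG_lower G : JG M S G = lower S G.
Proof. exact: (flatE (lower_flat G)). Qed.

Lemma mem_block G e : e \in block S G -> e \in G.
Proof. by rewrite inE => /andP []. Qed.

Lemma block_min G H e : G \in S -> H \in S -> e \in block S G -> e \in H -> G \subset H.
Proof.
move=> GS HS; rewrite inE => /andP [eJ eG] eH.
have /orP [//|HG] := nested_cmp ll bs nS GS HS eG eH.
have [<- //|neq] := eqVneq H G.
case/negP: eJ; apply: (subsetP (sub_lower HS _)) => //.
by rewrite properEneq neq HG.
Qed.

Lemma block_inj G H e : G \in S -> H \in S -> e \in block S G -> e \in block S H -> G = H.
Proof.
move=> GS HS eG eH; apply/eqP; rewrite eqEsubset.
by rewrite (block_min GS HS eG) ?(block_min HS GS eH) ?(mem_block eG) ?(mem_block eH).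
Qed.

Lemma bigcap_chain (Q : {set {set T}}) e : Q \subset S -> Q != set0 ->
  (forall H, H \in Q -> e \in H) -> \bigcap_(H in Q) H \in Q.
Proof.
move=> QS /set0Pn [H0 H0Q] eQ.
case: (@arg_minnP _ H0 (fun H => H \in Q) (fun H => #|H|) H0Q) => H HQ Hmin.
suff -> : \bigcap_(H in Q) H = H by [].
apply/eqP; rewrite eqEsubset (bigcap_inf H) //=; apply/bigcapsP => K KQ.
have := nested_cmp ll bs nS (subsetP QS _ HQ) (subsetP QS _ KQ) (eQ _ HQ) (eQ _ KQ).
case/orP => // KH; suff -> : H = K by [].
by apply/esym/eqP; rewrite eqEcard KH; apply: Hmin.
Qed.

Definition top X := \bigcap_(H in [set H in S | X \subset H]) H.

Lemma topP X : setT \in S -> X != set0 ->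
  [/\ top X \in S, X \subset top X & forall H, H \in S -> X \subset H -> top X \subset H].
Proof.
move=> ES /set0Pn [e eX].
have := @bigcap_chain [set H in S | X \subset H] e.
have -> : [set H in S | X \subset H] \subset S by apply/subsetP => H; rewrite inE => /andP [].
have -> : [set H in S | X \subset H] != set0.
  by apply/set0Pn; exists setT; rewrite inE ES subsetT.
move=> /(_ isT isT) h; have : top X \in [set H in S | X \subset H].
  by apply: h => H; rewrite inE => /andP [_ /subsetP]; apply.
rewrite inE => /andP [h1 h2]; split=> // H HS XH; apply: bigcap_inf.
by rewrite inE HS.
Qed.

Lemma top_id G : G \in S -> top G = G.
Proof.
move=> GS; apply/eqP; rewrite eqEsubset; apply/andP; split.
  by apply: bigcap_inf; rewrite inE GS subxx.
by apply/bigcapsP => H; rewrite inE => /andP [].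
Qed.

(* Junk value: [par setT = setT], an empty intersection. *)
Definition par G := \bigcap_(H in [set H in S | G \proper H]) H.

Lemma parP G : setT \in S -> G \in S -> G != setT ->
  [/\ par G \in S, G \proper par G & forall H, H \in S -> G \proper H -> par G \subset H].
Proof.
move=> ES GS GT; have [e eG] := set0Pn _ (nested_neq0 bs nS GS).
have := @bigcap_chain [set H in S | G \proper H] e.
have -> : [set H in S | G \proper H] \subset S by apply/subsetP => H; rewrite inE => /andP [].
have -> : [set H in S | G \proper H] != set0.
  by apply/set0Pn; exists setT; rewrite inE ES properT.
move=> /(_ isT isT) h; have : par G \in [set H in S | G \proper H].
  by apply: h => H; rewrite inE => /andP [_ /proper_sub /subsetP]; apply.
rewrite inE => /andP [h1 h2]; split=> // H HS XH; apply: bigcap_inf.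
by rewrite inE HS.
Qed.

Lemma is_parentE G H : setT \in S -> G \in S -> G != setT ->
  is_parent S G H = (H == par G).
Proof.
move=> ES GS GT; have [pS pG pmin] := parP ES GS GT.
apply/and3P/eqP => [[HS GH /forall_inP h]|->].
  by apply/eqP; rewrite eqEsubset pmin // andbT; apply: (implyP (h _ pS)).
by split=> //; apply/forall_inP => H' H'S; apply/implyP/pmin.
Qed.

Lemma exists_block e : setT \in S -> exists2 G, G \in S & e \in block S G.
Proof.
move=> ES; have e0 : [set e] != set0 by apply/set0Pn; exists e; rewrite set11.
have [tS st tmin] := topP ES e0; exists (top [set e]) => //.
rewrite inE (subsetP st) ?set11 // andbT; apply/negP => /bigcupP [H].
rewrite inE => /andP [HS /properP [_ [f ft fH]]] eH.
have tH : top [set e] \subset H by apply: tmin; rewrite ?sub1set.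
by rewrite (subsetP tH f ft) in fH.
Qed.

(** Induction on [A], removing a member [G] of maximal cardinality. The members of [A] not below [G]
    are disjoint from it, so their union adds the same rank to [G] and to [lower S G]; the
    difference is the summand of [G]. *)
Lemma rk_down A : A \subset S ->
  (forall G H, G \in A -> H \in S -> H \subset G -> H \in A) ->
  rk (\bigcup_(G in A) G) = \sum_(G in A) (rk G - rk (lower S G)).
Proof.
have [n] := ubnP #|A|; elim: n A => // n IH A ltn AS dA.
have [->|/set0Pn [G0 G0A]] := eqVneq A set0; first by rewrite !big_set0 rk_set0.
case: (@arg_maxnP _ G0 (fun H => H \in A) (fun H => #|H|) G0A) => G GA Gmax.
have eqG C : C \in A -> G \subset C -> C = G.
  by move=> CA GC; apply/esym/eqP; rewrite eqEcard GC; apply: Gmax.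
have GS := subsetP AS G GA.
rewrite [RHS](big_setD1 G GA) /=.
have <- : rk (\bigcup_(C in A :\ G) C) = \sum_(C in A :\ G) (rk C - rk (lower S C)).
  apply: IH.
  - by have := cardsD1 G A; rewrite GA => E; rewrite E in ltn.
  - exact: subset_trans (subsetDl _ _) AS.
  - move=> K H; rewrite !in_setD1 => /andP [KG KA] HS HK.
    rewrite (dA K H) // andbT; apply/eqP => E; move/eqP: KG; apply.
    by apply: eqG => //; rewrite -E.
pose Z := [set C in A | ~~ (C \subset G)].
have ZS : Z \subset S by apply: subset_trans AS; apply/subsetP => C; rewrite inE => /andP [].
have dis : [disjoint G & \bigcup_(C in Z) C].
  rewrite disjoint_subset; apply/subsetP => e eG; rewrite !inE; apply/bigcupP => -[C].
  rewrite inE => /andP [CA nCG] eC.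
  have := nested_cmp ll bs nS (subsetP AS C CA) GS eC eG.
  by rewrite (negPf nCG) /= => /(eqG C CA) E; rewrite E subxx in nCG.
have -> : \bigcup_(C in A) C = G :|: \bigcup_(C in Z) C.
  apply/eqP; rewrite eqEsubset subUset bigcup_sup //=; apply/andP; split.
    apply/bigcupsP => C CA; case: (boolP (C \subset G)) => CG.
      exact: subset_trans (subsetUl _ _).
    by apply: subset_trans (subsetUr _ _); apply: bigcup_sup; rewrite inE CA.
  by apply/bigcupsP => C; rewrite inE => /andP [CA _]; apply: bigcup_sup.
have -> : \bigcup_(C in A :\ G) C = lower S G :|: \bigcup_(C in Z) C.
  apply/eqP; rewrite eqEsubset subUset; apply/and3P; split.
  - apply/bigcupsP => C; rewrite in_setD1 => /andP [CG CA]; case: (boolP (C \subset G)) => sCG.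
      apply: subset_trans (subsetUl _ _); apply: sub_lower; first exact: (subsetP AS).
      by rewrite properEneq CG.
    by apply: subset_trans (subsetUr _ _); apply: bigcup_sup; rewrite inE CA.
  - apply/bigcupsP => C; rewrite inE => /andP [CS CG]; apply: bigcup_sup.
    rewrite in_setD1 (dA G) ?proper_sub // andbT.
    by apply/eqP => E; rewrite E properxx in CG.
  - apply/bigcupsP => C; rewrite inE => /andP [CA CG]; apply: bigcup_sup.
    by rewrite in_setD1 CA andbT; apply/eqP => E; rewrite E subxx in CG.
have [_ ->] := nested_disjoint_rk ll bs nS ZS GS dis (nested_flat bs nS GS) (subxx _).
have [_ ->] := nested_disjoint_rk ll bs nS ZS GS dis (lower_flat G) (lower_sub S G).
by rewrite addnA subnK // ltnW ?rk_lower.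
Qed.

Lemma rk_setT_sum : setT \in S -> rk setT = \sum_(G in S) (rk G - rk (lower S G)).
Proof.
move=> ES; rewrite -rk_down //; congr (rk _); apply/eqP.
by rewrite eqEsubset subsetT (bigcup_sup setT) ?subsetT.
Qed.

(** [X] is the factor through [e] of the join of [J^G] and [e]. Suppose an antichain [B] through [X]
    has its join in the building set. If [B] stays inside [G], the join lies below [X] or below a
    member of [below S G]; otherwise below [G] or below a member of [B] not inside [G]. Each case
    contradicts the antichain, the position of [e] outside [J^G], or the existence of a member of
    [B] not inside [G]. *)
Lemma add_nested G e : G \in S -> e \in block S G ->
  exists X, [/\ X \in BG, e \in X, X \subset G, cl (lower S G :|: [set e]) = lower S G :|: X &
    nested (X |: S)].
Proof.
move=> GS; rewrite inE => /andP [eJ eG].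
have [X [XB aX cX mX]] := nested_cl_add ll bs nS (below_sub S G) (atom_BG ll bs e).
have eX : e \in X by apply: (subsetP aX); apply: mem_cl1.
rewrite -/(lower S G) in cX mX.
have cE : cl (lower S G :|: [set e]) = lower S G :|: X.
  by rewrite -cX setUC -cl_clU setUC.
have XG : X \subset G.
  apply: subset_trans (subsetUr (lower S G) X) _; rewrite -cE; apply: cl_min.
    exact: (nested_flat bs nS).
  by rewrite subUset lower_sub sub1set.
exists X; split=> //; apply/nestedP; split.
  by rewrite subUset sub1set XB; case/nestedP: nS.
move=> B BS aB cB; apply/negP => BB.
have [XinB|XnB] := boolP (X \in B); last first.
  have BS' : B \subset S.
    apply/subsetP => C CB; have := subsetP BS C CB; rewrite in_setU1.
    by case/orP => // /eqP E; rewrite -E CB in XnB.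
  by have [_ /(_ B BS' aB cB)] := nestedP _ _ _ nS; rewrite BB.
have BY C : C \in B -> C \subset join_fam M B.
  by move=> CB; apply: subset_trans (cl_ext _ _); apply: bigcup_sup.
have antiB := antichainP _ aB.
set Y := join_fam M B in BB BY.
have inS C : C \in B -> C != X -> C \in S.
  by move=> CB CX; have := subsetP BS C CB; rewrite in_setU1 (negPf CX).
have notX C : C \in B -> C != X -> ~~ (C \subset X).
  by move=> CB CX; apply: contra CX => CX; rewrite (antiB C X).
have notX' C : C \in B -> C != X -> ~~ (X \subset C).
  by move=> CB CX; apply: contra CX => XC; rewrite (antiB X C).
have notG C : C \in B -> C != X -> ~~ (G \subset C).
  by move=> CB CX; apply: contra (notX' C CB CX); apply: subset_trans.
have [C CB CX] : exists2 C, C \in B & C != X.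
  have := cardsD1 X B; rewrite XinB => cD; have /card_gt0P [C] : 0 < #|B :\ X| by rewrite cD in cB.
  by rewrite in_setD1 => /andP [CX CB]; exists C.
have [allsub|] := boolP [forall C in B, C \subset G].
  have YF : Y \subset lower S G :|: X.
    rewrite /Y /join_fam -cX; apply: cl_min; first exact: flat_cl.
    rewrite cX; apply/bigcupsP => D DB; have [->|DX] := eqVneq D X; first exact: subsetUr.
    apply: subset_trans (subsetUl _ _); apply: sub_lower; first exact: inS.
    rewrite properE (forall_inP allsub D DB) /=; exact: notG.
  have [K KF YK] := exists_factor BB YF.
  have := subsetP mX K KF; rewrite in_setU1 => /orP [/eqP E|].
    by case/negP: (notX C CB CX); rewrite -E; apply: subset_trans YK; apply: BY.
  rewrite inE => /andP [KS KG].
  case/negP: eJ; apply: (subsetP (sub_lower KS KG)); apply: (subsetP YK).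
  by apply: (subsetP (BY X XinB)).
rewrite negb_forall_in => /exists_inP [D DB DG].
have DX : D != X by apply: contraNneq DG => ->.
pose A := G |: [set C in B | ~~ (C \subset G)].
have AS : A \subset S.
  rewrite subUset sub1set GS /=; apply/subsetP => K; rewrite inE => /andP [KB KG].
  by apply: inS => //; apply: contraNneq KG => ->.
have YA : Y \subset \bigcup_(K in A) K.
  apply: cl_min; first exact: (nested_bigcup_flat ll bs nS).
  apply/bigcupsP => K KB; have [KG|KG] := boolP (K \subset G).
    by apply: (bigcup_max G); rewrite ?setU11.
  by apply: (bigcup_max K); rewrite // !inE KB KG orbT.
have [K] := nested_BG_bigcup ll bs nS AS BB YA.
rewrite !inE => /orP [/eqP ->|/andP [KB KG]] YK.
  by case/negP: DG; apply: subset_trans YK; apply: BY.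
have KX : K != X by apply: contraNneq KG => ->.
by case/negP: (notX' K KB KX); apply: subset_trans YK; apply: BY.
Qed.

End NestedForest.

Lemma max_nestedP S : reflect (nested S /\ forall S', nested S' -> S \subset S' -> S' = S)
  (max_nested S).
Proof.
apply: (iffP andP) => [[nS /forallP h]|[nS h]]; split=> //.
  by move=> S' nS' SS'; apply/eqP; apply: (implyP (h S')); rewrite nS' SS'.
by apply/forallP => S'; apply/implyP => /andP [nS' SS']; rewrite (h S').
Qed.

Section MaxNested.
Variable S : {set {set T}}.
Hypothesis mS : max_nested S.

Lemma max_nested_nested : nested S. Proof. by case/max_nestedP: mS. Qed.

Lemma max_nested_setT : setT \in S.
Proof.
have [nS h] := max_nestedP S mS; rewrite -(h _ (nested_setT nS) (subsetUr _ _)).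
exact: setU11.
Qed.

Lemma max_nested_cl G e : G \in S -> e \in block S G -> cl (lower S G :|: [set e]) = G.
Proof.
move=> GS eG; have [nS h] := max_nestedP S mS.
have [X [XB eX XG -> nX]] := add_nested nS GS eG.
have XS : X \in S by rewrite -(h _ nX (subsetUr _ _)) setU11.
have -> : X = G by apply/eqP; rewrite eqEsubset XG (block_min nS GS XS eG eX).
exact/setUidPr/lower_sub.
Qed.

Lemma max_nested_rk G : G \in S -> rk G = (rk (lower S G)).+1.
Proof.
move=> GS; have nS := max_nested_nested; have [e eG] := set0Pn _ (block_neq0 nS GS).
rewrite -{1}(max_nested_cl GS eG) rk_cl setUC rk_addflat ?lower_flat //.
by move: eG; rewrite inE => /andP [].
Qed.

Lemma max_nested_card : #|S| = rk setT.
Proof.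
rewrite (rk_setT_sum max_nested_nested max_nested_setT) -sum1_card.
by apply: eq_bigr => G GS; rewrite max_nested_rk // subSnn.
Qed.

End MaxNested.

(** In a nested set containing [E] the differences [rk G - rk (lower S G)] are positive and sum to
    [rk setT]. If all of them are 1, then [#|S| = rk setT], which no nested set containing [S]
    exceeds. *)
Lemma max_nested_of_rk S : nested S -> setT \in S ->
  (forall G, G \in S -> rk G <= (rk (lower S G)).+1) -> max_nested S.
Proof.
move=> nS ES r; apply/max_nestedP; split=> // S' nS' SS'.
apply/esym/eqP; rewrite eqEcard SS' /=.
have E1 := rk_setT_sum nS ES; have E2 := rk_setT_sum nS' (subsetP SS' _ ES).
rewrite -!sum1_card; apply: (@leq_trans (rk setT)).
  rewrite E2; apply: leq_sum => G GS; by rewrite subn_gt0 rk_lower.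
by rewrite E1; apply: leq_sum => G GS; rewrite leq_subLR addn1 r.
Qed.

End Forest.

(** * Labels, descents and completions of nested sets *)

Section Descents.
Variables (T : finType) (M : matroid T) (BG : {set {set T}}) (lt : rel T).
Hypotheses (ll : loopless M) (bs : building_set M BG) (topBG : setT \in BG).
Hypothesis sto : strict_total_order lt.
Implicit Types (X Y Z F G H K C P Q : {set T}) (S A B N D : {set {set T}}) (e : T).
Local Notation rk := (mrank M).
Local Notation cl := (cl M).
Local Notation flat := (flat M).
Local Notation nested := (nested M BG).
Local Notation max_nested := (max_nested M BG).

Definition pos (x : T) := #|[set y | lt y x]|.
(* The position of the minimum of [X]; the junk value for [X] empty is [#|T|]. *)
Definition lmin X := #|[set y | [forall e in X, lt y e]]|.

Lemma lt_pos x y : lt x y = (pos x < pos y).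
Proof.
have [irr [tr tot]] := sto.
have imp a b : lt a b -> pos a < pos b.
  move=> ab; apply: proper_card; apply/properP; split.
    by apply/subsetP => z; rewrite !inE => /tr; apply.
  by exists a; rewrite !inE ?ab ?irr.
apply/idP/idP => [/imp //|]; have [->|xy] := eqVneq x y; first by rewrite ltnn.
by case/orP: (tot x y xy) => // /imp; case: ltngtP.
Qed.

Lemma pos_inj : injective pos.
Proof.
have [irr [tr tot]] := sto; move=> x y E; apply/eqP/negPn/negP => /tot.
by rewrite !lt_pos E ltnn.
Qed.

Lemma lmin_le X e : e \in X -> lmin X <= pos e.
Proof.
by move=> eX; apply: subset_leq_card; apply/subsetP => y; rewrite !inE => /forall_inP; apply.
Qed.

Lemma lmin_ex X : X != set0 -> exists2 e, e \in X & pos e = lmin X.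
Proof.
case/set0Pn => e0 e0X; case: (@arg_minnP _ e0 (fun e => e \in X) pos e0X) => e eX emin.
exists e => //; apply/eqP; rewrite eqn_leq lmin_le // andbT; apply: subset_leq_card.
apply/subsetP => y; rewrite !inE => ye; apply/forall_inP => f fX; rewrite lt_pos.
by apply: leq_trans (emin f fX); rewrite -lt_pos.
Qed.

Definition lam S G := lmin (block S G).
(** Descents restated through minima of blocks, as an inequality between numbers; on maximal nested
    sets this is [descent], by [descentE]. *)
Definition dsc S G := [&& G \in S, G != setT & lam S (par S G) < lam S G].
Definition asc S G := [&& G \in S, G != setT & lam S G < lam S (par S G)].

Lemma lam_ex S G : nested S -> G \in S -> exists2 e, e \in block S G & pos e = lam S G.
Proof. by move=> nS GS; apply: lmin_ex; apply: (block_neq0 ll bs nS GS). Qed.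

Lemma lam_le S G e : e \in block S G -> lam S G <= pos e.
Proof. exact: lmin_le. Qed.

Lemma lam_inj S : nested S -> {in S &, injective (lam S)}.
Proof.
move=> nS G H GS HS; have [e eG <-] := lam_ex nS GS; have [f fH <-] := lam_ex nS HS.
by move/pos_inj => E; apply: (block_inj ll bs nS GS HS eG); rewrite E.
Qed.

Lemma ascNdsc S G : nested S -> setT \in S -> G \in S -> G != setT -> asc S G = ~~ dsc S G.
Proof.
move=> nS ES GS GT; rewrite /asc /dsc GS GT /= -leqNgt ltn_neqAle.
have [pS pG _] := parP ll bs nS ES GS GT.
case: eqP => // /(lam_inj nS GS pS) E; move: pG; rewrite -E properxx //.
Qed.

Lemma exists_child S H K : nested S -> setT \in S -> H \in S -> K \in S -> H \proper K ->
  exists K', [/\ K' \in S, K' != setT, H \subset K' & par S K' = K].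
Proof.
move=> nS ES HS KS HK.
have P0 : [&& H \in S, H \subset H & H \proper K] by rewrite HS subxx.
case: (@arg_maxnP _ H (fun C => [&& C \in S, H \subset C & C \proper K]) (fun C => #|C|) P0).
move=> K' /and3P [K'S HK' K'K] Kmax.
have K'T : K' != setT by apply: contraTneq K'K => ->; rewrite properE subsetT andbF.
exists K'; split=> //; have [pS pK' pmin] := parP ll bs nS ES K'S K'T.
apply/eqP; rewrite eqEsubset pmin //=; apply/negPn/negP => nKp.
have : #|par S K'| <= #|K'|.
  by apply: Kmax; rewrite pS (subset_trans HK' (proper_sub pK')) properE pmin.
by rewrite leqNgt proper_card.
Qed.

Section MaxNested.
Variable S : {set {set T}}.
Hypothesis mS : max_nested S.
Let nS := max_nested_nested mS.
Let ES := max_nested_setT topBG mS.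

Lemma is_lambdaP G e : G \in S -> is_lambda M lt S G e = (e \in block S G) && (pos e == lam S G).
Proof.
move=> GS; rewrite /is_lambda (JG_lower ll bs nS).
have E f : (cl (lower S G :|: [set f]) == G) = (f \in block S G).
  apply/eqP/idP => [E|]; last exact: (max_nested_cl ll bs mS).
  rewrite inE; apply/andP; split.
    apply/negP => fl; have := lower_proper ll bs nS GS.
    have fs : [set f] \subset lower S G by rewrite sub1set.
    by rewrite -{2}E (setUidPl fs) (flatE (lower_flat ll bs nS G)) properxx.
  by have := subsetP (cl_ext M (lower S G :|: [set f])) f; rewrite E !inE eqxx orbT; apply.
rewrite E; case: (boolP (e \in block S G)) => //= eG; apply/forallP/eqP => [h|h f].
  have [f fG fE] := lam_ex nS GS; have := h f; rewrite E fG /=.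
  case/orP => [/eqP -> //|]; rewrite lt_pos fE => lef.
  by have := lam_le eG; rewrite leqNgt lef.
rewrite E; apply/implyP => /lam_le; rewrite -h leq_eqVlt -lt_pos.
by case/orP => [/eqP/pos_inj ->|->]; rewrite ?eqxx ?orbT.
Qed.

Lemma descentE G : descent M lt S G = dsc S G.
Proof.
rewrite /descent /dsc; case: (boolP (G \in S)) => //= GS.
have [->|GT] /= := eqVneq G setT.
  apply/existsP => [[H /existsP [a /existsP [b /and4P [/and3P [_ GH _] _ _ _]]]]].
  by move: GH; rewrite properE subsetT andbF.
have [pS pG _] := parP ll bs nS ES GS GT.
apply/existsP/idP => [[H /existsP [a /existsP [b /and4P []]]]|h].
  rewrite (is_parentE ll bs nS) // => /eqP ->.
  by rewrite !is_lambdaP // lt_pos => /andP [_ /eqP ->] /andP [_ /eqP ->].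
have [[a aP aE] [b bG bE]] := (lam_ex nS pS, lam_ex nS GS).
exists (par S G); apply/existsP; exists a; apply/existsP; exists b.
by rewrite (is_parentE ll bs nS) // eqxx !is_lambdaP // aP bG aE bE lt_pos aE bE !eqxx.
Qed.

End MaxNested.

(** As long as some [G] has rank at least two above [lower N G], it is refined at the least element
    [e] of its block. The new [X] keeps [e] in its block, while the block of its parent in the final
    set is inside the old block of [G] and has no smaller element, so [X] is not a descent. *)
Lemma completion_exists N : nested N -> setT \in N ->
  exists S, [/\ max_nested S, N \subset S & forall G, dsc S G -> G \in N].
Proof.
have [n] := ubnP #|~: N|; elim: n N => // n IH N ltn nN EN.
have [/forall_inP h|] := boolP [forall G in N, rk G <= (rk (lower N G)).+1].
  exists N; split=> //; first exact: max_nested_of_rk.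
  by move=> G /and3P [].
rewrite negb_forall_in => /exists_inP [G GN]; rewrite -ltnNge => rG.
have [e eG eE] := lam_ex nN GN.
have [X [XB eX XG cX nX]] := add_nested ll bs nN GN eG.
have XN : X \notin N.
  apply/negP => XN; move: rG; rewrite ltnNge; case/negP.
  have E : X = G by apply/eqP; rewrite eqEsubset XG (block_min ll bs nN GN XN eG eX).
  move: cX; rewrite E (setUidPr (lower_sub N G)) => {1}<-; rewrite rk_cl setUC.
  exact: rk_subU1.
have [||S [mS XS dS]] := IH (X |: N) _ nX; last 1 first.
- have nS := max_nested_nested mS; have ES := max_nested_setT topBG mS.
  have NS : N \subset S by apply: subset_trans XS; apply: subsetUr.
  have XS' : X \in S by rewrite (subsetP XS) ?setU11.
  exists S; split=> // K dK; have := dS K dK; rewrite in_setU1 => /orP [/eqP KX|//].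
  move: dK; rewrite KX => /and3P [_ XT]; rewrite ltnNge; case/negP.
  have [pS pX pmin] := parP ll bs nS ES XS' XT.
  set P := par S X in pS pX pmin *.
  have [eJ _] : e \notin lower N G /\ e \in G by move: eG; rewrite inE => /andP [].
  have XpG : X \proper G.
    by rewrite properEneq XG andbT; apply/eqP => E; rewrite E GN in XN.
  have bP : block S P \subset block N G.
    apply/subsetP => f fP; rewrite inE; have fPP := mem_block fP; apply/andP; split.
      apply/negP => /bigcupP [C]; rewrite inE => /andP [CN CG] fC.
      case/negP: eJ; apply: (subsetP (sub_lower CN CG)).
      apply: (subsetP (block_min ll bs nS pS (subsetP NS _ CN) fP fC)).
      exact: (subsetP (proper_sub pX)).
    by apply: (subsetP (pmin G _ XpG)) => //; apply: (subsetP NS).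
  have eXb : e \in block S X.
    rewrite inE eX andbT; apply/negP => /bigcupP [H]; rewrite inE => /andP [HS HX] eH.
    have HA : H |: below N G \subset S.
      by rewrite subUset sub1set HS (subset_trans (below_sub N G)).
    have : X \subset \bigcup_(C in H |: below N G) C.
      apply: subset_trans (subsetUr (lower N G) X) _; rewrite -cX bigcup_setU big_set1 setUC.
      apply: cl_min; last by apply: setSU; rewrite sub1set.
      by have := nested_bigcup_flat ll bs nS HA; rewrite bigcup_setU big_set1.
    case/(nested_BG_bigcup ll bs nS HA XB) => C; rewrite in_setU1 => /orP [/eqP ->|CG] XC.
      by rewrite properE XC andbF in HX.
    by case/negP: eJ; apply/bigcupP; exists C => //; apply: (subsetP XC).
  apply: leq_trans (lam_le eXb) _; rewrite eE.
  have [f fP <-] := lam_ex nS pS; apply: lam_le; exact: (subsetP bP).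
- move: ltn; rewrite (cardsD1 X (~: N)) inE XN add1n ltnS; apply: leq_trans.
  by rewrite ltnS; apply: subset_leq_card; apply/subsetP => Y; rewrite !inE negb_or.
- by rewrite in_setU1 EN orbT.
Qed.

Section UniqueStep.
Variables S N : {set {set T}}.
Hypotheses (mS : max_nested S) (NS : N \subset S).
Hypothesis dS : forall G, dsc S G -> G \in N.
Let nS := max_nested_nested mS.
Let ES := max_nested_setT topBG mS.

(** The node [H] of [S] whose block contains [e] turns out to be [X]. A child of [H] outside [N] is
    ascending, so its label is below [e], the least element of the block of [G]; this label then
    lies in [lower N G], and the child with it. So [lower S H] is inside [lower N G], whence [X] and
    [H] contain each other. *)
Lemma completion_step G e X : G \in N -> e \in block N G -> pos e = lam N G ->
  X \in BG -> e \in X -> cl (lower N G :|: [set e]) = lower N G :|: X -> nested (X |: N) ->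
  X \in S.
Proof.
move=> GN eG eE XB eX cX nX.
have [H HS eH] := exists_block ll bs nS e ES.
have GS := subsetP NS G GN.
have HG : H \subset G by apply: (block_min ll bs nS HS GS eH (mem_block eG)).
have [eJ _] : e \notin lower N G /\ e \in G by move: eG; rewrite inE => /andP [].
have JH : lower S H \subset lower N G.
  apply/bigcupsP => K; rewrite inE => /andP [KS KH].
  have [K' [K'S K'T KK' pK']] := exists_child nS ES KS HS KH.
  have [_ K'p _] := parP ll bs nS ES K'S K'T; rewrite pK' in K'p.
  apply: subset_trans KK' _; have [K'N|K'N] := boolP (K' \in N).
    by apply: sub_lower => //; apply: proper_sub_trans HG.
  have : asc S K' by rewrite ascNdsc //; apply: contra K'N; apply: dS.
  case/and3P => _ _; rewrite pK' => lamK.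
  have [f fK fE] := lam_ex nS K'S.
  have fe : pos f < pos e by rewrite fE; apply: leq_trans lamK (lam_le eH).
  have [fl|fl] := boolP (f \in lower N G); last first.
    have : f \in block N G.
      by rewrite inE fl (subsetP HG) // (subsetP (proper_sub K'p)) // (mem_block fK).
    by move/lam_le; rewrite -eE leqNgt fe.
  case/bigcupP: fl => C CG fC; apply: subset_trans (bigcup_sup C CG).
  move: CG; rewrite inE => /andP [CN _].
  exact: (block_min ll bs nS K'S (subsetP NS _ CN) fK fC).
have HA : H |: below N G \subset S.
  by rewrite subUset sub1set HS (subset_trans (below_sub N G)).
have XA : X |: below N G \subset X |: N by apply: setUS; apply: below_sub.
have XH : X \subset H.
  have : X \subset \bigcup_(C in H |: below N G) C.
    apply: subset_trans (subsetUr (lower N G) X) _; rewrite -cX bigcup_setU big_set1 setUC.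
    apply: cl_min; last by apply: setSU; rewrite sub1set (mem_block eH).
    by have := nested_bigcup_flat ll bs nS HA; rewrite bigcup_setU big_set1.
  case/(nested_BG_bigcup ll bs nS HA XB) => C; rewrite in_setU1 => /orP [/eqP -> //|CG] XC.
  by case/negP: eJ; apply/bigcupP; exists C => //; apply: (subsetP XC).
have HX : H \subset X.
  have : H \subset \bigcup_(C in X |: below N G) C.
    rewrite bigcup_setU big_set1 setUC -/(lower N G) -cX -{1}(max_nested_cl ll bs mS HS eH).
    by apply: cl_mono; apply: setSU.
  case/(nested_BG_bigcup ll bs nX XA (nested_BG nS HS)) => C.
  rewrite in_setU1 => /orP [/eqP -> //|CG] HC.
  by case/negP: eJ; apply/bigcupP; exists C => //; apply: (subsetP HC); apply: mem_block eH.
by have -> : X = H by apply/eqP; rewrite eqEsubset XH HX.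
Qed.

End UniqueStep.

Lemma completion_unique N S1 S2 : setT \in N -> 
  max_nested S1 -> N \subset S1 -> (forall G, dsc S1 G -> G \in N) ->
  max_nested S2 -> N \subset S2 -> (forall G, dsc S2 G -> G \in N) -> S1 = S2.
Proof.
have [n] := ubnP #|~: N|; elim: n N => // n IH N ltn EN m1 NS1 d1 m2 NS2 d2.
have nN : nested N := nested_sub (max_nested_nested m1) NS1.
have [/forall_inP h|] := boolP [forall G in N, rk G <= (rk (lower N G)).+1].
  have mN := max_nested_of_rk ll bs nN EN h.
  have [_ hm] := max_nestedP _ _ _ mN.
  by rewrite (hm S1 (max_nested_nested m1) NS1) (hm S2 (max_nested_nested m2) NS2).
rewrite negb_forall_in => /exists_inP [G GN]; rewrite -ltnNge => rG.
have [e eG eE] := lam_ex nN GN.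
have [X [XB eX XG cX nX]] := add_nested ll bs nN GN eG.
have XN : X \notin N.
  apply/negP => XN; move: rG; rewrite ltnNge; case/negP.
  have E : X = G by apply/eqP; rewrite eqEsubset XG (block_min ll bs nN GN XN eG eX).
  move: cX; rewrite E (setUidPr (lower_sub N G)) => {1}<-; rewrite rk_cl setUC.
  exact: rk_subU1.
apply: (IH (X |: N)) => //.
- move: ltn; rewrite (cardsD1 X (~: N)) inE XN add1n ltnS; apply: leq_trans.
  by rewrite ltnS; apply: subset_leq_card; apply/subsetP => Y; rewrite !inE negb_or.
- by rewrite in_setU1 EN orbT.
- by rewrite subUset sub1set NS1 (completion_step m1 NS1 d1 GN eG).
- by move=> K /d1 KN; rewrite in_setU1 KN orbT.
- by rewrite subUset sub1set NS2 (completion_step m2 NS2 d2 GN eG).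
- by move=> K /d2 KN; rewrite in_setU1 KN orbT.
Qed.

End Descents.

(** * Ascending children *)

Section Complete.
Variables (T : finType) (M : matroid T) (BG : {set {set T}}) (lt : rel T).
Hypotheses (ll : loopless M) (bs : building_set M BG) (topBG : setT \in BG).
Hypotheses (sto : strict_total_order lt) (cmp : complete M BG lt).
Implicit Types (X Y Z F G H K C P Q : {set T}) (S A B N D : {set {set T}}) (e : T).
Local Notation rk := (mrank M).
Local Notation cl := (cl M).
Local Notation flat := (flat M).
Local Notation nested := (nested M BG).
Local Notation max_nested := (max_nested M BG).
Local Notation lam := (lam lt).
Local Notation dsc := (dsc lt).
Local Notation asc := (asc lt).
Local Notation pos := (pos lt).

Section OneMaxNested.
Variable S : {set {set T}}.
Hypothesis mS : max_nested S.
Let nS := max_nested_nested mS.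
Let ES := max_nested_setT topBG mS.

Lemma par_not_between H K C : K \in S -> K != setT -> par S K = H -> C \in S ->
  K \proper C -> C \proper H -> False.
Proof.
move=> KS KT <- CS KC; have [_ _ /(_ C CS KC) pC] := parP ll bs nS ES KS KT.
by rewrite properE pC andbF.
Qed.

Lemma asc_child_block K H e A : K \in S -> K != setT -> par S K = H -> e \in block S K ->
  A \subset below S H -> K \notin A -> e \notin \bigcup_(C in A) C.
Proof.
move=> KS KT pK eK AH KA; apply/bigcupP => -[C CA eC].
have := subsetP AH C CA; rewrite inE => /andP [CS CH].
have KC := block_min ll bs nS KS CS eK eC.
have neq : K != C by apply: contraNneq KA => ->.
by apply: (par_not_between KS KT pK CS _ CH); rewrite properEneq neq.
Qed.

(* With two ascending children [K1], [K2] of [H], the chain from the flat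
   [lower S H \ (block K1 u block K2)] to [H] would pass through [lower S H],
   which is not a join of that flat with an element of the building set. *)
Lemma asc_child_unique_lt H K1 K2 : H \in S -> asc S K1 -> asc S K2 ->
  par S K1 = H -> par S K2 = H -> lam S K1 < lam S K2 -> False.
Proof.
move=> HS /and3P [K1S K1T l1] /and3P [K2S K2T l2] p1 p2 l12.
rewrite p1 in l1; rewrite p2 in l2.
have [_ K1H _] := parP ll bs nS ES K1S K1T; rewrite p1 in K1H.
have [_ K2H _] := parP ll bs nS ES K2S K2T; rewrite p2 in K2H.
pose A := below S H :\ K1 :\ K2; set J := \bigcup_(C in A) C.
have AH : A \subset below S H by apply: subset_trans (subsetDl _ _) (subsetDl _ _).
have AS : A \subset S := subset_trans AH (below_sub S H).
have fJ : flat J := nested_bigcup_flat ll bs nS AS.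
have fS := lower_flat ll bs nS.
have JL : J \subset lower S H by apply/bigcupsP => C /(subsetP AH) /bigcup_sup ->.
have JH : J \subset H := subset_trans JL (lower_sub S H).
have [x xK2 xE] := lam_ex ll bs sto nS K2S.
have [y yK1 yE] := lam_ex ll bs sto nS K1S.
have neq : K1 != K2 by apply: contraTneq l12 => ->; rewrite ltnn.
have xJ : x \notin J by apply: (asc_child_block K2S K2T p2 xK2 AH); rewrite !inE eqxx.
have yJ : y \notin J by apply: (asc_child_block K1S K1T p1 yK1 AH); rewrite !inE eqxx andbF.
have xH : x \in H := subsetP (proper_sub K2H) x (mem_block xK2).
have yH : y \in H := subsetP (proper_sub K1H) y (mem_block yK1).
have notA C : C \in S -> C \proper H -> C \notin A -> C = K1 \/ C = K2.
  move=> CS CH; rewrite !inE CS CH /= !andbT negb_and !negbK.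
  by case/orP => /eqP; [right | left].
have lowK K : K = K1 \/ K = K2 -> lower S K \subset J.
  move=> KE; apply/bigcupsP => C; rewrite inE => /andP [CS CK].
  have KH : K \proper H by case: KE => ->.
  have CH := proper_trans CK KH.
  apply: bigcup_sup; apply/negPn/negP => /(notA C CS CH) E.
  case: KE E => E1 [] E2; subst K C; rewrite ?properxx // in CK.
    exact: (par_not_between K2S K2T p2 K1S).
  exact: (par_not_between K1S K1T p1 K2S).
(* [x] is the larger of the labels of [K1] and [K2], and it is below the label of [H]. So this
   initial segment contains [x] and [y] and misses the block of [H]. *)
set W := [set e in H :\: J | (e == x) || lt e x].
have FE : cl (J :|: W) = lower S H.
  apply/eqP; rewrite eqEsubset; apply/andP; split.
    apply: cl_min => //; rewrite subUset JL /=; apply/subsetP => f.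
    rewrite inE => /andP [/setDP [fH fJ'] fx].
    have fle : pos f <= lam S K2.
      rewrite -xE; case/orP: fx => [/eqP -> //|]; rewrite (lt_pos sto); exact: ltnW.
    apply/negPn/negP => fl; have : f \in block S H by rewrite inE fl fH.
    by move/(lam_le lt); rewrite leqNgt (leq_ltn_trans fle).
  apply/bigcupsP => C; rewrite inE => /andP [CS CH].
  have [CA|/(notA C CS CH)] := boolP (C \in A).
    apply: subset_trans (cl_ext _ _); apply: subset_trans (subsetUl _ _); exact: bigcup_sup.
  have xW : x \in W by rewrite !inE xJ xH eqxx.
  have yW : y \in W by rewrite !inE yJ yH (lt_pos sto) yE xE l12 orbT.
  case=> ->.
    rewrite -(max_nested_cl ll bs mS K1S yK1); apply: cl_mono; apply: setUSS.
      by apply: lowK => //; left.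
    by rewrite sub1set.
  rewrite -(max_nested_cl ll bs mS K2S xK2); apply: cl_mono; apply: setUSS.
    by apply: lowK => //; right.
  by rewrite sub1set.
have : lower S H \in Cchain M lt J H.
  rewrite -FE; apply/setU1P; right; apply/imsetP; exists x => //.
  by rewrite inE xJ.
move/(subsetP (cmp fJ (nested_BG nS HS) JH)).
have xL : x \in lower S H by apply: (subsetP (sub_lower K2S K2H)); apply: mem_block xK2.
have yL : y \in lower S H by apply: (subsetP (sub_lower K1S K1H)); apply: mem_block yK1.
rewrite in_setU in_set1 => /orP [|/eqP E]; last by rewrite E (negPf xJ) in xL.
rewrite inE => /andP []; rewrite in_setD1 => /andP [_ /imsetP [Y YB YE]] _.
have YL : Y \subset lower S H.
  by rewrite YE; apply: subset_trans (cl_ext _ _); apply: subsetUr.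
(* [Y] lies below a single [C] properly inside [H], so the join of [J] and [Y] misses the block of
   whichever of [K1] and [K2] differs from [C]. *)
have [C CH YC] := nested_BG_bigcup ll bs nS (below_sub S H) YB YL.
have key K e : K \in S -> K != setT -> par S K = H -> e \in block S K -> C != K ->
    K \notin A -> e \notin lower S H.
  move=> KS KT pK eK CK KA; rewrite YE; apply/negP => ecl.
  have CA : C |: A \subset below S H by rewrite subUset sub1set CH.
  have KCA : K \notin C |: A by rewrite in_setU1 negb_or KA eq_sym CK.
  case/negP: (asc_child_block KS KT pK eK CA KCA); apply: (subsetP _ e ecl).
  apply: cl_min; first exact: (nested_bigcup_flat ll bs nS (subset_trans CA (below_sub S H))).
  by rewrite bigcup_setU big_set1 setUC; apply: setSU.
have [E|CK1] := eqVneq C K1.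
  have CK2 : C != K2 by rewrite E.
  by move: xL; apply/negP; apply: (key K2 x) => //; rewrite !inE eqxx.
by move: yL; apply/negP; apply: (key K1 y) => //; rewrite !inE eqxx andbF.
Qed.

Lemma asc_child_unique K1 K2 : asc S K1 -> asc S K2 -> par S K1 = par S K2 -> K1 = K2.
Proof.
move=> a1 a2 E; have [/and3P [K1S K1T _] /and3P [K2S K2T _]] := (a1, a2).
have [pS _ _] := parP ll bs nS ES K1S K1T.
case: (ltngtP (lam S K1) (lam S K2)) => [l|l|/(lam_inj ll bs sto nS K1S K2S) //]; exfalso.
  exact: (asc_child_unique_lt pS a1 a2).
by apply: (asc_child_unique_lt pS a2 a1).
Qed.

(** * Segments of a maximal nested set over a subfamily containing its descents *)

Section Segments.
Variable N : {set {set T}}.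
Hypotheses (NS : N \subset S) (EN : setT \in N).
Hypothesis dN : forall G, dsc S G -> G \in N.
Let nN := nested_sub nS NS.

Lemma topNP X : X != set0 ->
  [/\ top N X \in N, X \subset top N X & forall H, H \in N -> X \subset H -> top N X \subset H].
Proof. exact: (topP ll bs nN EN). Qed.

Lemma topN_mono X Y : X != set0 -> Y != set0 -> X \subset Y -> top N X \subset top N Y.
Proof.
move=> X0 Y0 XY; have [_ _ h] := topNP X0; have [YN YY _] := topNP Y0.
by apply: h => //; apply: subset_trans YY.
Qed.

Lemma S_neq0 K : K \in S -> K != set0. Proof. exact: (nested_neq0 bs nS). Qed.

Lemma seg_asc K : K \in S -> K \notin N -> asc S K /\ top N (par S K) = top N K.
Proof.
move=> KS KN; have KT : K != setT by apply: contraNneq KN => ->.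
have [pS pK pmin] := parP ll bs nS ES KS KT.
split; first by rewrite (ascNdsc ll bs sto) //; apply: contra KN; apply: dN.
have [tN Kt tmin] := topNP (S_neq0 KS).
apply/eqP; rewrite eqEsubset; apply/andP; split.
  have [_ _ h] := topNP (S_neq0 pS); apply: h => //; apply: pmin; first exact: (subsetP NS).
  by rewrite properEneq Kt andbT; apply: contraNneq KN => ->.
by apply: topN_mono; rewrite ?S_neq0 // proper_sub.
Qed.

Lemma seg_lam K H : K \in S -> H \in S -> K \subset H -> top N K = top N H -> lam S K <= lam S H.
Proof.
have [n] := ubnP (#|H| - #|K|); elim: n K => // n IH K ltn KS HS KH tE.
have [-> //|neq] := eqVneq K H.
have pKH : K \proper H by rewrite properEneq neq.
have KN : K \notin N.
  apply/negP => KN; have := top_id KN; rewrite tE => E.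
  have [_ Ht _] := topNP (S_neq0 HS); rewrite E in Ht.
  by move: pKH; rewrite properE Ht andbF.
have [aK tK] := seg_asc KS KN; have [_ KT lK] := and3P aK.
have [pS pK pmin] := parP ll bs nS ES KS KT.
apply: leq_trans (ltnW lK) (IH _ _ pS HS _ _).
- have := proper_card pK; have := proper_card pKH.
  by move=> c1 c2; rewrite -ltnS; apply: leq_trans ltn; rewrite ltnS ltn_sub2l.
- exact: pmin.
- by rewrite tK.
Qed.

(** Two incomparable nodes of a segment would meet in a node [Q] still below their common [top N];
    the children of [Q] above them lie outside [N], so [Q] would have two ascending children. *)
Lemma seg_chain K H : K \in S -> H \in S -> top N K = top N H -> (K \subset H) || (H \subset K).
Proof.
move=> KS HS tE; apply/negPn; rewrite negb_or; apply/negP => /andP [KH HK].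
have U0 : K :|: H != set0.
  by have [e eK] := set0Pn _ (S_neq0 KS); apply/set0Pn; exists e; rewrite inE eK.
have [QS UQ Qmin] := topP ll bs nS ES U0; set Q := top S _ in QS UQ Qmin.
have [KQ HQ] : K \subset Q /\ H \subset Q by apply/andP; rewrite -subUset.
have [tN Kt _] := topNP (S_neq0 KS); have [_ Ht _] := topNP (S_neq0 HS); rewrite -tE in Ht.
have QP : Q \subset top N K.
  by apply: Qmin; [apply: (subsetP NS) | rewrite subUset Kt Ht].
have KQ' : K \proper Q.
  by rewrite properEneq KQ andbT; apply: contraNneq HK => ->.
have HQ' : H \proper Q.
  by rewrite properEneq HQ andbT; apply: contraNneq KH => ->.
have [K' [K'S K'T KK' pK']] := exists_child ll bs nS ES KS QS KQ'.
have [H' [H'S H'T HH' pH']] := exists_child ll bs nS ES HS QS HQ'.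
have ascend C C' : C \in S -> C' \in S -> C' != setT -> C \subset C' -> par S C' = Q ->
    top N C = top N K -> asc S C'.
  move=> CS C'S C'T CC' pC' tC.
  have [_ C'Q _] := parP ll bs nS ES C'S C'T; rewrite pC' in C'Q.
  have C'N : C' \notin N.
    apply/negP => C'N; have [_ _ /(_ C' C'N CC')] := topNP (S_neq0 CS); rewrite tC => tC'.
    by move: C'Q; rewrite properE (subset_trans QP tC') andbF.
  by case: (seg_asc C'S C'N).
have E : K' = H'.
  apply: asc_child_unique; last by rewrite pK'.
    exact: (ascend K).
  exact: (ascend H).
have [_ K'Q _] := parP ll bs nS ES K'S K'T; rewrite pK' in K'Q.
have : Q \subset K' by apply: Qmin; rewrite // subUset KK' E.
by move: K'Q; rewrite properE => /andP [_ /negP h] /h.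
Qed.

(** Suppose [G] is ascending with parent [K]. Both [K] and the node [H] whose block contains [e] lie
    in the segment of [par N G], a chain along which labels increase. If [H] contains [K], then [e]
    comes after the label of [G]; if [H] is properly below [K], then [K] has an ascending child
    other than [G]. *)
Lemma dsc_of_lt G e : G \in N -> G != setT -> e \in block N (par N G) -> pos e < lam S G ->
  dsc S G.
Proof.
move=> GN GT eP le; apply/negPn/negP => nd; have GS := subsetP NS G GN.
have aG : asc S G by rewrite (ascNdsc ll bs sto).
have [_ _ lG] := and3P aG.
have [PN GP Pmin] := parP ll bs nN EN GN GT; set P := par N G in PN GP Pmin eP.
have [KS GK Kmin] := parP ll bs nS ES GS GT; set K := par S G in KS GK Kmin lG.
have KP : K \subset P by apply: Kmin => //; apply: (subsetP NS).
have [tN Kt tmin] := topNP (S_neq0 KS).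
have tK : top N K = P.
  apply/eqP; rewrite eqEsubset tmin //=; apply: Pmin => //.
  exact: proper_sub_trans Kt.
have [H HS eH] := exists_block ll bs nS e ES.
have HP : H \subset P.
  by apply: (block_min ll bs nS HS _ eH (mem_block eP)); apply: (subsetP NS).
have [tHN Ht tHmin] := topNP (S_neq0 HS).
have tH : top N H = P.
  apply/eqP; rewrite eqEsubset tHmin //=; apply/negPn/negP => nPt.
  have : top N H \subset lower N P by apply: sub_lower => //; rewrite properE tHmin.
  move/subsetP/(_ e (subsetP Ht e (mem_block eH))).
  by move: eP; rewrite inE => /andP [/negP].
have [|KH|HK] := orP (seg_chain HS KS _); first by rewrite tH tK.
  have HK := KH; have [E|neq] := eqVneq H K.
    have := lam_le lt eH; rewrite E leqNgt => /negP; apply.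
    exact: leq_trans le (ltnW lG).
  have HK' : H \proper K by rewrite properEneq neq.
  have [K' [K'S K'T HK'' pK']] := exists_child ll bs nS ES HS KS HK'.
  have [_ K'K _] := parP ll bs nS ES K'S K'T; rewrite pK' in K'K.
  have K'N : K' \notin N.
    apply/negP => K'N; have := tHmin K' K'N HK''; rewrite tH => PK'.
    by move: K'K; rewrite properE (subset_trans KP PK') andbF.
  have [aK' _] := seg_asc K'S K'N.
  have E : K' = G by apply: asc_child_unique; rewrite ?pK'.
  by rewrite E GN in K'N.
have : lam S K <= lam S H by apply: seg_lam; rewrite ?tK ?tH.
have := lam_le lt eH => l1 l2.
by move: lG; rewrite ltnNge (leq_trans l2) // (leq_trans l1) // ltnW.
Qed.

End Segments.
End OneMaxNested.

(** * Completing a subfamily again *)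

Section Thin.
Variables S S' N : {set {set T}}.
Hypotheses (mS : max_nested S) (mS' : max_nested S').
Hypotheses (NS : N \subset S) (NS' : N \subset S') (EN : setT \in N).
Hypothesis dN : forall G, dsc S' G -> G \in N.
Let nS := max_nested_nested mS.
Let ES := max_nested_setT topBG mS.
Let nS' := max_nested_nested mS'.
Let ES' := max_nested_setT topBG mS'.
Let nN := nested_sub nS NS.

(** If the label of [G] were smaller in [S'], every node of [S'] in the segment of [G] would have a
    label below that of [G] in [S], hence inside [lower S G]. As a node is spanned by its label and
    the nodes below it, induction would put [G] itself inside [lower S G]. *)
Lemma lam_thin G : G \in N -> lam S G <= lam S' G.
Proof.
move=> GN; rewrite leqNgt; apply/negP => l.
have GS := subsetP NS G GN; have GS' := subsetP NS' G GN.
suff h H : H \in S' -> H \subset G -> H \subset lower S G.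
  by have := lower_proper ll bs nS GS; rewrite properE h ?andbF.
have [n] := ubnP #|H|; elim: n H => // n IH H ltn HS HG.
have [tN Ht tmin] := topNP mS' NS' EN (S_neq0 mS' HS).
have [E|neq] := eqVneq (top N H) G; last first.
  apply: subset_trans Ht _; apply: sub_lower; first exact: (subsetP NS).
  by rewrite properEneq neq tmin.
have [y yH yE] := lam_ex ll bs sto nS' HS.
rewrite -(max_nested_cl ll bs mS' HS yH); apply: cl_min; first exact: (lower_flat ll bs nS).
rewrite subUset; apply/andP; split.
  apply/bigcupsP => C; rewrite inE => /andP [CS CH]; apply: IH => //.
    by apply: leq_trans (proper_card CH) _; rewrite -ltnS.
  exact: subset_trans (proper_sub CH) HG.
rewrite sub1set; apply/negPn/negP => yl.
have yG : y \in block S G by rewrite inE yl (subsetP HG) // (mem_block yH).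
have := lam_le lt yG; rewrite leqNgt yE (leq_ltn_trans _ l) //.
by apply: (seg_lam mS' NS' EN dN) => //; rewrite E top_id.
Qed.

(** The label of the parent of [G] in [S] lies in the block of the parent of [G] in [N], and the
    label of [G] does not decrease from [S] to [S'], so [dsc_of_lt] applies. *)
Lemma dsc_thin G : G \in N -> dsc S G -> dsc S' G.
Proof.
move=> GN /and3P [GS GT lG].
have [PN GP Pmin] := parP ll bs nN EN GN GT; set P := par N G in PN GP Pmin.
have [KS GK Kmin] := parP ll bs nS ES GS GT; set K := par S G in KS GK Kmin lG.
have [e eK eE] := lam_ex ll bs sto nS KS.
have KP : K \subset P by apply: Kmin => //; apply: (subsetP NS).
apply: (@dsc_of_lt S' mS' N NS' EN dN G e) => //; last first.
  by rewrite eE; apply: leq_trans lG (lam_thin GN).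
rewrite inE (subsetP KP _ (mem_block eK)) andbT; apply/bigcupP => -[C].
rewrite inE => /andP [CN CP] eC.
have KC := block_min ll bs nS KS (subsetP NS C CN) eK eC.
have := Pmin C CN (proper_sub_trans GK KC).
by move: CP; rewrite properE => /andP [_ /negP h] /h.
Qed.

End Thin.

Definition has_asc_child S G := [exists K in S, asc S K && (par S K == G)].

Lemma Des_mem S G : max_nested S -> (G \in Des M lt S) = dsc S G.
Proof.
move=> mS; rewrite inE (descentE ll bs topBG sto mS) andb_idl //.
by case/and3P.
Qed.

(** A bottom descent has no children and a double descent only descending ones; together they are
    the descents without ascending child. *)
Lemma stableP S : reflect (max_nested S /\ forall G, dsc S G -> has_asc_child S G)
  (stable_max_nested M BG lt S).
Proof.
apply: (iffP andP) => -[mS h]; split=> //.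
  have nS := max_nested_nested mS; have ES := max_nested_setT topBG mS.
  move=> G dG; have [GS GT _] := and3P dG.
  have := forall_inP h G GS; rewrite /bottom_descent /double_descent !(descentE ll bs topBG sto mS) dG /=.
  case/andP => ->; rewrite negb_forall_in /= => /exists_inP [K KS].
  rewrite negb_imply => /andP [pK]; rewrite (descentE ll bs topBG sto mS) => nd.
  have KT : K != setT.
    by apply: contraTneq pK => ->; rewrite /is_parent properE subsetT andbF /= andbF.
  rewrite (is_parentE ll bs nS) // in pK.
  by apply/exists_inP; exists K => //; rewrite (ascNdsc ll bs sto) // nd eq_sym.
have nS := max_nested_nested mS; have ES := max_nested_setT topBG mS.
apply/forall_inP => G GS; rewrite -negb_or; apply/negP => bd.
have dG : dsc S G.
  by rewrite -(descentE ll bs topBG sto mS); case/orP: bd => [/andP []|/and3P []].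
have /exists_inP [K KS /andP [aK /eqP pK]] := h G dG.
have KT : K != setT by case/and3P: aK.
have [_ KG _] := parP ll bs nS ES KS KT; rewrite pK in KG.
case/orP: bd => [/andP [_]|/and3P [_ _ /forall_inP /(_ K KS)]].
  by rewrite /is_minimal; case/negP; apply/exists_inP; exists K.
rewrite (is_parentE ll bs nS) // pK eqxx (descentE ll bs topBG sto mS) /=.
by apply/negP; rewrite -(ascNdsc ll bs sto).
Qed.

Lemma stable_Des_inj S1 S2 : max_nested S1 -> max_nested S2 -> Des M lt S1 = Des M lt S2 -> S1 = S2.
Proof.
move=> m1 m2 E; have E1 := max_nested_setT topBG m1; have E2 := max_nested_setT topBG m2.
have sub S : max_nested S -> setT |: Des M lt S \subset S.
  by move=> mS; rewrite subUset sub1set (max_nested_setT topBG mS); apply/subsetP => G; rewrite inE => /andP [].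
have d1 G : dsc S1 G -> G \in setT |: Des M lt S1.
  by move=> dG; rewrite in_setU1 (Des_mem G m1) dG orbT.
have d2 G : dsc S2 G -> G \in setT |: Des M lt S1.
  by move=> dG; rewrite in_setU1 E (Des_mem G m2) dG orbT.
have sub2 := sub S2 m2; rewrite -E in sub2.
exact: (completion_unique ll bs topBG sto (setU11 _ _) m1 (sub S1 m1) d1 m2 sub2 d2).
Qed.

Lemma Des_subset_stable S D' : stable_max_nested M BG lt S -> D' \subset Des M lt S ->
  exists2 S', stable_max_nested M BG lt S' & Des M lt S' = D'.
Proof.
case/stableP => mS hS D'D.
have nS := max_nested_nested mS; have ES := max_nested_setT topBG mS.
have D'S G : G \in D' -> dsc S G by move/(subsetP D'D); rewrite Des_mem.
pose N := setT |: D'.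
have NS : N \subset S.
  by rewrite subUset sub1set ES; apply/subsetP => G /D'S /and3P [].
have EN : setT \in N by rewrite setU11.
have nN := nested_sub nS NS.
have [S' [mS' NS' dN]] := completion_exists ll bs topBG sto nN EN.
have nS' := max_nested_nested mS'; have ES' := max_nested_setT topBG mS'.
have dD G : dsc S' G = (G \in D').
  apply/idP/idP => [dG|GD].
    have := dN G dG; rewrite in_setU1 => /orP [/eqP E|//].
    by move: dG; rewrite E /dsc eqxx /= andbF.
  by apply: (dsc_thin mS mS' NS NS' EN dN); rewrite ?in_setU1 ?GD ?orbT ?D'S.
exists S'; last by apply/setP => G; rewrite Des_mem.
apply/stableP; split=> // G dG.
have GD : G \in D' by rewrite -dD.
have GS' : G \in S' by case/and3P: dG.
have dGS := D'S G GD; have GS : G \in S by case/and3P: dGS.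
have /exists_inP [K KS /andP [aK /eqP pK]] := hS G dGS.
have KT : K != setT by case/and3P: aK.
have [_ KG _] := parP ll bs nS ES KS KT; rewrite pK in KG.
apply: contraT => nex.
(* Without an ascending child, all children of [G] in [S'] belong to [N]. But the ascending child
   [K] of [G] in [S] is missing from [N], so [lower N G] is strictly inside [lower S G], although
   [lower S' G] and [lower S G] both have rank [rk G - 1]. *)
have low : lower S' G \subset lower N G.
  apply/bigcupsP => H; rewrite inE => /andP [HS HG].
  have [H' [H'S H'T HH' pH']] := exists_child ll bs nS' ES' HS GS' HG.
  have [_ H'G _] := parP ll bs nS' ES' H'S H'T; rewrite pH' in H'G.
  apply: subset_trans HH' _; apply: sub_lower => //; apply: dN.
  apply/negPn/negP; rewrite -(ascNdsc ll bs sto) // => aH; case/negP: nex.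
  by apply/exists_inP; exists H'; rewrite // aH pH' eqxx.
have [y yK] := set0Pn _ (block_neq0 ll bs nS KS).
have pr : lower N G \proper lower S G.
  apply/properP; split; first exact: lowerS.
  exists y; first by apply: (subsetP (sub_lower KS KG)); apply: mem_block yK.
  apply: (asc_child_block mS KS KT pK yK).
    by apply/subsetP => C; rewrite [in X in X -> _]in_set [in X in _ -> X]in_set => /andP [/(subsetP NS) -> ->].
  rewrite !inE KG andbT (negPf KT) /=; apply/negP => KD.
  by move: aK; rewrite (ascNdsc ll bs sto) // D'S.
have := flat_rk_lt (lower_flat ll bs nN G) pr; have := mrank_mono M low.
have := max_nested_rk ll bs mS GS; have := max_nested_rk ll bs mS' GS' => -> [->] h1 h2.
by move: (leq_trans h2 h1); rewrite ltnn.
Qed.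

(** A descent of a stable set has an ascending child, so it is not an atom. If [G] were the closure
    of an initial segment, the label [k] of its parent, which is not in [G], would come after the
    whole segment; as the label of [G] comes after [k], the segment would lie in [lower S G], and
    [G] with it. *)
Lemma Des_subset_V S : stable_max_nested M BG lt S -> Des M lt S \subset Vset M BG lt.
Proof.
case/stableP => mS hS; have nS := max_nested_nested mS; have ES := max_nested_setT topBG mS.
apply/subsetP => G; rewrite Des_mem // => dG; have [GS GT lG] := and3P dG.
rewrite inE (nested_BG nS GS) andbT in_setU negb_or; apply/andP; split; last first.
  rewrite inE (nested_flat bs nS GS) /=.
  have /exists_inP [K KS /andP [aK /eqP pK]] := hS G dG.
  have KT : K != setT by case/and3P: aK.
  have [_ KG _] := parP ll bs nS ES KS KT; rewrite pK in KG.
  have := flat_rk_lt (nested_flat bs nS KS) KG.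
  have := rk_gt0 ll (S_neq0 mS KS) => k1 k2.
  by rewrite gtn_eqF // (leq_ltn_trans k1 k2).
apply/negP; rewrite in_setU1 (negPf (S_neq0 mS GS)) /= => /imsetP [x _].
rewrite set0U setD0 => GE; set W := [set e in setT | _] in GE.
have [pS pG _] := parP ll bs nS ES GS GT.
have [k kK kE] := lam_ex ll bs sto nS pS.
have kG : k \notin G.
  apply/negP => kG; have := sub_lower GS pG => /subsetP /(_ k kG).
  by move: kK; rewrite inE => /andP [/negP].
have : G \subset lower S G.
  rewrite {1}GE; apply: cl_min; first exact: (lower_flat ll bs nS).
  apply/subsetP => f fW; apply/negPn/negP => fl.
  have fG : f \in G by rewrite GE (subsetP (cl_ext _ _)).
  have fb : f \in block S G by rewrite inE fl.
  have := lam_le lt fb; rewrite leqNgt => /negP; apply; apply: ltn_trans lG; rewrite -kE.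
  have fx : pos f <= pos x.
    by move: fW; rewrite !inE /= (lt_pos sto) => /orP [/eqP -> //|/ltnW].
  apply: leq_ltn_trans fx _; rewrite ltnNge; apply/negP => kx; case/negP: kG.
  rewrite GE; apply: (subsetP (cl_ext _ _)); rewrite !inE /= (lt_pos sto).
  by move: kx; rewrite leq_eqVlt => /orP [/eqP/(pos_inj sto) ->|->]; rewrite ?eqxx ?orbT.
by have := lower_proper ll bs nS GS; rewrite properE => /andP [_ /negP].
Qed.

End Complete.

(** * Forests marked by words *)

Section ChainCount.
Variable (U : finType).
Implicit Types (C : {set {set U}}) (X Y : {set U}).

Definition height C X := #|[set Y in C | Y \subset X]|.

Lemma chain_height_count C k :
  (forall X Y, X \in C -> Y \in C -> (X \subset Y) || (Y \subset X)) ->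
  k <= #|C| -> #|[set X in C | height C X <= k]| = k.
Proof.
have [n] := ubnP #|C|; elim: n C k => // n IH C k ltn ch kC.
have hC X : height C X <= #|C|.
  by apply: subset_leq_card; apply/subsetP => Y; rewrite inE => /andP [].
have [E|neq] := eqVneq k #|C|.
  by rewrite E; congr #|pred_of_set _|; apply/setP => X; rewrite inE hC andbT.
have kC' : k < #|C| by rewrite ltn_neqAle neq.
have /card_gt0P [X0 X0C] : 0 < #|C| by apply: leq_ltn_trans kC'.
case: (@arg_maxnP _ X0 (fun H => H \in C) (fun H => #|H|) X0C) => X XC Xmax.
have leX Y : Y \in C -> Y \subset X.
  move=> YC; case/orP: (ch X Y XC YC) => // XY.
  suff -> : X = Y by [].
  by apply/eqP; rewrite eqEcard XY; apply: Xmax.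
have hX : height C X = #|C|.
  by apply/eqP; rewrite eqn_leq hC /=; apply: subset_leq_card; apply/subsetP => Y YC; rewrite inE YC leX.
have cD : #|C| = (#|C :\ X|).+1 by rewrite (cardsD1 X) XC.
have hD Y : Y \in C :\ X -> height C Y = height (C :\ X) Y.
  rewrite in_setD1 => /andP [YX YC]; congr #|pred_of_set _|; apply/setP => Z; rewrite !inE.
  have [->|//] := eqVneq Z X; rewrite XC /=; apply/negP => XY.
  by case/eqP: YX; apply/eqP; rewrite eqEsubset XY leX.
rewrite -[RHS](IH (C :\ X)).
- congr #|pred_of_set _|; apply/setP => Y; rewrite [LHS]inE [RHS]inE.
  have [->|YX] := eqVneq Y X; first by rewrite XC hX setD11 leqNgt kC'.
  by rewrite in_setD1 YX /=; case: (boolP (Y \in C)) => //= YC; rewrite hD // in_setD1 YX.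
- by rewrite -ltnS -cD.
- by move=> Y Z; rewrite !in_setD1 => /andP [_ YC] /andP [_]; apply: ch.
- by rewrite -ltnS -cD.
Qed.

Lemma chain_height_mem C (V : {set {set U}}) X :
  (forall X Y, X \in C -> Y \in C -> (X \subset Y) || (Y \subset X)) ->
  V \subset C -> (forall X Y, X \in C -> Y \in V -> X \subset Y -> X \in V) ->
  X \in C -> (X \in V) = (height C X <= #|V|).
Proof.
move=> ch VC dV XC; apply/idP/idP => [XV|].
  by apply: subset_leq_card; apply/subsetP => Y; rewrite inE => /andP [YC]; apply: dV.
apply: contraLR => XV; rewrite -ltnNge; apply: proper_card; apply/properP; split.
  apply/subsetP => Y YV; have YC := subsetP VC Y YV; rewrite inE YC.
  by case/orP: (ch X Y XC YC) => // /(dV X Y XC YV) h; rewrite h in XV.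
by exists X; rewrite // inE XC subxx.
Qed.

Lemma card_split (A : {set U}) (P : pred U) :
  #|A| = #|[set x in A | P x]| + #|[set x in A | ~~ P x]|.
Proof.
by rewrite -(cardsID [set x | P x] A); congr addn; apply: eq_card => x; rewrite !inE // andbC.
Qed.

End ChainCount.

Section Words.
Variables (T : finType) (M : matroid T) (BG : {set {set T}}) (lt : rel T).
Hypotheses (ll : loopless M) (bs : building_set M BG) (topBG : setT \in BG).
Hypotheses (sto : strict_total_order lt) (cmp : complete M BG lt).
Implicit Types (X Y Z F G H K C P Q : {set T}) (S A B N D U : {set {set T}}) (e : T).
Local Notation rk := (mrank M).
Local Notation cl := (cl M).
Local Notation flat := (flat M).
Local Notation nested := (nested M BG).
Local Notation max_nested := (max_nested M BG).
Local Notation lam := (lam lt).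
Local Notation dsc := (dsc lt).
Local Notation asc := (asc lt).
Local Notation has_asc_child := (has_asc_child lt).

Definition seg S N G := [set H in S | top N H == G].
(* A word is identified with the set of nodes carrying the letter 1. The nodes of [S] with the
   same [top N] form a chain, read upwards as a block of 1s followed by a block of 0s; [cuts]
   recovers the tops of these chains as the places where a 0 is followed by a 1. *)
Definition word S N (m : {set T} -> nat) :=
  [set H in S | height (seg S N (top N H)) H <= m (top N H)].
Definition cuts S U :=
  [set G in S | (G == setT) || (G \notin U) && (dsc S G || (par S G \in U))].
Definition segcount S U G :=
  if G \in cuts S U then #|U :&: seg S (cuts S U) G| else 0.
(** The constraints on the words of a monomial of degree [i]: 1 at nodes without ascending child, 0
    at descents, and [i.+1] ones because the exponent of [E] is raised by one. *)
Definition admissible S U i :=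
  [&& U \subset S, [forall K in S, ~~ has_asc_child S K ==> (K \in U)],
      [forall G in U, ~~ dsc S G] & #|U| == i.+1].

Section OneMaxNested.
Variable S : {set {set T}}.
Hypothesis mS : max_nested S.
Let nS := max_nested_nested mS.
Let ES := max_nested_setT topBG mS.

Section Segments.
Variable N : {set {set T}}.
Hypotheses (NS : N \subset S) (EN : setT \in N).
Hypothesis dN : forall G, dsc S G -> G \in N.
Let nN := nested_sub nS NS.

Lemma mem_seg H : H \in S -> H \in seg S N (top N H).
Proof. by move=> HS; rewrite inE HS eqxx. Qed.

Lemma seg_sub G : seg S N G \subset S.
Proof. by apply/subsetP => H; rewrite inE => /andP []. Qed.

Lemma seg_is_chain G X Y : X \in seg S N G -> Y \in seg S N G -> (X \subset Y) || (Y \subset X).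
Proof.
rewrite !inE => /andP [XS /eqP XG] /andP [YS /eqP YG].
by apply: (seg_chain ll bs topBG sto cmp mS NS EN dN XS YS); rewrite XG.
Qed.

(** Each node of a maximal nested set has rank one above its [lower], so by [rk_down] the numbers of
    nodes below [G] and below [lower N G] are the ranks of these flats; the segment is the
    difference. *)
Lemma card_seg G : G \in N -> #|seg S N G| = rk G - rk (lower N G).
Proof.
move=> GN; have GS := subsetP NS G GN.
pose A := [set H in S | H \subset G]; pose A' := [set H in S | H \subset lower N G].
have A'A : A' \subset A.
  by apply/subsetP => H; rewrite !inE => /andP [-> /subset_trans]; apply; apply: lower_sub.
have AS : A \subset S by apply/subsetP => H; rewrite inE => /andP [].
have sumA B : B \subset S -> \sum_(H in B) (rk H - rk (lower S H)) = #|B|.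
  move=> BS; rewrite -sum1_card; apply: eq_bigr => H HB.
  by rewrite (max_nested_rk ll bs mS (subsetP BS H HB)) subSnn.
have UA : \bigcup_(H in A) H = G.
  apply/eqP; rewrite eqEsubset (bigcup_sup G) ?inE ?GS ?subxx // andbT.
  by apply/bigcupsP => H; rewrite inE => /andP [].
have UA' : \bigcup_(H in A') H = lower N G.
  apply/eqP; rewrite eqEsubset; apply/andP; split.
    by apply/bigcupsP => H; rewrite inE => /andP [].
  apply/bigcupsP => H HG; apply: bigcup_sup; rewrite inE; apply/andP; split.
    exact: (subsetP NS _ (subsetP (below_sub N G) H HG)).
  exact: bigcup_sup.
have e1 : #|A| = rk G.
  rewrite -(sumA A AS) -(rk_down ll bs nS AS) ?UA // => K H; rewrite !inE => /andP [_ KG] HS HK.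
  by rewrite HS (subset_trans HK).
have A'S := subset_trans A'A AS.
have e2 : #|A'| = rk (lower N G).
  rewrite -(sumA A' A'S) -(rk_down ll bs nS A'S) ?UA' // => K H; rewrite !inE => /andP [_ KG] HS HK.
  by rewrite HS (subset_trans HK).
rewrite -e1 -e2 -cardsDS //; congr #|pred_of_set _|; apply/setP => H; rewrite [LHS]inE in_setD !inE.
case: (boolP (H \in S)) => HS /=; last by rewrite ?andbF.
have [tN Ht tmin] := topNP ll bs mS NS EN (S_neq0 bs mS HS).
apply/eqP/andP => [tE|[nl HG]].
  split; last by rewrite -tE.
  apply/negP => Hl.
  have [C] := nested_BG_bigcup ll bs nN (below_sub N G) (nested_BG nS HS) Hl.
  rewrite inE => /andP [CN CG] /(tmin C CN); rewrite tE => GC.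
  by move: CG; rewrite properE GC andbF.
apply/eqP; apply: contraNT nl => neq; apply: subset_trans Ht _.
by apply: sub_lower => //; rewrite properEneq neq tmin.
Qed.

Lemma height_top G : G \in N -> height (seg S N G) G = #|seg S N G|.
Proof.
move=> GN; congr #|pred_of_set _|; apply/setP => H; rewrite [LHS]inE.
case: (boolP (H \in seg S N G)) => //=; rewrite inE => /andP [HS /eqP <-].
by have [_ Ht _] := topNP ll bs mS NS EN (S_neq0 bs mS HS).
Qed.

Lemma height_par K : K \in S -> K \notin N ->
  height (seg S N (top N K)) (par S K) = (height (seg S N (top N K)) K).+1.
Proof.
move=> KS KN; have [aK tK] := seg_asc ll bs topBG sto mS NS EN dN KS KN.
have KT : K != setT by case/and3P: aK.
have [pS pK pmin] := parP ll bs nS ES KS KT.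
rewrite /height (cardsD1 (par S K)) inE subxx andbT -tK mem_seg // tK add1n; congr (_.+1).
congr #|pred_of_set _|; apply/setP => H; rewrite in_setD1 [in LHS]inE [in RHS]inE.
case: (boolP (H \in seg S N (top N K))) => /= HG; last by rewrite andbF.
have HS := subsetP (seg_sub _) H HG.
apply/andP/idP => [[HpK Hp]|HK].
  case/orP: (seg_is_chain HG (mem_seg KS)) => // KH.
  have [<- //|neq] := eqVneq K H.
  have pH : par S K \subset H by apply: pmin; rewrite // properEneq neq.
  by case/negP: HpK; rewrite eqEsubset Hp pH.
split; last exact: subset_trans HK (proper_sub pK).
by apply: contraTneq HK => ->; move: pK; rewrite properE => /andP [].
Qed.

Lemma height_bottom H : H \in S ->
  (forall K, K \in S -> K != setT -> par S K = H -> K \in N) ->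
  height (seg S N (top N H)) H = 1.
Proof.
move=> HS nc; rewrite -(cards1 H); congr #|pred_of_set _|; apply/setP => K.
rewrite in_set1 inE; apply/andP/eqP => [[KG KH]|->]; last by rewrite mem_seg.
apply/eqP; apply: contraT => neq; have KH' : K \proper H by rewrite properEneq neq.
have KS := subsetP (seg_sub _) K KG.
have [K' [K'S K'T KK' pK']] := exists_child ll bs nS ES KS HS KH'.
have [_ K'H _] := parP ll bs nS ES K'S K'T; rewrite pK' in K'H.
have K'N := nc K' K'S K'T pK'.
have [_ _ /(_ K' K'N KK')] := topNP ll bs mS NS EN (S_neq0 bs mS KS).
move: KG; rewrite inE => /andP [_ /eqP ->] tK'.
have [_ Ht _] := topNP ll bs mS NS EN (S_neq0 bs mS HS).
by move: K'H; rewrite properE (subset_trans Ht tK') andbF.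
Qed.

Lemma sum_seg (V : {set {set T}}) : V \subset S ->
  #|V| = \sum_(G in N) #|V :&: seg S N G|.
Proof.
move=> VS; rewrite -sum1_card (partition_big (top N) (mem N)) /=.
  apply: eq_bigr => G GN; rewrite -sum1_card; apply: eq_bigl => H.
  by rewrite !inE; case: (boolP (H \in V)) => //= HV; rewrite (subsetP VS).
by move=> H /(subsetP VS) HS; have [] := topNP ll bs mS NS EN (S_neq0 bs mS HS).
Qed.

(** * From exponents to words *)

Section Forward.
Variable m : {set T} -> nat.
Hypothesis mN : forall G, (0 < m G) = (G \in N).
Hypothesis m_lt : forall G, G \in N -> m G + (G != setT) <= rk G - rk (lower N G).

Lemma word_sub : word S N m \subset S.
Proof. by apply/subsetP => H; rewrite inE => /andP []. Qed.

Lemma word_top G : G \in N -> G != setT -> G \notin word S N m.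
Proof.
move=> GN GT; rewrite inE negb_and (top_id GN) height_top // card_seg //.
by rewrite -ltnNge; have := m_lt GN; rewrite GT addn1 => ->; rewrite orbT.
Qed.

Lemma word_bottom H : H \in S ->
  (forall K, K \in S -> K != setT -> par S K = H -> K \in N) -> H \in word S N m.
Proof.
move=> HS nc; rewrite inE HS height_bottom // mN.
by have [] := topNP ll bs mS NS EN (S_neq0 bs mS HS).
Qed.

Lemma word_seg G : G \in N -> #|word S N m :&: seg S N G| = m G.
Proof.
move=> GN; have le : m G <= #|seg S N G|.
  by rewrite card_seg //; apply: leq_trans (m_lt GN); rewrite leq_addr.
rewrite -[RHS](chain_height_count (@seg_is_chain G) le); congr #|pred_of_set _|.
apply/setP => H; rewrite in_setI [RHS]inE andbC.
case: (boolP (H \in seg S N G)) => //=; rewrite inE => /andP [HS /eqP tE].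
by rewrite inE HS tE.
Qed.

(** A node [G] of [N] other than [E] is the top of its segment and carries 0. If it is ascending, it
    is the only ascending child of its parent, which is then the bottom of a segment and carries 1.
    For [G] outside [N] the parent is the next node of the same segment, so a 0 at [G] is followed
    by a 0. *)
Lemma word_cuts : cuts S (word S N m) = N.
Proof.
apply/setP => G; rewrite inE; have [->|GT] /= := eqVneq G setT; first by rewrite ES EN.
case: (boolP (G \in N)) => GN.
  have GS := subsetP NS G GN; rewrite GS word_top //=.
  case: (boolP (dsc S G)) => //= nd; have aG : asc S G by rewrite (ascNdsc ll bs sto).
  have [pS _ _] := parP ll bs nS ES GS GT.
  apply: word_bottom => // K KS KT pK; apply: contraT => KN.
  have [aK _] := seg_asc ll bs topBG sto mS NS EN dN KS KN.
  by rewrite (asc_child_unique ll bs topBG sto cmp mS aK aG pK) GN in KN.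
apply/negbTE; rewrite !negb_and negb_or negbK.
case: (boolP (G \in S)) => //= GS; case: (boolP (G \in word S N m)) => //= GW.
have [aG tG] := seg_asc ll bs topBG sto mS NS EN dN GS GN.
rewrite -(ascNdsc ll bs sto) // aG /=.
rewrite inE negb_and tG height_par // -ltnNge ltnS ltnW ?orbT //.
by move: GW; rewrite inE GS /= -ltnNge.
Qed.

Lemma word_segcount G : segcount S (word S N m) G = m G.
Proof.
rewrite /segcount word_cuts; case: ifPn => GN; first exact: word_seg.
by apply/esym/eqP; rewrite -leqn0 leqNgt mN.
Qed.

Lemma word_admissible i : \sum_(G in N) m G = i.+1 -> admissible S (word S N m) i.
Proof.
move=> si; apply/and4P; split; first exact: word_sub.
- apply/forall_inP => K KS; apply/implyP => nc; apply: word_bottom => // H HS HT pH.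
  apply: contraT => HN; have [aH _] := seg_asc ll bs topBG sto mS NS EN dN HS HN.
  by case/negP: nc; apply/exists_inP; exists H; rewrite // aH pH eqxx.
- apply/forall_inP => G GW; apply/negP => dG; have [GS GT _] := and3P dG.
  by rewrite (negPf (word_top (dN dG) GT)) in GW.
- rewrite sum_seg ?word_sub // -si; apply/eqP/eq_bigr => G GN; exact: word_seg.
Qed.

End Forward.
End Segments.

(** * From words back to exponents *)

Section Backward.
Variables (U : {set {set T}}) (i : nat).
Hypothesis aU : admissible S U i.
Let N := cuts S U.

Lemma cuts_sub : N \subset S.
Proof. by apply/subsetP => G; rewrite inE => /andP []. Qed.
Let NS := cuts_sub.

Lemma cuts_setT : setT \in N. Proof. by rewrite inE ES eqxx. Qed.
Let EN := cuts_setT.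

Lemma cuts_dsc G : dsc S G -> G \in N.
Proof.
move=> dG; have [GS _ _] := and3P dG; rewrite inE GS dG /= andbT; apply/orP; right.
have /and4P [_ _ /forall_inP h _] := aU; by apply/negP => /h; rewrite dG.
Qed.
Let dN := cuts_dsc.

Lemma cuts_down H H' : H \in S -> H' \in U -> H \subset H' -> top N H = top N H' -> H \in U.
Proof.
have [US _ _ _] := and4P aU.
have [n] := ubnP (#|H'| - #|H|); elim: n H => // n IH H ltn HS H'U HH' tE.
have H'S := subsetP US H' H'U.
have [-> //|neq] := eqVneq H H'; have pHH' : H \proper H' by rewrite properEneq neq.
have HN : H \notin N.
  apply/negP => HN; have := top_id HN; rewrite tE => E.
  have [_ Ht _] := topNP ll bs mS NS EN (S_neq0 bs mS H'S); rewrite E in Ht.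
  by move: pHH'; rewrite properE Ht andbF.
have [aH tH] := seg_asc ll bs topBG sto mS NS EN dN HS HN; have [_ HT _] := and3P aH.
have [pS pH pmin] := parP ll bs nS ES HS HT.
have pU : par S H \in U.
  apply: IH => //; last by rewrite tH.
    have := proper_card pH; have := proper_card pHH'.
    by move=> c1 c2; rewrite -ltnS; apply: leq_trans ltn; rewrite ltnS ltn_sub2l.
  exact: pmin.
by move: HN; rewrite inE HS (negPf HT) pU orbT andbT /= negbK.
Qed.

(** The bottom [H] of the segment carries 1. Either it has no ascending child, where admissibility
    forces a 1, or its ascending child belongs to [N]; not being a descent, that child can be a cut
    only because [H] carries 1. *)
Lemma segcount_gt0 G : (0 < segcount S U G) = (G \in N).
Proof.
rewrite /segcount -/N; case: ifPn => // GN; apply/card_gt0P.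
have GS := subsetP NS G GN.
have Gseg : G \in seg S N G by rewrite inE GS (top_id GN) eqxx.
case: (@arg_minnP _ G (fun H => H \in seg S N G) (fun H => #|H|) Gseg) => H Hseg Hmin.
exists H; rewrite inE Hseg andbT; move: (Hseg); rewrite inE => /andP [HS /eqP tH].
have [_ /forall_inP bU _ _] := and4P aU.
have := implyP (bU H HS); case: (boolP (has_asc_child S H)) => [/exists_inP [K KS /andP [aK /eqP pK]] _|_]; last exact.
have [_ KT _] := and3P aK; have [_ KH _] := parP ll bs nS ES KS KT; rewrite pK in KH.
have [KN|KN] := boolP (K \in N).
  move: KN; rewrite inE KS (negPf KT) /= => /andP [_].
  by rewrite (negPf (_ : ~~ dsc S K)) ?pK // -(ascNdsc ll bs sto).
have [_ tK] := seg_asc ll bs topBG sto mS NS EN dN KS KN.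
have : #|H| <= #|K| by apply: Hmin; rewrite inE KS -tK pK tH eqxx.
by rewrite leqNgt proper_card.
Qed.

Lemma segcount_lt G : G \in N -> segcount S U G + (G != setT) <= rk G - rk (lower N G).
Proof.
move=> GN; have GS := subsetP NS G GN; rewrite -(card_seg NS EN GN) /segcount -/N GN.
have [->|GT] := eqVneq G setT; first by rewrite addn0 subset_leq_card ?subsetIr.
rewrite addn1; apply: proper_card; apply/properP; split; first exact: subsetIr.
exists G; first by rewrite inE GS (top_id GN) eqxx.
by move: GN; rewrite !inE GS (negPf GT) /= => /andP [/negPf -> _].
Qed.

Lemma word_segcountK : word S N (segcount S U) = U.
Proof.
have [US _ _ _] := and4P aU.
apply/setP => H; rewrite inE; case: (boolP (H \in S)) => HS; last first.
  by apply/esym/negP => /(subsetP US) h; rewrite h in HS.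
have [tN _ _] := topNP ll bs mS NS EN (S_neq0 bs mS HS).
rewrite /= /segcount -/N tN.
rewrite -(@chain_height_mem _ (seg S N (top N H))) ?in_setI ?mem_seg ?andbT //.
- exact: (seg_is_chain NS EN dN).
- exact: subsetIr.
- move=> X Y XS; rewrite !in_setI XS andbT => /andP [YU YS] XY.
  move: XS YS; rewrite !inE => /andP [XS /eqP tX] /andP [YS /eqP tY].
  by apply: cuts_down XY _; rewrite // tX.
Qed.

Lemma segcount_sum : \sum_(G in N) segcount S U G = i.+1.
Proof.
have [US _ _ /eqP <-] := and4P aU; rewrite (sum_seg NS EN US).
by apply: eq_bigr => G GN; rewrite /segcount -/N GN.
Qed.

End Backward.

Lemma card_nodes_noasc :
  #|[set K in S | ~~ has_asc_child S K]| = #|Des M lt S|.+1.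
Proof.
have DE : Des M lt S = [set G in S | dsc S G].
  by apply/setP => G; rewrite (Des_mem ll bs topBG sto G mS) inE andb_idl // => /and3P [].
have c1 := card_split S (has_asc_child S).
have c2 : #|[set K in S | has_asc_child S K]| = #|[set K in S | asc S K]|.
  rewrite -[RHS](card_in_imset (f := par S)); last first.
    move=> K1 K2; rewrite !inE => /andP [_ a1] /andP [_ a2].
    exact: (asc_child_unique ll bs topBG sto cmp mS a1 a2).
  congr #|pred_of_set _|; apply/setP => H; rewrite inE; apply/andP/imsetP.
    by case=> HS /exists_inP [K KS /andP [aK /eqP <-]]; exists K; rewrite // inE KS.
  case=> K; rewrite inE => /andP [KS aK] ->; have [_ KT _] := and3P aK.
  by have [pS _ _] := parP ll bs nS ES KS KT; split=> //; apply/exists_inP; exists K; rewrite // aK eqxx.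
have c3 : #|S| = (#|[set K in S | asc S K]| + #|[set G in S | dsc S G]|).+1.
  rewrite (cardsD1 setT) ES add1n; congr _.+1; rewrite (card_split (S :\ setT) (asc S)).
  by congr addn; apply: eq_card => K; rewrite !inE; have [->|KT] := eqVneq K setT;
    rewrite /= ?ES /asc /dsc ?eqxx ?andbF //=; case: (boolP (K \in S)) => //= KS;
    have := ascNdsc ll bs sto nS ES KS KT; rewrite /asc /dsc KS KT /= => ->; rewrite ?negbK.
by apply/eqP; rewrite -(eqn_add2l #|[set K in S | asc S K]|) -{1}c2 -c1 c3 DE addnS.
Qed.

(* Words on a fixed forest are free outside the descents (never chosen) and the
   nodes without ascending child (always chosen). *)
Lemma card_admissible i :
  #|[set U | admissible S U i]| =
  if stable_max_nested M BG lt S && (#|Des M lt S| <= i) then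
    'C((rk setT).-1 - 2 * #|Des M lt S|, i - #|Des M lt S|) else 0.
Proof.
have DE G : (G \in Des M lt S) = dsc S G := Des_mem ll bs topBG sto G mS.
set D := Des M lt S in DE *; set B := [set K in S | ~~ has_asc_child S K].
have cB : #|B| = #|D|.+1 := card_nodes_noasc.
have DS : D \subset S by apply/subsetP => G; rewrite DE => /and3P [].
have BS : B \subset S by apply/subsetP => G; rewrite inE => /andP [].
have admE U : admissible S U i = [&& U \subset S, B \subset U, [disjoint U & D] & #|U| == i.+1].
  rewrite /admissible; congr [&& _, _, _ & _].
    apply/forall_inP/subsetP => h K; first by rewrite inE => /andP [KS]; apply/implyP/h.
    by move=> KS; apply/implyP => nc; apply: h; rewrite inE KS.
  have pC K : (K \in [predC D]) = ~~ dsc S K by rewrite -DE.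
  by rewrite disjoint_subset; apply/forall_inP/subsetP => h K KU; have := h K KU; rewrite pC.
have stE : stable_max_nested M BG lt S = [disjoint B & D].
  apply/(stableP ll bs topBG sto)/idP => [[_ h]|dis].
    rewrite disjoint_subset; apply/subsetP => K; rewrite inE => /andP [KS nc].
    have -> : (K \in [predC D]) = ~~ dsc S K by rewrite -DE.
    by apply: contra nc; apply: h.
  split=> // G dG; apply: contraT => nc; have := disjointFr dis (x := G).
  by rewrite inE nc DE dG (subsetP DS) ?DE // => /(_ isT).
rewrite stE; case: (boolP [disjoint B & D]) => [dis|ndis] /=; last first.
  apply/eqP; rewrite cards_eq0; apply/eqP/setP => U; rewrite !inE admE; apply/negP.
  case/and4P => _ BU UD _; case/negP: ndis; exact: disjointWl UD.
case: ifPn => [Di|]; last first.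
  rewrite -ltnNge => iD; apply/eqP; rewrite cards_eq0; apply/eqP/setP => U; rewrite !inE admE; apply/negP.
  case/and4P => _ /subset_leq_card BU _ /eqP cU; move: BU.
  by rewrite cB cU ltnS leqNgt iD.
set R := S :\: (B :|: D).
have cR : #|R| = (rk setT).-1 - 2 * #|D|.
  rewrite cardsDS ?subUset ?BS // cardsU (_ : B :&: D = set0) ?cards0 ?subn0; last first.
    by apply/eqP; rewrite setI_eq0.
  rewrite (max_nested_card ll bs topBG mS) cB mul2n -addnn addSn subnS -predn_sub //.
rewrite -cR -(cards_draws R (i - #|D|)).
have dBR : [disjoint B & R].
  by rewrite -setI_eq0; apply/eqP/setP => K; rewrite in_set0 in_setI in_setD in_setU negb_or; case: (K \in B).
rewrite -[RHS](card_in_imset (f := fun A => B :|: A)); last first.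
  move=> A1 A2; rewrite !inE => /andP [s1 _] /andP [s2 _] E.
  have dr A : A \subset R -> (B :|: A) :\: B = A.
    move=> AR; rewrite setDUl setDv set0U; apply/setDidPl; rewrite disjoint_sym.
    exact: disjointWr dBR.
  by rewrite -(dr A1 s1) E dr.
congr #|pred_of_set _|; apply/setP => U; rewrite inE admE; apply/and4P/imsetP.
  case=> US BU UD /eqP cU; exists (U :\: B); last by rewrite setDE setUIr setUCr setIT (setUidPr BU).
  rewrite inE; apply/andP; split.
    apply/subsetP => K; rewrite in_setD => /andP [KB KU]; rewrite in_setD in_setU negb_or KB (subsetP US) //= andbT.
    by rewrite (disjointFr UD).
  by rewrite cardsDS // cB cU subSS.
case=> A; rewrite inE => /andP [AR /eqP cA] ->; split.
- by rewrite subUset BS (subset_trans AR) // subsetDl.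
- exact: subsetUl.
- rewrite -setI_eq0 setIUl setU_eq0 !setI_eq0 dis /= -setI_eq0.
  apply/eqP/setP => K; rewrite in_set0 in_setI; apply/negP => /andP [/(subsetP AR)].
  by rewrite in_setD in_setU negb_or => /andP [/andP [_ /negPf ->]].
- rewrite cardsU (_ : B :&: A = set0) ?cards0 ?subn0 ?cB ?cA ?addSn ?subnKC //.
  by apply/eqP; rewrite setI_eq0; apply: disjointWr dBR.
Qed.

End OneMaxNested.
End Words.

(** * Standard monomials *)

Section StandardMonomials.
Variables (T : finType) (M : matroid T) (BG : {set {set T}}).
Local Notation rk := (mrank M).
Local Notation nested := (nested M BG).

Definition mon_supp i (c : monom T i) : {set {set T}} := [set G | 0 < (c G : nat)].
Definition standard i (c : monom T i) :=
  [&& valid_monom BG c, nested (mon_supp c) &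
      [forall G in mon_supp c, c G < rk G - rk (lower (mon_supp c) G)]].

Section Count.
Variable lt : rel T.
Hypotheses (ll : loopless M) (bs : building_set M BG) (topBG : setT \in BG).
Hypotheses (sto : strict_total_order lt) (cmp : complete M BG lt).
Variable i : nat.
Implicit Types (c : monom T i) (N S U : {set {set T}}) (G : {set T}).

(* The extra 1 at [E] makes the bound [0 < lifted c G] uniform over the forest, since [c] may
   vanish at [E] only. *)
Definition lifted c G : nat := c G + (G == setT).
Definition forest_of c : {set {set T}} := setT |: mon_supp c.
Definition completion N : {set {set T}} :=
  odflt set0 [pick S | [&& max_nested M BG S, N \subset S & [forall G, dsc lt S G ==> (G \in N)]]].

Lemma completionP N : nested N -> setT \in N ->
  [/\ max_nested M BG (completion N), N \subset completion N &
      forall G, dsc lt (completion N) G -> G \in N].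
Proof.
move=> nN EN; rewrite /completion; case: pickP => [S /and3P [h1 h2 /forallP h3]|].
  by split=> // G; apply/implyP.
have [S [h1 h2 h3]] := completion_exists ll bs topBG sto nN EN => /(_ S).
by rewrite h1 h2 /= => /negP; case; apply/forallP => G; apply/implyP/h3.
Qed.

Lemma lower_setT1 N G : lower (setT |: N) G = lower N G.
Proof.
apply: eq_bigl => H; rewrite !inE andb_orl; have [->|_] //= := eqVneq H setT.
have -> : [set: T] \proper G = false by rewrite properE subsetT andbF.
by rewrite andbF.
Qed.

Lemma lifted_gt0 c G : (0 < lifted c G) = (G \in forest_of c).
Proof. by rewrite /lifted addn_gt0 !inE orbC lt0b. Qed.

Lemma setT_forest c : setT \in forest_of c. Proof. exact: setU11. Qed.

Lemma standardP c : standard c ->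
  [/\ nested (forest_of c), \sum_(G in forest_of c) lifted c G = i.+1 &
   forall G, G \in forest_of c -> lifted c G + (G != setT) <= rk G - rk (lower (forest_of c) G)].
Proof.
case/and3P => /andP [/eqP sc _] nc /forall_inP h.
have nN : nested (forest_of c) by apply: nested_setT.
split=> //.
  rewrite big_split /=.
  have -> : \sum_(G in forest_of c) c G = \sum_G c G.
    rewrite [RHS](bigID (mem (forest_of c))) /= [X in _ + X]big1 ?addn0 //.
    by move=> G; rewrite !inE negb_or -eqn0Ngt => /andP [_ /eqP].
  have -> : \sum_(G in forest_of c) (G == setT) = 1.
    rewrite (bigD1 setT) ?setT_forest //= eqxx big1 // => G /andP [_ /negPf ->] //.
  by rewrite sc addn1.
move=> G GN; rewrite lower_setT1 /lifted; have [->|GT] := eqVneq G setT; last first.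
  rewrite addn0 addn1; apply: h; by move: GN; rewrite in_setU1 (negPf GT).
rewrite addn0 addn1; case: (boolP (setT \in mon_supp c)) => [/h //|].
rewrite inE -eqn0Ngt => /eqP ->; rewrite subn_gt0 -lower_setT1.
exact: (rk_lower ll bs nN (setT_forest c)).
Qed.

Definition encode c : {set {set T}} * {set {set T}} :=
  let S := completion (forest_of c) in (S, word S (forest_of c) (lifted c)).

Lemma encode_inj : {in [pred c | standard c] &, injective encode}.
Proof.
move=> c1 c2; rewrite !inE => s1 s2 [E1 E2].
have [n1 _ l1] := standardP s1; have [n2 _ l2] := standardP s2.
have [m1 N1 d1] := completionP n1 (setT_forest c1); have [_ N2 d2] := completionP n2 (setT_forest c2).
rewrite -E1 in E2 N2 d2; set S := completion (forest_of c1) in E2 m1 N1 d1 N2 d2 *.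
have k1 := word_segcount ll bs topBG sto cmp m1 N1 (setT_forest c1) d1 (lifted_gt0 c1) l1.
have k2 := word_segcount ll bs topBG sto cmp m1 N2 (setT_forest c2) d2 (lifted_gt0 c2) l2.
apply/ffunP => G; apply: val_inj; apply/eqP.
by rewrite -(eqn_add2r (G == setT)) -[X in X == _]/(lifted c1 G) -[X in _ == X]/(lifted c2 G) -k1 -k2 E2.
Qed.

Lemma encode_image : [set encode c | c in [pred c | standard c]] =
  [set p | max_nested M BG p.1 && admissible lt p.1 p.2 i].
Proof.
apply/setP => -[S U]; rewrite [RHS]inE /=; apply/imsetP/andP.
  case=> c; rewrite inE => sc [-> ->]; have [nN si l] := standardP sc.
  have [mS NS dN] := completionP nN (setT_forest c); split=> //.
  exact: (word_admissible ll bs topBG sto cmp mS NS (setT_forest c) dN (lifted_gt0 c) l si).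
case=> mS aU; have NS := cuts_sub lt S U.
have EN := cuts_setT lt topBG mS U; have dN := cuts_dsc aU.
have nN := nested_sub (max_nested_nested mS) NS.
have gt0 := segcount_gt0 ll bs topBG sto mS aU.
have slt := segcount_lt (lt := lt) ll bs topBG mS (U := U).
have ssum := segcount_sum ll bs topBG mS aU.
set N := cuts lt S U in NS EN dN nN gt0 slt ssum.
set m := segcount lt S U in gt0 slt ssum.
have mT : 0 < m setT by rewrite gt0.
(* Exponents must fit into ['I_i.+1]. The values of [m] sum to [i.+1] and the one at [E] is
   positive, so once a unit is removed at [E] each is at most [i]. *)
have le G : m G - (G == setT) < i.+1.
  rewrite -ssum; case: (boolP (G \in N)) => GN; last first.
    by move: GN; rewrite -gt0 -eqn0Ngt => /eqP ->; rewrite sub0n ssum.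
  have [->|GT] := eqVneq G setT.
    rewrite (bigD1 setT) //=; have := leq_addr (\sum_(G in N | G != setT) m G) (m setT).
    by apply: leq_trans; rewrite subn1 prednK.
  rewrite subn0 (bigD1 setT) //= (bigD1 G) /=; last by rewrite GN.
  by rewrite addnCA -[X in X < _]addn0 ltn_add2l addn_gt0 mT.
pose c : monom T i := [ffun G => Ordinal (le G)].
have cE G : (c G : nat) = m G - (G == setT) by rewrite ffunE.
have lE G : lifted c G = m G.
  by rewrite /lifted cE; have [->|] := eqVneq G setT; rewrite ?subn0 ?addn0 // subnK.
have fE : forest_of c = N by apply/setP => G; rewrite -lifted_gt0 lE gt0.
have suppN : mon_supp c \subset N by rewrite -fE subsetUr.
have sc : standard c.
  apply/and3P; split; [apply/andP; split|exact: nested_sub suppN|].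
  - have : \sum_(G in forest_of c) lifted c G = \sum_(G in N) m G.
      by rewrite fE; apply: eq_bigr => G _; rewrite lE.
    rewrite ssum big_split /= [X in _ + X](bigD1 setT) ?setT_forest //= eqxx.
    rewrite [X in _ + (_ + X)]big1 => [|G /andP [_ /negPf ->] //]; rewrite addn0 addn1 => -[E].
    apply/eqP; rewrite -[RHS]E [LHS](bigID (mem (forest_of c))) /= [X in _ + X]big1 ?addn0 //.
    by move=> G; rewrite !inE negb_or -eqn0Ngt => /andP [_ /eqP].
  - apply/forall_inP => H HB; rewrite eqn0Ngt; apply: contra HB => c0.
    by apply: (nested_BG nN); apply: (subsetP suppN); rewrite inE.
  - apply/forall_inP => G Gc; have GN := subsetP suppN G Gc.
    have := slt G GN; rewrite -fE lower_setT1; apply: leq_trans.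
    rewrite -lE /lifted; have [->|_] := eqVneq G setT; by rewrite ?addn0 addn1.
exists c => //; have [mC NC dC] := completionP nN EN.
have SE : completion N = S.
  exact: (completion_unique ll bs topBG sto EN mC NC dC mS NS dN).
rewrite /encode fE SE; congr pair.
rewrite -{1}(word_segcountK ll bs topBG sto cmp mS aU); apply/setP => H.
by rewrite !inE lE.
Qed.

Lemma card_standard :
  #|[pred c : monom T i | standard c]| =
  \sum_(S | stable_max_nested M BG lt S && (#|Des M lt S| <= i))
     'C((rk setT).-1 - 2 * #|Des M lt S|, i - #|Des M lt S|).
Proof.
rewrite -(card_in_imset encode_inj) encode_image -sum1_card.
rewrite (partition_big (fun p => p.1) (max_nested M BG)) /=; last by move=> p; rewrite inE => /andP [].
rewrite [RHS]big_mkcond [LHS]big_mkcond /=; apply: eq_bigr => S _.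
case: (boolP (max_nested M BG S)) => mS; last first.
  by rewrite ifF // /stable_max_nested (negPf mS).
rewrite -(card_admissible ll bs topBG sto cmp mS) sum1_card.
rewrite -[RHS](card_imset (mem [set U | admissible lt S U i]) (f := pair S)); last by move=> U1 U2 [].
apply: eq_card => -[S1 U]; rewrite [in LHS]unfold_in /= inE /=; apply/andP/imsetP.
  by case=> /andP [_ a] /eqP E; subst S1; exists U; rewrite // inE.
by case=> U'; rewrite inE => a [-> ->]; rewrite mS.
Qed.

End Count.
End StandardMonomials.

(** * The dragon Hall-Rado condition *)

Section DragonHallRado.
Variables (T : finType) (M : matroid T).
Local Notation rk := (mrank M).
Implicit Types (J B H : {set T}) (D N K U V W : {set {set T}}) (mu nu : {set T} -> nat).

Definition span_over J V := J :|: \bigcup_(H in V) H.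

(** Rado's rank condition with an excess of one, in the contraction by [J] and with [nu H] copies of
    each [H]: the matroid form of Postnikov's dragon marriage condition. *)
Definition dhr J D nu :=
  [forall V : {set {set T}}, (V \subset D) ==> (V != set0) ==>
     (rk J + 1 + \sum_(H in V) nu H <= rk (span_over J V))].

Lemma dhrP J D nu : reflect (forall V, V \subset D -> V != set0 ->
    rk J + 1 + \sum_(H in V) nu H <= rk (span_over J V)) (dhr J D nu).
Proof.
apply: (iffP forallP) => h V; first by move=> VD V0; have := h V; rewrite VD V0.
by apply/implyP => VD; apply/implyP; apply: h.
Qed.

Lemma dhrPn J D nu : ~~ dhr J D nu -> exists V,
  [/\ V \subset D, V != set0 & rk (span_over J V) <= rk J + \sum_(H in V) nu H].
Proof.
rewrite negb_forall => /existsP [V]; rewrite !negb_imply => /and3P [VD V0].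
by rewrite -ltnNge addnAC addn1 ltnS => h; exists V.
Qed.

Lemma span_sub J V W : V \subset W -> span_over J V \subset span_over J W.
Proof.
by move=> VW; apply: setUS; apply/bigcupsP => H HV; apply: bigcup_sup; apply: (subsetP VW).
Qed.

Lemma spanU J V W : span_over J (V :|: W) = span_over J V :|: span_over J W.
Proof. by rewrite /span_over bigcup_setU setUUr. Qed.

Lemma rk_span_cl J V W : span_over J W \subset cl M (span_over J V) -> rk (span_over J (V :|: W)) = rk (span_over J V).
Proof. by move=> h; rewrite spanU rk_addU. Qed.

Section Exchange.
Variables (J B : {set T}) (D N : {set {set T}}) (mu : {set T} -> nat).
Hypotheses (ND : N \subset D) (N0 : N != set0) (BD : B \in D).
Hypotheses (NB : forall F, F \in N -> F \subset B) (BN : B \subset cl M (span_over J N)).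

(* Multiplicities after replacing the members [K] of [N] by copies of [B]. *)
Definition exch K H := mu H + (H \in N :\: K) + (H == B) * #|K|.

Lemma sum_exch K V :
  \sum_(H in V) exch K H = \sum_(H in V) mu H + #|V :&: (N :\: K)| + (B \in V) * #|K|.
Proof.
rewrite !big_split /=; congr (_ + _ + _).
  rewrite -sum1_card [LHS]big_mkcond [RHS]big_mkcond; apply: eq_bigr => H _.
  by rewrite in_setI; case: (H \in V); case: (H \in _).
case: (boolP (B \in V)) => BV.
  by rewrite (bigD1 B) //= eqxx big1 ?addn0 // => H /andP [_ /negPf ->].
by rewrite big1 // => H HV; case: eqP => // E; rewrite -E HV in BV.
Qed.

(** Replacing sets by the larger set [B] only helps. A violation [V] for [K'] that avoids [B] is one
    for [K]. If it contains [B], adjoining [K' :\: K] does not raise the rank, these sets being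
    inside [B], and gives a violation for [K]. *)
Lemma dhr_exch_mono K K' : K \subset K' -> K' \subset N -> dhr J D (exch K) -> dhr J D (exch K').
Proof.
move=> KK' K'N; apply: contraLR => /dhrPn [V [VD V0 vio]]; apply/negP => /dhrP h.
have cKK' := cardsDS KK'; have lKK' := subset_leq_card KK'.
have [BV|BV] := boolP (B \in V); last first.
  have := h V VD V0; move: vio; rewrite !sum_exch (negPf BV) !mul0n !addn0.
  have : #|V :&: (N :\: K')| <= #|V :&: (N :\: K)| by apply/subset_leq_card/setIS/setDS.
  by clear; lia.
have W0 : V :|: (K' :\: K) != set0 by apply/set0Pn; exists B; rewrite inE BV.
have WD : V :|: (K' :\: K) \subset D.
  by rewrite subUset VD (subset_trans _ ND) // (subset_trans _ K'N) // subsetDl.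
have := h _ WD W0; rewrite sum_exch rk_span_cl; last first.
  apply: subset_trans (cl_ext _ _); rewrite subUset subsetUl /=; apply/bigcupsP => F FK.
  apply: subset_trans (subsetUr _ _); apply: (bigcup_max B) => //; apply: NB.
  by apply: (subsetP K'N); apply: (subsetP (subsetDl K' K)).
move: vio; rewrite sum_exch BV in_setU BV !mul1n.
have : #|V :&: (N :\: K')| + #|K' :\: K| <= #|(V :|: K' :\: K) :&: (N :\: K)|.
  rewrite -cardsUI [X in _ + X](_ : _ = 0) ?addn0; last first.
    by apply/eqP; rewrite cards_eq0 -subset0; apply/subsetP => H; rewrite !inE; case: (H \in K'); rewrite ?andbF.
  apply: subset_leq_card; apply/subsetP => H; rewrite in_setU => /orP [].
    rewrite in_setI in_setD => /and3P [HV HK' HN]; rewrite in_setI in_setU !in_setD HV HN andbT.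
    by apply: contra HK'; apply: (subsetP KK').
  rewrite in_setD => /andP [HK HK']; rewrite in_setI in_setU !in_setD HK HK' orbT.
  exact: (subsetP K'N).
have : \sum_(H in V) mu H <= \sum_(H in V :|: K' :\: K) mu H.
  rewrite [X in _ <= X](bigID (mem V)) /=.
  by rewrite [X in _ <= X + _](eq_bigl (mem V)) ?leq_addr // => H; rewrite !inE; case: (H \in V); rewrite ?andbF.
by move: cKK' lKK'; clear; lia.
Qed.

Definition overfull U := [exists V : {set {set T}}, [&& V \subset D, U \subset V :&: N &
  rk (span_over J V) <= rk J + \sum_(H in V) mu H + #|U|]].

Lemma overfull0 : overfull set0.
Proof.
by apply/existsP; exists set0; rewrite !sub0set /span_over !big_set0 setU0 cards0 !addn0 leqnn.
Qed.

Lemma sum_setUI (V W : {set {set T}}) :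
  \sum_(H in V :|: W) mu H + \sum_(H in V :&: W) mu H = \sum_(H in V) mu H + \sum_(H in W) mu H.
Proof.
rewrite (big_setID V) /= [in RHS]addnC [in RHS](big_setID V) /=.
have -> : (V :|: W) :&: V = V by apply/setIidPr/subsetUl.
have -> : (V :|: W) :\: V = W :\: V by rewrite setDUl setDv set0U.
rewrite [V :&: W]setIC.
by rewrite -addnA addnC [X in X + _ = _]addnC.
Qed.

(* Overfull sets behave like tight sets in Rado's theorem: the union of a maximal one
   with any new overfull set is overfull. An index outside a maximal overfull set can be
   exchanged freely. *)
Lemma dhr_exchange : exists2 i, i \in N &
  forall K, K \subset N -> i \notin K -> dhr J D (exch K) = dhr J D (exch (i |: K)).
Proof.
have [hN|hN] := boolP (dhr J D (exch N)); last first.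
  have hK K : K \subset N -> dhr J D (exch K) = false.
    by move=> KN; apply: contraNF hN; apply: dhr_exch_mono.
  case/set0Pn: N0 => i iN; exists i => // K KN _.
  by rewrite !hK // subUset sub1set iN.
case: (@arg_maxnP _ set0 overfull (fun U => #|U|) overfull0) => U /existsP [VU /and3P [VUD UVU vU]] Umax.
have UN : U \subset N by apply: subset_trans UVU (subsetIr _ _).
have UV : U \subset VU by apply: subset_trans UVU (subsetIl _ _).
(* [N] cannot be overfull: [B] lies in the closure of [span_over J N], so adjoining [B] to the
   witness keeps its rank and violates [hN], which counts [#|N|] copies of [B]. *)
have /subsetPn [i iN iU] : ~~ (N \subset U).
  apply/negP => NU; have UE : U = N by apply/eqP; rewrite eqEsubset UN.
  subst U; have W0 : VU :|: [set B] != set0 by apply/set0Pn; exists B; rewrite !inE eqxx orbT.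
  have WD : VU :|: [set B] \subset D by rewrite subUset VUD sub1set.
  have := dhrP _ _ _ hN _ WD W0; rewrite sum_exch rk_span_cl; last first.
    rewrite /span_over big_set1 subUset; apply/andP; split.
      by apply: subset_trans (cl_ext _ _); apply: subsetUl.
    by apply: subset_trans BN _; apply: cl_mono; apply: span_sub.
  rewrite !inE eqxx orbT mul1n.
  have : \sum_(H in VU) mu H <= \sum_(H in VU :|: [set B]) mu H.
    rewrite [X in _ <= X](bigID (mem VU)) /=.
    by rewrite [X in _ <= X + _](eq_bigl (mem VU)) ?leq_addr // => H; rewrite !inE; case: (H \in VU); rewrite ?andbF.
  by move: vU; clear; lia.
exists i => // K KN iK.
have iKN : i |: K \subset N by rewrite subUset sub1set iN.
apply/idP/idP; first by apply: dhr_exch_mono => //; apply: subsetUr.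
move=> /dhrP h; apply: contraT => /dhrPn [V [VD V0 vV]].
have ciK : #|i |: K| = #|K|.+1 by rewrite cardsU1 iK.
have cV : #|V :&: (N :\: K)| = (i \in V) + #|V :&: (N :\: (i |: K))|.
  rewrite (cardsD1 i) !inE iN iK !andbT; congr (_ + _).
  by apply: eq_card => H; rewrite !inE negb_or; case: (H == i); rewrite ?andbF.
have := h V VD V0; move: vV; rewrite !sum_exch ciK cV.
have [BV|BV] := boolP (B \in V).
  by case: (i \in V); clear; lia.
rewrite !mul0n !addn0; have [iV|iV] := boolP (i \in V); last by clear; lia.
move=> vV _; exfalso.
set A := V :&: (N :\: K).
have iA : i \in A by rewrite !inE iV iK iN.
suff ov : overfull (U :|: A).
  have := Umax _ ov; apply/negP; rewrite -ltnNge; apply: proper_card.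
  by apply/properP; split; [apply: subsetUl | exists i; rewrite // inE iA orbT].
apply/existsP; exists (VU :|: V); apply/and3P; split.
- by rewrite subUset VUD.
- rewrite subUset !subsetI UN (subset_trans UV) ?subsetUl //=.
  rewrite (subset_trans (subsetIl _ _)) ?subsetUr //=.
  by rewrite (subset_trans (subsetIr _ _)) ?subsetDl.
(* Bounding the rank of the union of the two witnesses by submodularity takes a lower bound on their
   intersection. The condition for [i |: K] supplies it, since [U] avoids [i]. *)
have inter : rk J + \sum_(H in VU :&: V) mu H + #|U :&: A| <= rk (span_over J (VU :&: V)).
  have UA : U :&: A \subset (VU :&: V) :&: (N :\: (i |: K)).
    apply/subsetP => H; rewrite !inE => /and4P [HU HV HK HN].
    rewrite HV HN (negPf HK) orbF (subsetP UV) //= andbT.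
    by apply: contraNneq iU => <-.
  have [E|n0] := eqVneq (VU :&: V) set0.
    move: UA; rewrite E set0I subset0 => /eqP ->.
    by rewrite /span_over !big_set0 setU0 cards0 !addn0.
  have := h _ (subset_trans (subsetIr _ _) VD) n0; rewrite sum_exch.
  by have := subset_leq_card UA; clear; lia.
have sm := @rk_submod_rel _ M (span_over J VU) (span_over J V) (span_over J (VU :&: V))
   (span_sub _ (subsetIl _ _)) (span_sub _ (subsetIr _ _)).
rewrite -spanU in sm.
have sU := sum_setUI VU V; have cU := cardsUI U A.
have cA : #|A| = 1 + #|V :&: (N :\: (i |: K))| by rewrite /A cV iV.
by move: inter sm sU cU vU vV; rewrite -cA; clear; lia.
Qed.

End Exchange.
End DragonHallRado.

(** * Polynomials and relations *)

Import Order.TTheory GRing.Theory Num.Theory.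
Local Open Scope ring_scope.

Section Presentation.
Variables (T : finType) (M : matroid T) (BG : {set {set T}}).
Local Notation rk := (mrank M).
Local Notation nested := (nested M BG).
Local Notation n := #|{: {set T}}|.
Local Notation R := {mpoly rat[n]}.
Implicit Types (G H C : {set T}) (p q : R) (m : 'X_{1..n}).

Definition var G : R := 'X_(enum_rank G).
(** The ring has a variable for every subset of the ground set, as in [monom]; those outside the
    building set are replaced by 0 here and dropped by [proj]. *)
Definition xvar G : R := if G \in BG then var G else 0.
Definition expo m G : nat := m (enum_rank G).
Definition to_mnm i (c : monom T i) : 'X_{1..n} := [multinom (c (enum_val j) : nat) | j < n].
Definition proj i p : hpoly T i :=
  [ffun c => if valid_monom BG c then p@_(to_mnm c) else 0].
Definition relations i := <<Igens M BG i ++ Jgens M BG i>>%VS.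

Lemma expo_to_mnm i (c : monom T i) G : expo (to_mnm c) G = c G.
Proof. by rewrite /expo mnmE enum_rankK. Qed.

Lemma expoP m1 m2 : expo m1 =1 expo m2 -> m1 = m2.
Proof. by move=> h; apply/mnmP => j; have := h (enum_val j); rewrite /expo enum_valK. Qed.

Lemma to_mnm_inj i : injective (@to_mnm i).
Proof.
move=> c1 c2 E; apply/ffunP => G; apply: val_inj.
by rewrite /= -!expo_to_mnm E.
Qed.

Lemma expoD m1 m2 G : expo (m1 + m2) G = (expo m1 G + expo m2 G)%N.
Proof. exact: mnmDE. Qed.

Lemma expo1 G H : expo U_(enum_rank G) H = (G == H).
Proof. by rewrite /expo mnm1E (inj_eq enum_rank_inj). Qed.

Lemma mdeg_expo m : mdeg m = (\sum_G expo m G)%N.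
Proof.
rewrite mdegE (reindex_onto (@enum_rank {set T}) enum_val) => [|j _]; last exact: enum_valK.
by apply: eq_bigl => G; rewrite enum_rankK eqxx.
Qed.

Lemma mdeg_to_mnm i (c : monom T i) : mdeg (to_mnm c) = (\sum_G (c G : nat))%N.
Proof. by rewrite mdeg_expo; apply: eq_bigr => G _; rewrite expo_to_mnm. Qed.

Lemma var_sum (A : {set {set T}}) :
  \prod_(G in A) var G = 'X_[(\sum_(G in A) U_(enum_rank G))%MM].
Proof. by rewrite (big_morph _ (@mpolyXD n rat) (mpolyX0 n rat)). Qed.

Lemma expo_sum1 (A : {set {set T}}) H :
  expo (\sum_(G in A) U_(enum_rank G))%MM H = (H \in A).
Proof.
rewrite /expo mnm_sumE; under eq_bigr => G _ do rewrite -/(expo _ H) expo1.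
have [HA|HA] := boolP (H \in A).
  by rewrite (bigD1 H) //= eqxx big1 // => G /andP [_ /negPf ->].
by rewrite big1 // => G GA; case: eqP => // E; rewrite -E GA in HA.
Qed.

Lemma prod_xvar (A : {set {set T}}) : A \subset BG ->
  \prod_(G in A) xvar G = 'X_[(\sum_(G in A) U_(enum_rank G))%MM].
Proof.
move=> AB; rewrite -var_sum; apply: eq_bigr => G GA.
by rewrite /xvar (subsetP AB).
Qed.

Lemma proj_linear i : linear (proj i).
Proof.
move=> a p q; apply/ffunP => c; rewrite !ffunE; case: ifP => _; rewrite ?scaler0 ?addr0 //.
by rewrite mcoeffD mcoeffZ.
Qed.
HB.instance Definition _ i := GRing.isLinear.Build rat R (hpoly T i) *:%R (proj i) (proj_linear i).

Lemma projX i (c : monom T i) : valid_monom BG c -> proj i 'X_[to_mnm c] = delta c.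
Proof.
move=> vc; apply/ffunP => d; rewrite !ffunE mcoeffX eq_sym (inj_eq (@to_mnm_inj i)).
by case: ifP => // vd; case: eqP => // E; rewrite E vc in vd.
Qed.

Lemma projX0 i m : (forall c : monom T i, valid_monom BG c -> to_mnm c <> m) -> proj i 'X_[m] = 0.
Proof.
move=> h; apply/ffunP => d; rewrite !ffunE mcoeffX; case: ifP => // vd.
by case: eqP => // E; case: (h d vd).
Qed.

Lemma mem_relations i v : v \in Igens M BG i ++ Jgens M BG i -> v \in relations i.
Proof. exact: memv_span. Qed.

(** Quantifying over all multiples and degrees makes this an ideal by definition, so ring identities
    can be used although the relations are given degree by degree. *)
Definition inI p := forall i q, proj i (q * p) \in relations i.

Lemma inI_mono p : (forall i m, proj i ('X_[m] * p) \in relations i) -> inI p.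
Proof.
move=> h i q; rewrite (mpolyE q) mulr_suml linear_sum; apply: memv_suml => m _.
by rewrite -scalerAl linearZ /=; apply: memvZ; apply: h.
Qed.

Lemma inI0 : inI 0. Proof. by move=> i q; rewrite mulr0 linear0 mem0v. Qed.
Lemma inID p q : inI p -> inI q -> inI (p + q).
Proof. by move=> hp hq i r; rewrite mulrDr linearD; apply: memvD; [apply: hp | apply: hq]. Qed.
Lemma inIM q p : inI p -> inI (q * p).
Proof. by move=> hp i r; rewrite mulrA; apply: hp. Qed.
Lemma inIMr q p : inI p -> inI (p * q).
Proof. by rewrite mulrC; apply: inIM. Qed.
Lemma inIN p : inI p -> inI (- p).
Proof. by rewrite -mulN1r; apply: inIM. Qed.
Lemma inI_sum (I : Type) (r : seq I) (P : pred I) (F : I -> R) :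
  (forall j, P j -> inI (F j)) -> inI (\sum_(j <- r | P j) F j).
Proof. by move=> h; elim/big_ind: _ => //; [exact: inI0 | exact: inID]. Qed.

Lemma projX_cases i m : {c : monom T i | valid_monom BG c & to_mnm c = m} + {proj i 'X_[m] = 0}.
Proof.
case: (pickP (fun c : monom T i => valid_monom BG c && (to_mnm c == m))) => [c /andP [vc /eqP cE]|h].
  by left; exists c.
by right; apply: projX0 => c vc E; have := h c; rewrite vc E eqxx.
Qed.

Lemma inI_nonnested (N : {set {set T}}) : N \subset BG -> ~~ nested N ->
  inI (\prod_(G in N) xvar G).
Proof.
move=> NB nN; apply: inI_mono => i m; rewrite prod_xvar // -mpolyXD.
case: (projX_cases i (m + \sum_(G in N) U_(enum_rank G))%MM) => [[c vc cE]|->]; last exact: mem0v.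
rewrite -cE projX //; apply: mem_relations; rewrite mem_cat; apply/orP; left.
apply/mapP; exists c => //; rewrite mem_enum inE vc; apply/existsP; exists N.
rewrite NB nN; apply/forall_inP => G GN.
by rewrite -expo_to_mnm cE expoD expo_sum1 GN addn1.
Qed.

Definition hvar G := - \sum_(H in BG | G \subset H) xvar H.

Definition jgen j (a : {set T}) (c' : monom T j) : hpoly T j.+1 :=
  [ffun c : monom T j.+1 => (\sum_(G in BG | a \subset G)
     ([forall H, (c H : nat) == ((c' H : nat) + (H == G))%N] : nat))%:R].

Lemma mdeg_valid j (c : monom T j) : valid_monom BG c -> mdeg (to_mnm c) = j.
Proof. by case/andP => /eqP s _; rewrite mdeg_to_mnm. Qed.

Lemma mulX_hvar m a :
  'X_[m] * - hvar a = \sum_(H in BG | a \subset H) 'X_[m + U_(enum_rank H)].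
Proof.
rewrite opprK mulr_sumr; apply: eq_bigr => H /andP [HB _].
by rewrite /xvar HB -mpolyXD.
Qed.

Lemma jgenE j a (c' : monom T j) : valid_monom BG c' ->
  jgen a c' = proj j.+1 ('X_[to_mnm c'] * - hvar a).
Proof.
move=> vc; rewrite mulX_hvar; apply/ffunP => c; rewrite [LHS]ffunE [RHS]ffunE [in RHS]raddf_sum /=.
have mE H : (to_mnm c == (to_mnm c' + U_(enum_rank H))%MM) =
    [forall G, (c G : nat) == (c' G + (G == H))%N].
  apply/eqP/forallP => [E G|hG].
    by rewrite -(expo_to_mnm c) E expoD expo1 expo_to_mnm [H == G]eq_sym eqxx.
  apply: expoP => G; rewrite expo_to_mnm (eqP (hG G)) expoD expo1 expo_to_mnm.
  by rewrite [H == G]eq_sym.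
rewrite natr_sum; case: ifPn => nv.
  by apply: eq_bigr => H _; rewrite mcoeffX eq_sym mE.
rewrite big1 // => H /andP [HB _]; case: forallP => // hG; case/negP: nv.
have E : to_mnm c = (to_mnm c' + U_(enum_rank H))%MM by apply/eqP; rewrite mE; apply/forallP.
apply/andP; split; first by rewrite -mdeg_to_mnm E mdegD mdeg1 addn1 (mdeg_valid vc).
apply/forallP => G; apply/implyP => GB; rewrite (eqP (hG G)).
case/andP: vc => _ /forallP /(_ G); rewrite GB /= => /eqP ->.
by have [E'|] := eqVneq G H; first by rewrite E' HB in GB.
Qed.

Lemma inI_atom a : a \in atoms M -> inI (hvar a).
Proof.
move=> aA; rewrite -[hvar a]opprK; apply: inIN; apply: inI_mono => i m.
have degm H : mdeg (m + U_(enum_rank H)) = (mdeg m).+1 by rewrite mdegD mdeg1 addn1.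
case: i => [|j].
  rewrite mulX_hvar linear_sum big1 ?mem0v // => H _; apply: projX0 => c vc E.
  by have := mdeg_valid vc; rewrite E degm.
case: (pickP (fun c : monom T j => valid_monom BG c && (to_mnm c == m))) => [c' /andP [vc /eqP cE]|h].
  rewrite -cE -jgenE //; apply: mem_relations; rewrite mem_cat; apply/orP; right.
  by apply/allpairsP; exists (a, c'); split; rewrite ?mem_enum.
rewrite mulX_hvar linear_sum big1 ?mem0v // => H /andP [HB _]; apply: projX0 => c vc E.
have mle G : (expo m G < j.+1)%N.
  have dm : mdeg m = j by have := mdeg_valid vc; rewrite E degm => -[].
  by rewrite ltnS -dm mdeg_expo (bigD1 G) //= leq_addr.
pose c' : monom T j := [ffun G => Ordinal (mle G)].
have cE : to_mnm c' = m by apply: expoP => G; rewrite expo_to_mnm ffunE.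
have := h c'; rewrite cE eqxx andbT => /negP; case; apply/andP; split.
  by rewrite -mdeg_to_mnm cE; have := mdeg_valid vc; rewrite E degm => -[->].
apply/forallP => G; apply/implyP => GB; rewrite ffunE /=.
case/andP: vc => _ /forallP /(_ G); rewrite GB /= -expo_to_mnm E expoD addn_eq0.
by case/andP.
Qed.

End Presentation.

(** * Standard monomials span *)

Section SupportGrading.
Variables (k : nat) (Q : nat -> 'X_{1..k} -> bool).
Hypotheses (Q0 : Q 0 0%MM) (QD : forall a b m m', Q a m -> Q b m' -> Q (a + b)%N (m + m')%MM).
Implicit Types (p q : {mpoly rat[k]}).

(** Serves twice: for lower bounds on the weight ([weight_ge]) in the spanning argument, and for
    homogeneity in the variables of the building set ([homogBG]). *)
Definition supported a p := forall m, p@_m != 0 -> Q a m.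

Lemma supported0 a : supported a 0.
Proof. by move=> m; rewrite mcoeff0 eqxx. Qed.

Lemma supportedD a p q : supported a p -> supported a q -> supported a (p + q).
Proof.
move=> hp hq m; rewrite mcoeffD; have [E|/hp //] := eqVneq (p@_m) 0.
by rewrite E add0r => /hq.
Qed.

Lemma supportedN a p : supported a p -> supported a (- p).
Proof. by move=> hp m; rewrite mcoeffN oppr_eq0 => /hp. Qed.

Lemma supportedX a m : Q a m -> supported a 'X_[m].
Proof. by move=> h m'; rewrite mcoeffX; have [<- //|] := eqVneq m m'; rewrite eqxx. Qed.

Lemma supportedM a b p q : supported a p -> supported b q -> supported (a + b)%N (p * q).
Proof.
move=> hp hq m; rewrite -mcoeff_msupp => /msuppM_le /allpairsP [[m1 m2] /= [h1 h2 ->]].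
by apply: QD; [apply: hp | apply: hq]; rewrite -mcoeff_msupp.
Qed.

Lemma supported_sum (I : Type) (r : seq I) (P : pred I) (F : I -> {mpoly rat[k]}) a :
  (forall j, P j -> supported a (F j)) -> supported a (\sum_(j <- r | P j) F j).
Proof. by move=> h; elim/big_ind: _ => //; [exact: supported0 | exact: supportedD]. Qed.

Lemma supported1 : supported 0 1.
Proof. by rewrite -mpolyX0; apply: supportedX. Qed.

Lemma supported_exp a p j : supported a p -> supported (j * a)%N (p ^+ j).
Proof.
move=> hp; elim: j => [|j IH]; first exact: supported1.
by rewrite exprS mulSn; apply: supportedM.
Qed.

Lemma supported_prod (I : Type) (r : seq I) (P : pred I) (F : I -> {mpoly rat[k]}) (a : I -> nat) :
  (forall j, P j -> supported (a j) (F j)) ->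
  supported (\sum_(j <- r | P j) a j)%N (\prod_(j <- r | P j) F j).
Proof.
move=> h; elim/big_ind2: _ => //; first exact: supported1.
by move=> p1 a1 p2 a2; apply: supportedM.
Qed.

End SupportGrading.

Section Spanning.
Variables (T : finType) (M : matroid T) (BG : {set {set T}}).
Hypotheses (ll : loopless M) (bs : building_set M BG).
Local Notation rk := (mrank M).
Local Notation cl := (cl M).
Local Notation flat := (flat M).
Local Notation nested := (nested M BG).
Local Notation n := #|{: {set T}}|.
Local Notation R := {mpoly rat[n]}.
Local Notation inI := (inI M BG).
Local Notation xvar := (xvar BG).
Local Notation hvar := (hvar BG).
Local Notation proj := (proj BG).
Local Notation relations := (relations M BG).
Implicit Types (G H C : {set T}) (p q : R) (m : 'X_{1..n}) (A : {set {set T}}).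

Definition yvar G := \sum_(H in BG | G \subset H) xvar H.

(** Expanding the product adds to [A] one set [H] through each [x] of [s]. The closure of the final
    union contains [G] while no member does, so the family is not nested; a repeated [H] only
    contributes an extra factor. *)
Lemma inI_expand G (s : seq T) A : G \in BG -> A \subset BG ->
  (forall H, H \in A -> ~~ (G \subset H)) ->
  G \subset cl (\bigcup_(C in A) C :|: [set x in s]) ->
  inI (\prod_(C in A) xvar C * \prod_(x <- s) \sum_(H in BG | (x \in H) && ~~ (G \subset H)) xvar H).
Proof.
move=> GB; elim: s A => [|x s IH] A AB nA Gcl.
  rewrite big_nil mulr1; apply: inI_nonnested => //; apply/negP => nest.
  move: Gcl; have -> : [set x in [::]] = set0 :> {set T} by apply/setP => x; rewrite !inE.
  rewrite setU0 flatE; last exact: (nested_bigcup_flat ll bs nest (subxx A)).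
  move=> /(nested_BG_bigcup ll bs nest (subxx A) GB) [C CA GC].
  by move: (nA C CA); rewrite GC.
rewrite big_cons mulrA mulr_sumr mulr_suml; apply: inI_sum => H /and3P [HB xH nGH].
have HA : inI (\prod_(C in H |: A) xvar C *
    \prod_(y <- s) \sum_(K in BG | (y \in K) && ~~ (G \subset K)) xvar K).
  apply: IH.
  - by rewrite subUset sub1set HB.
  - by move=> K; rewrite in_setU1 => /orP [/eqP ->|/nA].
  - apply: subset_trans Gcl _; apply: cl_mono; rewrite bigcup_setU big_set1.
    apply/subsetP => y; rewrite !inE => /orP [->|/orP [/eqP ->|->]]; rewrite ?xH ?orbT //.
have [HinA|HnA] := boolP (H \in A).
  rewrite mulrAC; apply: inIMr; move: HA; rewrite (_ : H |: A = A) //.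
  by apply/setUidPr; rewrite sub1set.
by move: HA; rewrite big_setU1 //= [xvar H * _]mulrC.
Qed.

Lemma hvar_cl1 x : - hvar (cl [set x]) = \sum_(H in BG | x \in H) xvar H.
Proof.
rewrite opprK; apply: eq_bigl => H; case: (boolP (H \in BG)) => //= HB.
by rewrite cl1_sub ?(BG_flat bs).
Qed.

(** For [x] in [G], the sum over all [H] through [x] is a generator of [J], so modulo relations each
    truncated sum of [inI_expand] equals [- yvar G]. *)
Lemma inI_FY G (s : seq T) A : G \in BG -> A \subset BG ->
  (forall H, H \in A -> ~~ (G \subset H)) -> {subset s <= G} ->
  G \subset cl (\bigcup_(C in A) C :|: [set x in s]) ->
  inI (\prod_(C in A) xvar C * yvar G ^+ size s).
Proof.
move=> GB AB nA sG Gcl; have hE := inI_expand GB AB nA Gcl.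
have hD : inI (\prod_(x <- s) \sum_(H in BG | (x \in H) && ~~ (G \subset H)) xvar H
               - (- yvar G) ^+ size s).
  elim: s sG {Gcl hE} => [|x s IH] sG; first by rewrite big_nil expr0 subrr; apply: inI0.
  have xG : x \in G by apply: sG; rewrite inE eqxx.
  have hx : inI (\sum_(H in BG | x \in H) xvar H).
    rewrite -hvar_cl1; apply: inIN; apply: inI_atom.
    by rewrite inE flat_cl rk_cl1.
  rewrite big_cons /= exprS.
  have -> : \sum_(H in BG | (x \in H) && ~~ (G \subset H)) xvar H =
      \sum_(H in BG | x \in H) xvar H - yvar G.
    apply/esym/eqP; rewrite subr_eq addrC; apply/eqP.
    rewrite [LHS](bigID (fun H => G \subset H)) /=; congr (_ + _).
      apply: eq_bigl => H; rewrite -andbA; case: (boolP (G \subset H)) => GH; rewrite ?andbF //.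
      by rewrite (subsetP GH).
    by apply: eq_bigl => H; rewrite andbA.
  set a := \sum_(H in BG | x \in H) xvar H in hx *; set b := \big[_/_]_(_ <- s) _.
  have -> : (a - yvar G) * b - - yvar G * (- yvar G) ^+ size s =
      a * b + (- yvar G) * (b - (- yvar G) ^+ size s) by ring.
  apply: inID; first exact: inIMr.
  by apply: inIM; apply: IH => y ys; apply: sG; rewrite inE ys orbT.
have h : inI (\prod_(C in A) xvar C * (- yvar G) ^+ size s).
  set P := \prod_(C in A) xvar C in hE *; set b := \big[_/_]_(_ <- s) _ in hE hD.
  have -> : P * (- yvar G) ^+ size s = P * b + (- P) * (b - (- yvar G) ^+ size s) by ring.
  by apply: inID => //; apply: inIM.
have -> : yvar G ^+ size s = (- 1) ^+ size s * (- yvar G) ^+ size s.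
  by rewrite -exprMn mulN1r opprK.
by rewrite mulrCA; apply: inIM.
Qed.

Definition weight m := (\sum_G expo m G * rk G)%N.
Definition weight_ge w m := (w <= weight m)%N.

Lemma weightD m m' : weight (m + m') = (weight m + weight m')%N.
Proof. by rewrite -big_split; apply: eq_bigr => G _; rewrite expoD mulnDl. Qed.

Lemma weight_ge0 : weight_ge 0 0%MM. Proof. by []. Qed.
Lemma weight_geD a b m m' : weight_ge a m -> weight_ge b m' -> weight_ge (a + b) (m + m')%MM.
Proof. by rewrite /weight_ge weightD; apply: leq_add. Qed.

Lemma weight1 G : weight U_(enum_rank G) = rk G.
Proof.
rewrite /weight (bigD1 G) //= expo1 eqxx mul1n big1 ?addn0 // => H HG.
by rewrite expo1 eq_sym (negPf HG).
Qed.

Local Notation heavy := (supported weight_ge).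

Lemma heavy_xvar a G : (a <= rk G)%N -> heavy a (xvar G).
Proof.
move=> aG; rewrite /xvar; case: ifP => _; last exact: supported0.
by apply: supportedX; rewrite /weight_ge weight1.
Qed.

Section Degree.
Variable i : nat.
Definition std_seq : seq (hpoly T i) := [seq delta c | c <- enum [pred c : monom T i | standard M BG c]].
Let V := (relations i + <<std_seq>>)%VS.

Lemma proj_heavy w p :
  (forall c : monom T i, valid_monom BG c -> (w <= weight (to_mnm c))%N -> delta c \in V) ->
  heavy w p -> proj i p \in V.
Proof.
move=> h hp; rewrite (mpolyE p) linear_sum; apply: memv_suml => m _.
rewrite linearZ /=; have [->|nz] := eqVneq (p@_m) 0; first by rewrite scale0r mem0v.
apply: memvZ; case: (projX_cases BG i m) => [[c vc cE]|->]; last exact: mem0v.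
by rewrite -cE projX //; apply: h => //; rewrite cE; apply: hp.
Qed.

Lemma weight_le (c : monom T i) : valid_monom BG c -> (weight (to_mnm c) <= i * rk setT)%N.
Proof.
case/andP => /eqP sc _; rewrite -[X in (_ <= X * _)%N]sc big_distrl /=.
by apply: leq_sum => G _; rewrite expo_to_mnm leq_mul2l mrank_mono ?subsetT ?orbT.
Qed.

Lemma delta_span (c : monom T i) : valid_monom BG c -> delta c \in V.
Proof.
have [k] := ubnP (i * rk setT - weight (to_mnm c)); elim: k c => // k IH c ltk vc.
have [nc|nnc] := boolP (nested (mon_supp c)); last first.
  apply: (subvP (addvSl _ _)); apply: mem_relations; rewrite mem_cat; apply/orP; left.
  apply/mapP; exists c => //; rewrite mem_enum inE vc; apply/existsP; exists (mon_supp c).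
  have sB : mon_supp c \subset BG.
    apply/subsetP => G; rewrite inE => c0; apply: contraTT c0 => GB.
    by case/andP: vc => _ /forallP /(_ G); rewrite GB /= -eqn0Ngt.
  by rewrite sB nnc; apply/forall_inP => G; rewrite inE.
have [sc|] := boolP (standard M BG c).
  apply: (subvP (addvSr _ _)); apply: memv_span; apply: map_f.
  by rewrite mem_enum.
rewrite /standard vc nc /= negb_forall_in => /exists_inP [G Gc]; rewrite -leqNgt.
set N := mon_supp c in nc Gc *; set r := (rk G - rk (lower N G))%N => rc.
have r0 : (0 < r)%N by rewrite subn_gt0 (rk_lower ll bs nc Gc).
have GB := nested_BG nc Gc.
pose A := below N G; have AN : A \subset N := below_sub N G.
have AB : A \subset BG by apply/subsetP => C /(subsetP AN) /(nested_BG nc).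
have GA : G \notin A by rewrite inE properxx andbF.
pose e := ((\sum_(C in A) U_(enum_rank C)) + U_(enum_rank G) *+ r)%MM.
pose m' := (to_mnm c - e)%MM.
have eE H : expo e H = ((H \in A) + (H == G) * r)%N.
  by rewrite expoD expo_sum1 /expo mulmnE -/(expo _ H) expo1 eq_sym.
have mE : to_mnm c = (m' + e)%MM.
  apply: expoP => H; rewrite expoD {1}/m' {2}/expo mnmBE -!/(expo _ H) subnK // eE expo_to_mnm.
  have [->|HG] := eqVneq H G; first by rewrite (negPf GA) mul1n.
  rewrite mul0n addn0; case: (boolP (H \in A)) => // /(subsetP AN).
  by rewrite inE.
have XE : 'X_[to_mnm c] = 'X_[m'] * (\prod_(C in A) xvar C * xvar G ^+ r).
  have xG : xvar G = var G by rewrite /xvar GB.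
  by rewrite mE /e !mpolyXD prod_xvar // xG /var mpolyXn.
have [s ss [sG cs]] := flat_basis_over (lower_flat ll bs nc G) (nested_flat bs nc Gc) (lower_sub N G).
have hFY : inI (\prod_(C in A) xvar C * yvar G ^+ r).
  rewrite -[X in _ ^+ X]ss; apply: inI_FY => //; last by rewrite -/(lower N G) cs.
  by move=> H; rewrite inE properE => /and3P [].
pose z := yvar G - xvar G.
have zE : z = \sum_(H in BG | (G \subset H) && (H != G)) xvar H.
  rewrite /z /yvar (bigD1 G) ?GB ?subxx //=.
  by rewrite addrAC subrr add0r; apply: eq_bigl => H; rewrite -andbA.
have hz : heavy (rk G).+1 z.
  rewrite zE; apply: supported_sum => H /and3P [HB GH HG]; apply: heavy_xvar.
  by apply: flat_rk_lt; [apply: (nested_flat bs nc) | rewrite properEneq eq_sym HG].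
have hy : heavy (rk G) (yvar G).
  by apply: supported_sum => H /andP [HB GH]; apply: heavy_xvar; apply: mrank_mono.
pose D := yvar G ^+ r - xvar G ^+ r.
(* The difference is divisible by [z], whose variables all have rank above that of [G], so at least
   one unit of weight is gained. The induction ends because weights are at most [i * rk setT]. *)
have hD : heavy ((rk G).+1 + r.-1 * rk G) D.
  rewrite /D subrXX -/z; apply: (supportedM weight_geD) => //; apply: supported_sum => j _.
  have -> : (r.-1 * rk G = (r.-1 - j) * rk G + j * rk G)%N.
    by rewrite -mulnDl subnK // -ltnS prednK.
  apply: (supportedM weight_geD); first exact: (supported_exp weight_ge0 weight_geD).
  by apply: (supported_exp weight_ge0 weight_geD); apply: heavy_xvar.
have XD : 'X_[m'] * (\prod_(C in A) xvar C * xvar G ^+ r) =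
    'X_[m'] * (\prod_(C in A) xvar C * yvar G ^+ r) - 'X_[m'] * (\prod_(C in A) xvar C * D).
  by rewrite -mulrBr -mulrBr /D opprB addrCA subrr addr0.
rewrite -(projX vc) XE XD linearB /=.
apply: memvB; first by apply: (subvP (addvSl _ _)); apply: hFY.
apply: (@proj_heavy (weight (to_mnm c)).+1).
  move=> d vd ld; apply: IH => //; have := weight_le vd; move: ltk ld.
  by clear; lia.
have -> : (weight (to_mnm c)).+1 = (weight m' + (\sum_(C in A) rk C + ((rk G).+1 + r.-1 * rk G)))%N.
  have we : weight e = (\sum_(C in A) rk C + r * rk G)%N.
    rewrite /weight; under eq_bigr => H _ do rewrite eE mulnDl.
    rewrite big_split /=; congr addn.
      by rewrite [RHS]big_mkcond; apply: eq_bigr => H _; case: (H \in A); rewrite ?mul1n.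
    rewrite (bigD1 G) //= eqxx mul1n big1 ?addn0 // => H /negPf ->; by rewrite mul0n.
  rewrite mE weightD we -[in LHS](prednK r0) mulSn; clear; lia.
apply: (supportedM weight_geD); first by apply: supportedX; rewrite /weight_ge.
apply: (supportedM weight_geD) => //.
by apply: (supported_prod weight_ge0 weight_geD) => C _; apply: heavy_xvar.
Qed.

Lemma dimCH_le : (dimCH M BG i <= #|[pred c : monom T i | standard M BG c]|)%N.
Proof.
rewrite /dimCH leq_subLR.
have sub : (<<Pgens BG i>> <= V)%VS.
  apply/span_subvP => v /mapP [c]; rewrite mem_enum inE => vc ->; exact: delta_span.
apply: leq_trans (dimvS sub) _; apply: leq_trans (dimv_add_leqif _ _).1 _.
rewrite leq_add2l; apply: leq_trans (dim_span _) _.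
by rewrite size_map -cardE.
Qed.

End Degree.
End Spanning.

(** * Functionals on the Chow ring *)

Lemma sum_sign_involution (U : finType) (A : {set U}) (F : {set U} -> rat) (x : U) :
  x \in A -> (forall K : {set U}, K \subset A -> x \notin K -> F (x |: K) = - F K) ->
  \sum_(K : {set U} | K \subset A) F K = 0.
Proof.
move=> xA hF; rewrite (bigID (fun K : {set U} => x \in K)) /=.
rewrite (reindex_onto (fun K => x |: K) (fun K => K :\ x)) /=; last first.
  by move=> K /andP [_ xK]; rewrite setD1K.
have -> : \sum_(K : {set U} | (x |: K \subset A) && (x \in x |: K) && ((x |: K) :\ x == K)) F (x |: K)
    = \sum_(K : {set U} | (K \subset A) && (x \notin K)) - F K.
  have eqb (K : {set U}) : (x |: K \subset A) && (x \in x |: K) && ((x |: K) :\ x == K) =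
      (K \subset A) && (x \notin K).
    rewrite subUset sub1set xA setU11 andbT /=; congr (_ && _).
    apply/eqP/idP => [<-|xK]; first by rewrite !inE eqxx.
    by rewrite setU1K.
  rewrite (eq_bigl _ _ eqb); apply: eq_bigr => K /andP [KA xK]; exact: hF.
by rewrite sumrN addNr.
Qed.

Lemma dhr_eq (T : finType) (M : matroid T) (J : {set T}) (D : {set {set T}}) (nu1 nu2 : {set T} -> nat) :
  {in D, nu1 =1 nu2} -> dhr M J D nu1 = dhr M J D nu2.
Proof.
move=> E; apply: eq_forallb => V; case: (boolP (V \subset D)) => //= /subsetP VD.
by under eq_bigr => H HV do rewrite E ?VD //.
Qed.

Section Functional.
Variables (T : finType) (M : matroid T) (BG : {set {set T}}).
Hypotheses (ll : loopless M) (bs : building_set M BG).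
Variables (N : {set {set T}}) (f : {set T} -> nat) (i : nat).
Local Notation rk := (mrank M).
Local Notation cl := (cl M).
Local Notation nested := (nested M BG).
Local Notation n := #|{: {set T}}|.
Local Notation R := {mpoly rat[n]}.
Hypotheses (nN : nested N) (EN : setT \in N).
Implicit Types (F G H C B : {set T}) (p q : R) (m : 'X_{1..n}) (A K : {set {set T}}).

(* [dom G] collects the elements of the building set that live in the interval [[J^G, G]]. *)
Definition dom G := [set H in BG | (H \subset G) && ~~ (H \subset lower N G)].
Definition omega m := (mdeg m == i) &&
  [forall G in N, ((\sum_(H in dom G) expo m H)%N == f G) && dhr M (lower N G) (dom G) (expo m)].
Definition phi p : rat := \sum_(m : 'X_{1..n < i.+1}) p@_m * (omega m)%:R.

Lemma phi_linear : scalar phi.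
Proof.
move=> a p q; rewrite /phi mulr_sumr -big_split; apply: eq_bigr => m _ /=.
by rewrite mcoeffD mcoeffZ mulrDl mulrA.
Qed.
HB.instance Definition _ := GRing.isLinear.Build rat R rat _ phi phi_linear.

Lemma phiX m : phi 'X_[m] = (omega m)%:R.
Proof.
have [lm|lm] := ltnP (mdeg m) i.+1.
  rewrite /phi (bigD1 (BMultinom lm)) //= mcoeffX eqxx mul1r big1 ?addr0 // => m' neq.
  rewrite mcoeffX; case: eqP => [E|]; last by rewrite mul0r.
  by case/eqP: neq; apply: val_inj.
rewrite /omega gtn_eqF //= /phi big1 // => m' _.
rewrite mcoeffX; case: eqP => [E|]; last by rewrite mul0r.
by have := bmdeg m'; rewrite -E ltnNge lm.
Qed.

(** The largest ideal contained in the kernel of [phi]. *)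
Definition inK p := forall q, phi (q * p) = 0.

Lemma inK_mono p : (forall m, phi ('X_[m] * p) = 0) -> inK p.
Proof.
move=> h q; rewrite (mpolyE q) mulr_suml linear_sum big1 // => m _.
by rewrite -scalerAl linearZ /= h mulr0.
Qed.

Lemma inK0 : inK 0. Proof. by move=> q; rewrite mulr0 linear0. Qed.
Lemma inKD p q : inK p -> inK q -> inK (p + q).
Proof. by move=> hp hq r; rewrite mulrDr linearD /= hp hq addr0. Qed.
Lemma inKM q p : inK p -> inK (q * p).
Proof. by move=> hp r; rewrite mulrA hp. Qed.
Lemma inKMr q p : inK p -> inK (p * q).
Proof. by rewrite mulrC; apply: inKM. Qed.
Lemma inKN p : inK p -> inK (- p).
Proof. by rewrite -mulN1r; apply: inKM. Qed.
Lemma inK_sum (I : Type) (r : seq I) (P : pred I) (F : I -> R) :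
  (forall j, P j -> inK (F j)) -> inK (\sum_(j <- r | P j) F j).
Proof. by move=> h; elim/big_ind: _ => //; [exact: inK0 | exact: inKD]. Qed.

Lemma dom_top H : H \in BG -> top N H \in N /\ H \in dom (top N H).
Proof.
move=> HB; have [tN Ht tmin] := topP ll bs nN EN (BG_neq0 bs HB).
split=> //; rewrite inE HB Ht /=; apply/negP => Hl.
have [C] := nested_BG_bigcup ll bs nN (below_sub N _) HB Hl.
by rewrite inE => /andP [CN]; rewrite properE => /andP [_ /negP h] /(tmin C CN).
Qed.

Lemma dom_uniq G H : G \in N -> H \in dom G -> top N H = G.
Proof.
move=> GN; rewrite inE => /and3P [HB HG Hl].
have [tN Ht tmin] := topP ll bs nN EN (BG_neq0 bs HB).
apply/eqP; apply: contraNT Hl => neq; apply: subset_trans Ht _; apply: sub_lower => //.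
by rewrite properEneq neq tmin.
Qed.

(** An atom raises the rank of [J^G] by at most one, while the condition on the family consisting of
    this atom asks for one plus its exponent, which is positive. *)
Lemma inK_atom e : inK (var (cl [set e])).
Proof.
apply: inK_mono => m; rewrite -mpolyXD phiX; suff -> : omega (m + U_(enum_rank (cl [set e]))) = false by [].
apply/negP => /andP [_ /forall_inP h].
have [GN aG] := dom_top (atom_BG ll bs e); set G := top N _ in GN aG.
have /andP [_ /dhrP /(_ [set cl [set e]])] := h G GN.
rewrite sub1set aG => /(_ isT); rewrite big_set1 expoD expo1 eqxx /span_over big_set1.
have -> : [set cl [set e]] != set0 by apply/set0Pn; exists (cl [set e]); rewrite set11.
have -> : rk (lower N G :|: cl [set e]) = rk (lower N G :|: [set e]).
  by rewrite -rk_cl setUC cl_clU setUC rk_cl.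
move=> /(_ isT); rewrite setUC; have := rk_subU1 M e (lower N G).
by clear; lia.
Qed.

Section Exchange.
Variables (A : {set {set T}}).
Hypotheses (AB : A \subset BG) (aA : antichain A) (cA : (1 < #|A|)%N) (BB : join_fam M A \in BG).
Variable m : 'X_{1..n}.
Let B := join_fam M A.
Let G0 := top N B.

(** The exponent of the term of ['X_[m] * \prod_(F in A) (var F - var B)] in which the factors
    indexed by [K] contribute [B]. *)
Definition partial K := (m + (U_(enum_rank B) *+ #|K| + \sum_(F in A :\: K) U_(enum_rank F)))%MM.

Lemma expo_partial K H : expo (partial K) H = (expo m H + (H == B) * #|K| + (H \in A :\: K))%N.
Proof.
by rewrite !expoD expo_sum1 {2}/expo mulmnE -/(expo _ H) expo1 eq_sym addnA.
Qed.

Lemma factor_sub F : F \in A -> F \subset B.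
Proof. by move=> FA; apply: subset_trans (cl_ext _ _); apply: bigcup_sup. Qed.

Lemma join_notin : B \notin A.
Proof.
apply/negP => BA; have : A \subset [set B].
  apply/subsetP => F FA; rewrite inE; apply/eqP; have/antichainP := aA; apply=> //.
  exact: factor_sub.
by move/subset_leq_card; rewrite cards1 leqNgt cA.
Qed.

(** [B] and the chosen [x] both belong to [dom G0], so toggling [x] leaves the other intervals
    alone, and in that of [G0] it is [dhr_exchange]. The members of [A] outside [dom G0] are inside
    [J], hence the others still span [B] over [J]. *)
Lemma omega_exchange : exists2 x, x \in A &
  forall K, K \subset A -> x \notin K -> omega (partial K) = omega (partial (x |: K)).
Proof.
have [G0N BG0] := dom_top BB; rewrite -/B -/G0 in G0N BG0.
set D := dom G0 in BG0; set J := lower N G0.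
pose A0 := [set F in A | F \in D].
have A0D : A0 \subset D by apply/subsetP => F; rewrite inE => /andP [].
have A0A : A0 \subset A by apply/subsetP => F; rewrite inE => /andP [].
have fJ : flat M J := lower_flat ll bs nN G0.
have BGs : B \subset G0 by move: BG0; rewrite inE => /and3P [].
have lowF F : F \in A -> F \notin D -> F \subset J.
  move=> FA; rewrite inE (subsetP AB) // (subset_trans (factor_sub FA) BGs) /=.
  by rewrite negbK.
have BN : B \subset cl (span_over J A0).
  apply: cl_mono; apply/bigcupsP => F FA; case: (boolP (F \in D)) => FD.
    by apply: subset_trans (subsetUr _ _); apply: (bigcup_max F); rewrite // inE FA.
  by apply: subset_trans (subsetUl _ _); apply: lowF.
have A00 : A0 != set0.
  apply/negP => /eqP E; move: BG0; rewrite inE => /and3P [_ _ /negP]; apply.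
  apply: cl_min => //; apply/bigcupsP => F FA; apply: lowF => //.
  by apply/negP => FD; have := in_set0 F; rewrite -E inE FA FD.
(* Members of [K] outside [A0] also contribute copies of [B]. When the degree condition at [G0]
   holds, their number is forced to be [k0], whatever [K] is, so these copies can be absorbed into
   [mu]. *)
pose k0 := (f G0 - (\sum_(H in D) expo m H + #|A0|))%N.
pose mu H := (expo m H + (H == B) * k0)%N.
have [x xA0 hx] := dhr_exchange mu A0D A00 BG0 (fun F FA => factor_sub (subsetP A0A F FA)) BN.
have xA := subsetP A0A x xA0; have xD := subsetP A0D x xA0.
exists x; first exact: xA.
move=> K KA xK.
have BA := join_notin.
have xKA : x |: K \subset A by rewrite subUset sub1set xA.
have cxK : #|x |: K| = #|K|.+1 by rewrite cardsU1 xK.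
have xB : x != B by apply: contraNneq BA => <-.
have AxK : A :\: K = x |: (A :\: (x |: K)).
  by apply/setP => F; rewrite !inE negb_or; case: (eqVneq F x) => [->|]; rewrite ?xK ?xA.
have degE : mdeg (partial K) = mdeg (partial (x |: K)).
  have deg K' : K' \subset A -> mdeg (partial K') = (mdeg m + #|A|)%N.
    move=> K'A; rewrite !mdegD mdegMn mdeg1 mul1n mdeg_sum.
    under eq_bigr => F _ do rewrite mdeg1; rewrite sum1_card cardsDS //.
    by rewrite subnKC // subset_leq_card.
  by rewrite !deg.
rewrite /omega -degE; apply: andb_id2l => _; apply: eq_forallb => G; case: (boolP (G \in N)) => [GN|_]; last by [].
rewrite !implyTb.
have [GE|GG0] := eqVneq G G0; last first.
  have eqx : {in dom G, expo (partial K) =1 expo (partial (x |: K))}.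
    move=> H HG; have tH := dom_uniq GN HG.
    have HB : H == B = false.
      by apply/negP => /eqP HB; case/eqP: GG0; rewrite -tH HB.
    have Hx : H == x = false.
      by apply/negP => /eqP Hx; case/eqP: GG0; rewrite -tH Hx; apply: dom_uniq xD.
    by rewrite !expo_partial HB AxK in_setU1 Hx.
  by rewrite (dhr_eq M _ eqx) (eq_bigr _ eqx).
rewrite GE -/D -/J.
have sumE K' : K' \subset A ->
    (\sum_(H in D) expo (partial K') H = \sum_(H in D) expo m H + #|K'| + #|A0 :\: K'|)%N.
  move=> K'A; under eq_bigr => H _ do rewrite expo_partial.
  rewrite !big_split /=; congr (_ + _ + _)%N.
    by rewrite (bigD1 B) //= eqxx mul1n big1 ?addn0 // => H /andP [_ /negPf ->].
  rewrite -sum1_card [LHS]big_mkcond [RHS]big_mkcond; apply: eq_bigr => H _.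
  by rewrite !in_setD [H \in A0]inE; case: (H \in D); case: (H \in A); case: (H \in K').
have c0 : #|A0 :\: K| = (#|A0 :\: (x |: K)|).+1.
  have xAK : x \in A0 :\: K by rewrite in_setD xK xA0.
  rewrite (cardsD1 x) xAK add1n; congr _.+1.
  by apply: eq_card => F; rewrite !in_setD in_set1 in_setU1 negb_or andbA.
rewrite !sumE // cxK c0 !addnS addSn.
case: eqP => //= fE.
pose K0 := K :&: A0.
have K0A : K0 \subset A0 := subsetIr _ _.
have xK0 : x \notin K0 by rewrite inE (negPf xK).
have k0E : (k0 + #|K0| = #|K|)%N.
  have := cardsID K A0; rewrite setIC -/K0 c0 => c1.
  have c2 : (#|K0| <= #|K|)%N by apply/subset_leq_card/subsetIl.
  move: fE c1 c2; rewrite /k0; move: (\sum_(H in D) expo m H)%N #|K| #|K0| #|A0| #|A0 :\: (x |: K)| (f G0) => a b c d e g; clear; lia.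
have inA0 H : H \in D -> (H \in A0) = (H \in A) by move=> HD; rewrite in_set HD andbT.
have e1 : {in D, exch B A0 mu K0 =1 expo (partial K)}.
  move=> H HD; rewrite expo_partial /exch /mu -k0E mulnDr !in_setD in_setI inA0 //.
  rewrite addnAC !addnA; congr (_ + nat_of_bool _)%N.
  by case: (H \in A); case: (H \in K).
have e2 : {in D, exch B A0 mu (x |: K0) =1 expo (partial (x |: K))}.
  move=> H HD; rewrite expo_partial /exch /mu cxK cardsU1 xK0 add1n -k0E -addnS mulnDr.
  rewrite !in_setD !in_setU1 in_setI inA0 //.
  rewrite addnAC !addnA; congr (_ + nat_of_bool _)%N.
  by case: (H == x); case: (H \in A); case: (H \in K).
by rewrite -(dhr_eq M J e1) -(dhr_eq M J e2) hx.
Qed.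

End Exchange.

Lemma inK_prod A : A \subset BG -> antichain A -> (1 < #|A|)%N -> join_fam M A \in BG ->
  inK (\prod_(F in A) (var F - var (join_fam M A))).
Proof.
move=> AB aA cA BB; apply: inK_mono => m; set B := join_fam M A in BB *.
have distr : \prod_(F in A) (var F - var B) = \sum_(K : {set {set T}} | K \subset A)
    (-1) ^+ #|K| * 'X_[(U_(enum_rank B) *+ #|K| + \sum_(F in A :\: K) U_(enum_rank F))%MM] :> R.
  rewrite big_mkcond /=.
  rewrite (eq_bigr (fun F => (if F \in A then - var B else 0) + (if F \in A then var F else 1))); last first.
    by move=> F _; case: ifP; rewrite ?add0r // addrC.
  rewrite bigA_distr [LHS](bigID (fun K : {set {set T}} => K \subset A)) /= [X in _ + X]big1 ?addr0; last first.
    by move=> K /subsetPn [F FK FA]; rewrite (bigD1 F) //= FK (negPf FA) mul0r.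
  apply: eq_bigr => K KA; rewrite mpolyXD -var_sum -mpolyXn -/(var B).
  rewrite mulrA -exprMn mulN1r (bigID (mem K)) /=; congr (_ * _).
    rewrite -prodr_const; apply: eq_bigr => F FK; by rewrite FK (subsetP KA).
  rewrite [RHS]big_mkcond [LHS]big_mkcond; apply: eq_bigr => F _; rewrite in_setD.
  by case: (F \in K).
rewrite distr mulr_sumr linear_sum /=.
have [x xA hx] := omega_exchange AB aA cA BB m.
apply: (sum_sign_involution xA) => K KA xK.
rewrite cardsU1 xK add1n exprS !mulN1r mulNr mulrN linearN /=; congr (- _).
have sgn j p : phi ('X_[m] * ((-1) ^+ j * p)) = (-1) ^+ j * phi ('X_[m] * p).
  rewrite mulrCA -(rmorphN1 (@mpolyC n rat)) -rmorphXn /= mul_mpolyC linearZ //=.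
rewrite !sgn -!mpolyXD !phiX; have := hx K KA xK; rewrite /partial cardsU1 xK add1n => <- //.
Qed.

Section Inverse.
Variable y : {set T} -> R.
Hypothesis yE : forall G, G \in BG -> \sum_(H in BG | G \subset H) y H = - var G.

Lemma join_sum A F : F \in A -> A \subset BG -> join_fam M A \in BG ->
  var F - var (join_fam M A) = - \sum_(H | (H \in BG) && ((F \subset H) && ~~ (join_fam M A \subset H))) y H.
Proof.
move=> FA AB BB; set B := join_fam M A in BB *.
have FB : F \subset B by apply: subset_trans (cl_ext _ _); apply: bigcup_sup.
have E : \sum_(H in BG | F \subset H) y H = \sum_(H in BG | B \subset H) y H +
    \sum_(H | (H \in BG) && ((F \subset H) && ~~ (B \subset H))) y H.
  rewrite (bigID (fun H => B \subset H)) /=; congr (_ + _); apply: eq_bigl => H; last by rewrite andbA.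
  case: (boolP (B \subset H)) => BH; rewrite ?andbF ?andbT //.
  by rewrite (subset_trans FB BH) andbT.
move: E; rewrite yE ?(subsetP AB) // yE // => E.
by rewrite -[var F]opprK E opprD opprK addrAC subrr add0r.
Qed.

(** Rewriting the factors of [inK_prod] by [join_sum] and expanding gives, up to sign,
    [\prod_(F in A) y F] plus products over families whose join contains [B] while no member does.
    These are not nested, so they contain an antichain with join in the building set; its total [wt]
    is smaller because ranks have gone up. *)
Lemma inK_antichain A : A \subset BG -> antichain A -> (1 < #|A|)%N -> join_fam M A \in BG ->
  inK (\prod_(F in A) y F).
Proof.
pose wt F := (rk setT - rk F).+1.
have [k] := ubnP (\sum_(F in A) wt F)%N; elim: k A => // k IH A ltk AB aA cA BB.
have := inK_prod AB aA cA BB; set B := join_fam M A in BB *.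
rewrite (eq_bigr _ (fun F FA => join_sum FA AB BB)) -/B prodrN => /(inKM ((-1) ^+ #|A|)).
rewrite mulrA -exprMn mulrNN mulr1 expr1n mul1r.
rewrite (big_distr_big_dep set0) /=.
pose f0 : {ffun {set T} -> {set T}} := [ffun F => if F \in A then F else set0].
set Q := pfamily _ _ _; have f0Q : f0 \in Q.
  apply/pfamilyP; split.
    by apply/subsetP => F; rewrite !inE ffunE; case: ifP => //; rewrite eqxx.
  move=> F FA; rewrite ffunE [X in if X then _ else _]FA unfold_in /= (subsetP AB) // subxx /=.
  apply/negP => BF; have : A \subset [set F].
    apply/subsetP => C CA; rewrite inE; apply/eqP; have/antichainP := aA; apply=> //.
    apply: subset_trans BF; apply: subset_trans (cl_ext _ _); exact: bigcup_sup.
  by move/subset_leq_card; rewrite cards1 leqNgt cA.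
rewrite (bigD1 f0) //= => hK.
have -> : \prod_(F in A) y F =
    (\prod_(F in A) y (f0 F) + \sum_(g in Q | g != f0) \prod_(F in A) y (g F)) -
    \sum_(g in Q | g != f0) \prod_(F in A) y (g F).
  by rewrite addrK; apply: eq_bigr => F FA; rewrite ffunE FA.
apply: inKD; first by [].
apply: inKN; apply: inK_sum => g /andP [/pfamilyP [gs gQ] gf0].
have gF F : F \in A -> [/\ g F \in BG, F \subset g F & ~~ (B \subset g F)].
  by move=> FA; have := gQ F FA; rewrite unfold_in /= => /and3P [].
have gAB : g @: A \subset BG by apply/subsetP => C /imsetP [F FA ->]; case: (gF F FA).
have nn : ~~ nested (g @: A).
  apply/negP => nest; have fl := nested_bigcup_flat ll bs nest (subxx _).
  have : B \subset \bigcup_(C in g @: A) C.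
    apply: cl_min => //; apply/bigcupsP => F FA; apply: (bigcup_max (g F)); first exact: imset_f.
    by case: (gF F FA).
  case/(nested_BG_bigcup ll bs nest (subxx _) BB) => C /imsetP [F FA ->] BgF.
  by case: (gF F FA) => _ _; rewrite BgF.
have [A' [A'g aA' cA' BA']] := nonnestedP gAB nn.
have wtlt : (\sum_(C in A') wt C < k)%N.
  have l1 : (\sum_(C in A') wt C <= \sum_(C in g @: A) wt C)%N.
    rewrite [X in (_ <= X)%N](big_setID A') /= (setIidPr A'g); exact: leq_addr.
  have l2 : (\sum_(C in g @: A) wt C <= \sum_(F in A) wt (g F))%N.
    rewrite [X in (_ <= X)%N](partition_big_imset g) /=; apply: leq_sum => C /imsetP [F FA ->].
    by rewrite (bigD1 F) ?FA ?eqxx //= leq_addr.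
  have [F FA gFF] : exists2 F, F \in A & g F != F.
    apply/exists_inP; apply: contraNT gf0; rewrite negb_exists_in => /forall_inP h.
    apply/eqP/ffunP => F; rewrite ffunE; case: ifPn => FA; first by apply/eqP; have := h F FA; rewrite negbK.
    by apply/eqP; apply: contraNT FA => nz; have := subsetP gs F; rewrite !inE nz => ->.
  have [gB Fg _] := gF F FA.
  have l3 : (\sum_(F in A) wt (g F) < \sum_(F in A) wt F)%N.
    rewrite [X in (X < _)%N](bigD1 F) //= [X in (_ < X)%N](bigD1 F) //= -addSn; apply: leq_add.
      have : (rk F < rk (g F))%N.
        apply: flat_rk_lt; first by apply: BG_flat (subsetP AB F FA).
        by rewrite properEneq eq_sym gFF.
      have gT : (rk (g F) <= rk setT)%N by apply: mrank_mono; apply: subsetT.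
      by move: gT; rewrite /wt; move: (rk F) (rk (g F)) (rk setT) => a b c; clear; lia.
    apply: leq_sum => C /andP [CA _]; have [_ Cg _] := gF C CA.
    by rewrite ltnS leq_sub2l // mrank_mono.
  by rewrite -ltnS; apply: leq_trans ltk; rewrite ltnS; apply: leq_ltn_trans l3; apply: leq_trans l2.
have hA' : inK (\prod_(C in A') y C) by apply: IH => //; apply: subset_trans gAB.
rewrite (partition_big_imset g) /=.
rewrite (eq_bigr (fun C => y C * y C ^+ #|[set F in A | g F == C]|.-1)); last first.
  move=> C /imsetP [F FA CE]; rewrite -exprS prednK; last first.
    by apply/card_gt0P; exists F; rewrite inE FA CE eqxx.
  rewrite -prodr_const; rewrite [RHS](eq_bigl (fun F' => (F' \in A) && (g F' == C))); last by move=> F'; rewrite inE.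
  by apply: eq_bigr => F' /andP [_ /eqP ->].
rewrite big_split /=; apply: inKMr; rewrite (big_setID A') /= (setIidPr A'g).
exact: inKMr.
Qed.

Lemma inK_nonnested A : A \subset BG -> ~~ nested A -> inK (\prod_(F in A) y F).
Proof.
move=> AB nA; have [A' [A'A aA' cA' BA']] := nonnestedP AB nA.
rewrite (big_setID A') /= (setIidPr A'A); apply: inKMr; apply: inK_antichain => //.
exact: subset_trans AB.
Qed.

End Inverse.
End Functional.

(** * Transport of the functionals to the Chow ring *)

Section LowerBound.
Variables (T : finType) (M : matroid T) (BG : {set {set T}}).
Hypotheses (ll : loopless M) (bs : building_set M BG) (topBG : setT \in BG).
Local Notation rk := (mrank M).
Local Notation cl := (cl M).
Local Notation nested := (nested M BG).
Local Notation n := #|{: {set T}}|.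
Local Notation R := {mpoly rat[n]}.
Local Notation xvar := (xvar BG).
Local Notation hvar := (hvar BG).
Local Notation proj := (proj BG).
Local Notation relations := (relations M BG).
Implicit Types (F G H C : {set T}) (p q : R) (m : 'X_{1..n}) (A K N : {set {set T}}).

(* [x_G |-> ypoly G] inverts the substitution [x_G |-> h_G]; the recursion goes up in the
   building set, and [k] is fuel. *)
Fixpoint yrec k G : R :=
  if k is k'.+1 then - var G - \sum_(H in BG | G \proper H) yrec k' H else 0.
Definition ypoly G := yrec #|T|.+1 G.

Lemma yrec_fuel k1 k2 G : (#|T| - #|G| < k1)%N -> (#|T| - #|G| < k2)%N -> yrec k1 G = yrec k2 G.
Proof.
elim: k1 k2 G => [|k1 IH] [|k2] G //= h1 h2; congr (_ - _).
apply: eq_bigr => H /andP [_ /proper_card cGH].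
have cH : (#|H| <= #|T|)%N := max_card _.
apply: IH; move: h1 h2 cGH cH; move: #|T| #|G| #|H| => a b c; clear; lia.
Qed.

Lemma ypolyE G : G \in BG -> \sum_(H in BG | G \subset H) ypoly H = - var G.
Proof.
move=> GB; rewrite (bigD1 G) ?GB ?subxx //= {1}/ypoly /=.
apply/eqP; rewrite addrAC subr_eq addrC eq_sym [X in _ == X]addrC; apply/eqP; congr (_ + _).
rewrite [RHS](eq_bigl (fun H => (H \in BG) && (G \proper H))); last first.
  by move=> H; rewrite -andbA properEneq eq_sym [(_ != _) && _]andbC.
apply: eq_bigr => H /andP [_ pGH]; have cGH := proper_card pGH.
have cH : (#|H| <= #|T|)%N := max_card _.
apply: yrec_fuel; move: cGH cH; move: #|T| #|G| #|H| => a b c; clear; lia.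
Qed.

Definition ytuple := [tuple ypoly (enum_val j) | j < n].
Definition subst p : R := p \mPo ytuple.

Lemma subst_var G : subst (var G) = ypoly G.
Proof.
rewrite /subst /var comp_mpolyXU -(tnth_nth 0 ytuple) tnth_mktuple enum_rankK //.
Qed.

Lemma subst_hvar G : G \in BG -> subst (hvar G) = var G.
Proof.
move=> GB; rewrite /hvar /subst rmorphN rmorph_sum /= -[RHS]opprK -(ypolyE GB).
congr (- _); apply: eq_bigr => H /andP [HB _].
by rewrite -subst_var /subst /xvar HB.
Qed.

Section OneFunctional.
Variables (N : {set {set T}}) (f : {set T} -> nat) (i : nat).
Hypotheses (nN : nested N) (EN : setT \in N).
Local Notation phi := (phi M BG N f i).
Local Notation inK := (inK M BG N f i).

Definition Lfun p := phi (subst p).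

Lemma Lfun_linear : scalar Lfun.
Proof. by move=> a p q; rewrite /Lfun /subst linearP /= linearP. Qed.
HB.instance Definition _ := GRing.isLinear.Build rat R rat _ Lfun Lfun_linear.

Definition lam_hpoly (v : hpoly T i) : rat := \sum_(c : monom T i) v c * Lfun 'X_[to_mnm c].

Lemma lam_hpoly_linear : scalar lam_hpoly.
Proof.
move=> a u v; rewrite /lam_hpoly mulr_sumr -big_split; apply: eq_bigr => c _ /=.
by rewrite !ffunE mulrDl mulrA.
Qed.
HB.instance Definition _ := GRing.isLinear.Build rat (hpoly T i) rat _ lam_hpoly lam_hpoly_linear.

Definition homogBG k m := (mdeg m == k) && [forall G, (G \notin BG) ==> (expo m G == 0%N)].

Lemma homog0 : homogBG 0 0%MM.
Proof. by rewrite /homogBG mdeg0 eqxx; apply/forallP => G; rewrite /expo mnm0E implybT. Qed.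

Lemma homogD a b m m' : homogBG a m -> homogBG b m' -> homogBG (a + b) (m + m')%MM.
Proof.
case/andP => /eqP dm /forallP hm /andP [/eqP dm' /forallP hm']; rewrite /homogBG mdegD dm dm' eqxx.
apply/forallP => G; apply/implyP => GB; rewrite expoD.
by rewrite (eqP (implyP (hm G) GB)) (eqP (implyP (hm' G) GB)).
Qed.

Lemma homog1 G : G \in BG -> homogBG 1 U_(enum_rank G).
Proof.
move=> GB; rewrite /homogBG mdeg1 eqxx; apply/forallP => H; apply/implyP => HB.
by rewrite expo1; have [E|//] := eqVneq G H; rewrite -E GB in HB.
Qed.

Lemma homog_hvar G : supported homogBG 1 (hvar G).
Proof.
apply: supportedN; apply: supported_sum => H /andP [HB _].
by rewrite /xvar HB; apply: supportedX; apply: homog1.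
Qed.

Lemma homog_to_mnm k (c : monom T k) : valid_monom BG c -> homogBG k (to_mnm c).
Proof.
move=> vc; rewrite /homogBG (mdeg_valid vc) eqxx; apply/forallP => G; apply/implyP => GB.
rewrite expo_to_mnm; by case/andP: vc => _ /forallP /(_ G); rewrite GB.
Qed.

Lemma homogP m : homogBG i m -> exists2 c : monom T i, valid_monom BG c & to_mnm c = m.
Proof.
case/andP => /eqP dm /forallP hm.
have mle G : (expo m G < i.+1)%N by rewrite ltnS -dm mdeg_expo (bigD1 G) //= leq_addr.
pose c : monom T i := [ffun G => Ordinal (mle G)].
have cE : to_mnm c = m by apply: expoP => G; rewrite expo_to_mnm ffunE.
exists c => //; apply/andP; split; first by rewrite -mdeg_to_mnm cE dm.
by apply/forallP => G; rewrite ffunE; apply: hm.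
Qed.

Lemma Jgens_proj u : u \in Jgens M BG i -> exists m e,
  u = proj i ('X_[m] * - hvar (cl [set e])) /\ supported homogBG i ('X_[m] * - hvar (cl [set e])).
Proof.
case: i u => [|j] u; first by rewrite in_nil.
case/allpairsP => -[a c'] /= []; rewrite mem_enum inE => /andP [fa /eqP ra].
rewrite mem_enum inE => vc ->; have a0 : a != set0.
  by apply: contraTneq isT => E; move: ra; rewrite E rk_set0.
case/set0Pn: a0 => e ea; have aE : a = cl [set e].
  by apply/esym/flat_eq; [exact: flat_cl | rewrite cl1_sub | rewrite rk_cl1 // ra].
exists (to_mnm c'), e; rewrite -aE; split; first exact: jgenE.
rewrite -addn1; apply: (supportedM homogD); first by apply: supportedX; apply: homog_to_mnm.
exact: (supportedN (@homog_hvar a)).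
Qed.

Lemma lam_hpoly_proj p : supported homogBG i p -> lam_hpoly (proj i p) = Lfun p.
Proof.
move=> hp; rewrite [in LHS](mpolyE p) [in RHS](mpolyE p) !linear_sum /=.
apply: eq_big_seq => m; rewrite mcoeff_msupp => /hp /homogP [c vc <-].
rewrite !linearZ /= projX //; congr (_ * _).
rewrite /lam_hpoly (bigD1 c) //= ffunE eqxx mul1r big1 ?addr0 // => d /negPf dc.
by rewrite ffunE dc mul0r.
Qed.

Lemma Lfun_kill p q : inK (subst p) -> Lfun (q * p) = 0.
Proof. by move=> h; rewrite /Lfun /subst rmorphM /= h. Qed.

(** The substitution turns a generator of [I] into a multiple of a product of [ypoly] over a
    non-nested family, and one of [J] into a multiple of the variable of an atom; both lie in
    [inK]. *)
Lemma lam_hpoly_relations v : v \in relations i -> lam_hpoly v = 0.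
Proof.
have key u : u \in Igens M BG i ++ Jgens M BG i -> lam_hpoly u = 0.
  rewrite mem_cat => /orP [/mapP [c]|].
    rewrite mem_enum inE => /andP [vc /existsP [A /and3P [AB nA /forall_inP cA]]] ->.
    rewrite -(projX vc) lam_hpoly_proj; last by apply: supportedX; apply: homog_to_mnm.
    pose e := (\sum_(G in A) U_(enum_rank G))%MM.
    have -> : to_mnm c = (to_mnm c - e + e)%MM.
      apply: expoP => G; rewrite expoD {2}/expo mnmBE -!/(expo _ G) subnK // expo_sum1.
      by case: (boolP (G \in A)) => // /cA; rewrite expo_to_mnm.
    rewrite mpolyXD -(prod_xvar AB); apply: Lfun_kill; rewrite /subst rmorph_prod /=.
    rewrite (eq_bigr ypoly) => [|G GA]; first exact: (inK_nonnested ll bs f i nN EN ypolyE AB nA).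
    by rewrite -subst_var /xvar (subsetP AB).
  case/Jgens_proj => m [e [-> hm]]; rewrite lam_hpoly_proj //; apply: Lfun_kill.
  rewrite /subst rmorphN /= -/(subst _) subst_hvar ?atom_BG //; apply: inKN.
  exact: inK_atom.
move=> vr; rewrite (coord_span (X := in_tuple (Igens M BG i ++ Jgens M BG i)) vr) linear_sum big1 // => j _.
by rewrite linearZ /= key ?mulr0 // mem_nth.
Qed.

Definition hprod (c : monom T i) : R := \prod_G hvar G ^+ (c G).

Lemma hprod_homog c : valid_monom BG c -> supported homogBG i (hprod c).
Proof.
case/andP => /eqP sc _; rewrite -[X in supported _ X _]sc.
apply: (supported_prod homog0 homogD) => G _.
by rewrite -[X in supported _ X _]muln1; apply: (supported_exp homog0 homogD); apply: homog_hvar.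
Qed.

Lemma lam_hprod c : valid_monom BG c ->
  lam_hpoly (proj i (hprod c)) = (omega M BG N f i (to_mnm c))%:R.
Proof.
move=> vc; rewrite lam_hpoly_proj; last exact: hprod_homog.
rewrite /Lfun -[RHS](phiX M BG N f i (to_mnm c)); congr (phi _).
rewrite /subst rmorph_prod /= mpolyXE_id (reindex_onto (@enum_rank {set T}) enum_val) /= => [|j _]; last exact: enum_valK.
rewrite [RHS](eq_bigl xpredT) => [|G]; last by rewrite enum_rankK eqxx.
apply: eq_bigr => G _; rewrite -[to_mnm c _]/(expo _ G) expo_to_mnm rmorphXn /= -/(subst _).
have [GB|GB] := boolP (G \in BG); first by rewrite subst_hvar.
by case/andP: vc => _ /forallP /(_ G); rewrite GB /= => /eqP ->; rewrite !expr0.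
Qed.

End OneFunctional.
End LowerBound.

(** * Standard monomials are independent *)

Section Triangular.
Local Open Scope nat_scope.
Variables (T : finType) (M : matroid T) (BG : {set {set T}}).
Hypotheses (ll : loopless M) (bs : building_set M BG) (topBG : setT \in BG).
Variable i : nat.
Local Notation rk := (mrank M).
Local Notation nested := (nested M BG).
Implicit Types (c : monom T i) (G H : {set T}).

Definition dual_at c c' := omega M BG (forest_of c) (fun G => c G) i (to_mnm c').

Lemma mem_forest c G : c G != 0 :> nat -> G \in forest_of c.
Proof. by rewrite -lt0n => h; rewrite in_setU1 inE h orbT. Qed.

Lemma mem_dom_self c G : nested (forest_of c) -> G \in forest_of c -> G \in dom BG (forest_of c) G.
Proof.
move=> nN GN; rewrite inE (nested_BG nN GN) subxx /=; apply/negP => h.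
by have := lower_proper ll bs nN GN; rewrite properE h andbF.
Qed.

Lemma dom_forest c G H : nested (forest_of c) -> G \in forest_of c -> H \in forest_of c ->
  H \in dom BG (forest_of c) G -> H = G.
Proof.
move=> nN GN HN HG; rewrite -(dom_uniq ll bs nN (setT_forest c) GN HG).
by apply/esym/top_id.
Qed.

Lemma sum_dom_self c G : nested (forest_of c) -> G \in forest_of c ->
  (\sum_(H in dom BG (forest_of c) G) c H = c G)%N.
Proof.
move=> nN GN; rewrite (bigD1 G) ?mem_dom_self //= big1 ?addn0 // => H /andP [HG neq].
apply/eqP; apply: contraNT neq => /mem_forest HN; apply/eqP.
exact: (dom_forest nN GN HN HG).
Qed.

(** In the interval of [G] only [G] itself can have a nonzero exponent, and standardness bounds it.
    A family avoiding [G] asks for a rank increase of one, which any set not inside [J^G]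
    provides. *)
Lemma dual_at_diag c : standard M BG c -> dual_at c c.
Proof.
move=> sc; have [nN _ l] := standardP ll bs topBG sc.
have vc : valid_monom BG c by case/and3P: sc.
rewrite /dual_at /omega (mdeg_valid vc) eqxx; apply/forall_inP => G GN; apply/andP; split.
  by under eq_bigr => H _ do rewrite expo_to_mnm; rewrite (sum_dom_self nN GN).
apply/dhrP => V VD V0; under eq_bigr => H _ do rewrite expo_to_mnm.
set N := forest_of c in nN l GN VD *.
have [GV|GV] := boolP (G \in V).
  have -> : (\sum_(H in V) c H = c G)%N.
    rewrite (bigD1 G) //= big1 ?addn0 // => H /andP [HV neq].
    apply/eqP; apply: contraNT neq => /mem_forest HN; apply/eqP.
    exact: (dom_forest nN GN HN (subsetP VD H HV)).
  have lG := l G GN; rewrite /lifted in lG.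
  have cG : (c G < rk G - rk (lower N G))%N.
    by move: lG; have [_|_] := eqVneq G setT; rewrite ?addn0 addn1.
  have : (rk G <= rk (span_over (lower N G) V))%N.
    by apply: mrank_mono; apply: subset_trans (subsetUr _ _); apply: bigcup_sup.
  by move: cG; move: (rk G) (rk (lower N G)) (nat_of_ord (c G)) (rk (span_over _ _)) => a b d e; clear; lia.
rewrite big1 => [|H HV]; last first.
  apply/eqP; apply: contraNT GV => /mem_forest HN.
  by rewrite -(dom_forest nN GN HN (subsetP VD H HV)).
case/set0Pn: V0 => H HV; have := subsetP VD H HV; rewrite inE => /and3P [_ _ Hl].
rewrite addn0 addn1; apply: flat_rk_lt; first exact: (lower_flat ll bs nN).
rewrite properE subsetUl /=; apply: contra Hl; apply: subset_trans.
by apply: subset_trans (subsetUr _ _); apply: bigcup_sup.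
Qed.

(* [kappa] encodes the lexicographic order: first more nodes, then smaller total rank. *)
Definition kappa_bound := (#|{: {set T}}| * rk setT).+1.
Definition kappa c :=
  (#|forest_of c| * kappa_bound + (kappa_bound.-1 - \sum_(G in forest_of c) rk G))%N.

Lemma sum_rk_bound (N : {set {set T}}) : (\sum_(G in N) rk G <= kappa_bound.-1)%N.
Proof.
apply: (@leq_trans (\sum_(G in N) rk setT)).
  by apply: leq_sum => G _; apply: mrank_mono; apply: subsetT.
by rewrite sum_nat_const leq_mul2r max_card orbT.
Qed.

(** Every node [G] of [c] has a node of [c'] in its interval, [E] itself for [E] and by the degree
    condition otherwise; this choice is injective because intervals share no set. With equally many
    nodes it is a bijection onto smaller or equal sets, so the total rank drops unless all nodes are
    fixed, and then the degree conditions give [c' = c]. *)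
Lemma dual_at_lt c c' : standard M BG c -> standard M BG c' -> dual_at c c' -> c' != c ->
  (kappa c < kappa c')%N.
Proof.
move=> sc sc' /andP [_ /forall_inP h] neq.
have [nN _ _] := standardP ll bs topBG sc; have [nN' _ _] := standardP ll bs topBG sc'.
set N := forest_of c in h nN *; set N' := forest_of c' in nN' *.
have EN : setT \in N := setT_forest c; have EN' : setT \in N' := setT_forest c'.
have sumE G : G \in N -> (\sum_(H in dom BG N G) c' H = c G)%N.
  move=> GN; have /andP [/eqP <- _] := h G GN; apply: eq_bigr => H _; by rewrite expo_to_mnm.
have ex G : G \in N -> exists2 H, H \in N' & H \in dom BG N G.
  move=> GN; have [->|GT] := eqVneq G setT; first by exists setT => //; apply: mem_dom_self.
  have cG : c G != 0 :> nat by move: GN; rewrite in_setU1 (negPf GT) inE lt0n.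
  case: (boolP [exists H in dom BG N G, c' H != 0 :> nat]) => [/exists_inP [H HG c'H]|].
    by exists H => //; apply: mem_forest.
  rewrite negb_exists_in => /forall_inP h0; case/negP: cG; rewrite -(sumE G GN).
  by rewrite big1 // => H HG; apply/eqP; have := h0 H HG; rewrite negbK.
pose g G := odflt G [pick H in N' | H \in dom BG N G].
have gP G : G \in N -> g G \in N' /\ g G \in dom BG N G.
  move=> GN; rewrite /g; case: pickP => [H /andP []//|].
  by case: (ex G GN) => H h1 h2 /(_ H); rewrite h1 h2.
have gI : {in N &, injective g}.
  move=> G1 G2 G1N G2N E; have [_ d1] := gP G1 G1N; have [_ d2] := gP G2 G2N.
  by rewrite -(dom_uniq ll bs nN EN G1N d1) E (dom_uniq ll bs nN EN G2N d2).
have gN : g @: N \subset N' by apply/subsetP => H /imsetP [G GN ->]; case: (gP G GN).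
have cg : #|g @: N| = #|N| := card_in_imset gI.
have lN : (#|N| <= #|N'|)%N by rewrite -cg; apply: subset_leq_card.
have bN := sum_rk_bound N; have bN' := sum_rk_bound N'.
rewrite /kappa -/N -/N'; move: lN; rewrite leq_eqVlt => /orP [/eqP eN|lN]; last first.
  apply: leq_trans (leq_addr _ _); apply: (@leq_trans (#|N|.+1 * kappa_bound)); last by rewrite leq_mul2r lN orbT.
  by rewrite mulSn addnC ltn_add2r ltnS leq_subr.
rewrite eN ltn_add2l.
have gN' : g @: N = N' by apply/eqP; rewrite eqEcard gN cg eN leqnn.
have gsub G : G \in N -> g G \subset G.
  by move=> GN; have [_] := gP G GN; rewrite inE => /and3P [].
suff lt : (\sum_(G in N') rk G < \sum_(G in N) rk G)%N.
  move: lt bN bN'; move: (\sum_(G in N') rk G)%N (\sum_(G in N) rk G)%N kappa_bound.-1 => a b d.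
  by clear; lia.
rewrite -gN' big_imset //=.
have [G GN gG] : exists2 G, G \in N & g G != G.
  apply/exists_inP; apply: contraNT neq; rewrite negb_exists_in => /forall_inP gid.
  have NE : N' = N.
    rewrite -gN'; apply/setP => H; apply/imsetP/idP => [[G GN ->]|HN].
      by have := gid G GN; rewrite negbK => /eqP ->.
    by exists H => //; have := gid H HN; rewrite negbK => /eqP ->.
  apply/eqP/ffunP => H; apply: val_inj => /=.
  have [HN|HN] := boolP (H \in N).
    have HN' : H \in N' by rewrite NE.
    by rewrite -(sumE H HN) -NE (sum_dom_self nN' HN').
  have z (d : monom T i) : H \notin forest_of d -> d H = 0 :> nat.
    by move=> Hd; apply/eqP; apply: contraNT Hd; apply: mem_forest.
  have HN' : H \notin N' by rewrite NE.
  by rewrite (z c' HN') (z c HN).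
rewrite (bigD1 G) //= [X in (_ < X)%N](bigD1 G) //= -addSn; apply: leq_add.
  apply: flat_rk_lt; last by rewrite properEneq gG gsub.
  by have [gGN _] := gP G GN; apply: (nested_flat bs nN').
by apply: leq_sum => H /andP [HN _]; apply: mrank_mono; apply: gsub.
Qed.

Local Open Scope ring_scope.

Local Notation std := [pred c : monom T i | standard M BG c].
Definition std_val (j : 'I_#|std|) : monom T i := enum_val j.

Lemma std_valP j : standard M BG (std_val j).
Proof. by have := enum_valP j; rewrite inE. Qed.

Definition dual_row (v : hpoly T i) : 'rV[rat]_#|std| :=
  \row_j lam_hpoly M BG (forest_of (std_val j)) (fun G => std_val j G) v.

Lemma dual_row_linear : linear dual_row.
Proof. by move=> a u v; apply/rowP => j; rewrite !mxE linearP. Qed.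
HB.instance Definition _ :=
  GRing.isLinear.Build rat (hpoly T i) 'rV[rat]_#|std| *:%R dual_row dual_row_linear.

Definition std_hprod j : hpoly T i := proj BG i (hprod BG (std_val j)).

Lemma dual_row_test j k : dual_row (std_hprod j) 0 k = (dual_at (std_val k) (std_val j))%:R.
Proof.
rewrite mxE /std_hprod.
have [nN _ _] := standardP ll bs topBG (std_valP k).
have vj : valid_monom BG (std_val j) by case/and3P: (std_valP j).
exact: (lam_hprod _ _ _ vj).
Qed.

Lemma dual_row_free : free [tuple dual_row (std_hprod j) | j < #|std|].
Proof.
apply/freeP => k kE j0; apply/eqP; apply: contraT => kj0.
case: (@arg_maxnP _ j0 (fun j => k j != 0) (fun j => kappa (std_val j)) kj0) => j kj jmax.
have kE' : \sum_j k j *: dual_row (std_hprod j) = 0.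
  by rewrite -[RHS]kE; apply: eq_bigr => l _; rewrite nth_mktuple.
have := congr1 (fun v : 'rV[rat]_#|std| => v 0 j) kE'; rewrite summxE [in RHS]mxE (bigD1 j) //=.
rewrite mxE dual_row_test dual_at_diag ?std_valP // mulr1 big1 ?addr0.
  by move/eqP; rewrite (negPf kj).
move=> l lj; rewrite mxE dual_row_test.
have [->|kl] := eqVneq (k l) 0; first by rewrite mul0r.
case: (boolP (dual_at _ _)) => d; last by rewrite mulr0.
have le : (kappa (std_val l) <= kappa (std_val j))%N := jmax l kl.
move: le; rewrite leqNgt dual_at_lt ?std_valP //.
by apply: contraNneq lj => /enum_val_inj ->.
Qed.

Lemma mem_Pgens (v : hpoly T i) : (forall c, ~~ valid_monom BG c -> v c = 0) -> v \in <<Pgens BG i>>%VS.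
Proof.
move=> v0; have -> : v = \sum_(c | valid_monom BG c) v c *: delta c.
  apply/ffunP => d; rewrite sum_ffunE; have [vd|nvd] := boolP (valid_monom BG d).
    rewrite (bigD1 d) //= !ffunE eqxx big1 ?addr0; first by rewrite [_ *: _]mulr1.
    by move=> c /andP [_ /negPf cd]; rewrite !ffunE eq_sym cd scaler0.
  rewrite v0 // big1 // => c vc; rewrite !ffunE; case: eqP => [E|]; last by rewrite scaler0.
  by rewrite E vc in nvd.
apply: memv_suml => c vc; apply: memvZ; apply: memv_span; apply: map_f.
by rewrite mem_enum.
Qed.

Lemma relations_Pgens : (relations M BG i <= <<Pgens BG i>>)%VS.
Proof.
apply/span_subvP => v; rewrite mem_cat => /orP [/mapP [c]|].
  rewrite mem_enum inE => /andP [vc _] ->; apply: memv_span; apply: map_f; by rewrite mem_enum.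
case/(Jgens_proj ll) => m [e [-> _]]; apply: mem_Pgens => c nvc.
by rewrite ffunE (negPf nvc).
Qed.

(** Rank-nullity for [dual_row] on the span of all monomials: the kernel contains the relations, and
    the image has dimension at least [#|std|]. *)
Lemma dimCH_ge : (#|std| <= dimCH M BG i)%N.
Proof.
rewrite /dimCH leq_subRL; last exact: dimvS relations_Pgens.
have F := limg_ker_dim (linfun dual_row) <<Pgens BG i>>.
rewrite -F; apply: leq_add.
  apply: dimvS; rewrite subv_cap relations_Pgens; apply/subvP => v vr.
  rewrite memv_ker lfunE /=; apply/eqP/rowP => j; rewrite !mxE.
  have [nN _ _] := standardP ll bs topBG (std_valP j).
  exact: (lam_hpoly_relations ll bs _ nN (setT_forest _) vr).
have := dual_row_free; rewrite /free size_tuple => /eqP fr; rewrite -[X in (X <= _)%N]fr; apply: dimvS.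
apply/span_subvP => w /mapP [j _ ->]; rewrite -lfunE; apply: memv_img.
by apply: mem_Pgens => c nvc; rewrite ffunE (negPf nvc).
Qed.

End Triangular.

(** * The gamma-vector *)

Section GammaVector.
Variables (T : finType) (M : matroid T) (BG : {set {set T}}) (lt : rel T).
Hypotheses (ll : loopless M) (bs : building_set M BG) (topBG : setT \in BG).
Hypotheses (sto : strict_total_order lt) (cmp : complete M BG lt).
Local Notation d := (mrank M setT).-1.
Local Notation stable := (stable_max_nested M BG lt).

(** In a stable set the nodes without ascending child, one more than the descents, are disjoint from
    them, and there are [rk setT] nodes in all. *)
Lemma stable_card_Des S : stable S -> (2 * #|Des M lt S| <= d)%N.
Proof.
move=> sS; have [mS h] := elimT (stableP ll bs topBG sto S) sS.
have cB := card_nodes_noasc ll bs topBG sto cmp mS.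
set B := [set K in S | _] in cB.
have dis : B :&: Des M lt S = set0.
  apply/eqP; rewrite -subset0; apply/subsetP => K; rewrite in_setI in_set => /andP [/andP [_ nc]].
  by rewrite (Des_mem ll bs topBG sto K mS) => /h hc; rewrite hc in nc.
have sub : B :|: Des M lt S \subset S.
  by rewrite subUset; apply/andP; split; apply/subsetP => K; rewrite in_set => /andP [].
have := subset_leq_card sub; rewrite cardsU dis cards0 subn0 cB (max_nested_card ll bs topBG mS).
by rewrite addSn mul2n -addnn; case: (mrank M setT).
Qed.

Lemma nfaces_Gamma j :
  nfaces (Gamma M BG lt) j = #|[set S | stable S && (#|Des M lt S| == j)]|.
Proof.
have inj : {in [set S | stable S && (#|Des M lt S| == j)] &, injective (Des M lt)}.
  move=> S1 S2; rewrite !in_set => /andP [s1 _] /andP [s2 _].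
  by apply: (stable_Des_inj ll bs topBG sto); [case/andP: s1 | case/andP: s2].
rewrite /nfaces -(card_in_imset inj); apply: eq_card => D; rewrite in_set.
apply/andP/imsetP => [[/imsetP [S]]|[S]].
  by rewrite in_set => sS -> cD; exists S; rewrite // in_set sS.
rewrite in_set => /andP [sS cS] ->; split=> //; apply/imsetP; exists S => //.
by rewrite in_set.
Qed.

Lemma dimCH_sum i : dimCH M BG i =
  (\sum_(S | stable S && (#|Des M lt S| <= i)) 'C(d - 2 * #|Des M lt S|, i - #|Des M lt S|))%N.
Proof.
rewrite -(card_standard ll bs topBG sto cmp); apply/eqP.
by rewrite eqn_leq dimCH_le // dimCH_ge.
Qed.

Lemma coef_gamma j k i :
  ('X^j * ('X + 1) ^+ k : {poly rat})`_i = (if (j <= i)%N then 'C(k, i - j) else 0%N)%:R.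
Proof.
rewrite coefXnM ltnNge; case: (j <= i)%N => //=.
rewrite exprDn coef_sum.
under eq_bigr => l _ do rewrite expr1n mulr1 coefMn coefXn.
have [lk|lk] := leqP (i - j) k; last first.
  rewrite bin_small // big1 // => l _; case: eqP => [E|]; last by rewrite mul0rn.
  by have := ltn_ord l; have := leq_subr l k; rewrite -E leqNgt lk.
have sk : (k - (i - j) < k.+1)%N by rewrite ltnS leq_subr.
rewrite (bigD1 (Ordinal sk)) //= subKn // eqxx bin_sub // big1 ?addr0 // => l neq.
case: eqP => [E|]; last by rewrite mul0rn.
case/eqP: neq; apply: val_inj => /=; rewrite E subKn //.
by have := ltn_ord l.
Qed.

Lemma dimCH_gamma i :
  ((dimCH M BG i)%:R : rat) =
  (\sum_(j < d./2.+1)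
     (nfaces (Gamma M BG lt) j)%:R *: ('X^j * ('X + 1) ^+ (d - 2 * j))) `_ i.
Proof.
rewrite coef_sum dimCH_sum.
pose g j := if (j <= i)%N then 'C(d - 2 * j, i - j) else 0%N.
rewrite (eq_bigr (fun j : 'I_(d./2.+1) => (nfaces (Gamma M BG lt) j * g j)%N%:R)) => [|j _]; last first.
  by rewrite coefZ coef_gamma -natrM.
rewrite -natr_sum; congr (_%:R).
rewrite (eq_bigr (fun j : 'I_(d./2.+1) => (\sum_(S | stable S) (#|Des M lt S| == j) * g j)%N)) => [|j _]; last first.
  rewrite nfaces_Gamma -sum1_card big_distrl /= [LHS]big_mkcond [RHS]big_mkcond /=.
  apply: eq_bigr => S _; rewrite in_set.
  by case: (stable S) => //=; case: (_ == _); rewrite ?mul1n ?mul0n.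
rewrite exchange_big /= big_mkcondr; apply: eq_bigr => S sS.
have lS : (#|Des M lt S| < d./2.+1)%N.
  by have := stable_card_Des sS; rewrite ltnS mul2n -geq_half_double.
rewrite (bigD1 (Ordinal lS)) //= eqxx mul1n big1 ?addn0 // => j neq.
case: eqP => [E|]; last by rewrite mul0n.
by case/eqP: neq; apply: val_inj.
Qed.

End GammaVector.

Unset Implicit Arguments.

Theorem theorem5p17 (T : finType) (M : matroid T) (BG : {set {set T}})
    (lt : rel T) :
  loopless M -> building_set M BG -> setT \in BG ->
  strict_total_order lt -> complete M BG lt ->
  (* Gamma is a simplicial complex contained in P(V) *)
  (forall D D' : {set {set T}}, D \in Gamma M BG lt -> D' \subset D -> D' \in Gamma M BG lt) /\
  (forall D, D \in Gamma M BG lt -> D \subset Vset M BG lt) /\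
  (* its face numbers are the gamma-coefficients of H(M,G)(t), of degree d = rk M - 1 *)
  (let d := (mrank M setT).-1 in
   (forall j, (d < 2 * j)%N -> nfaces (Gamma M BG lt) j = 0%N) /\
   (forall i : nat,
      ((dimCH M BG i)%:R : rat) =
      (\sum_(j < d./2.+1)
          (nfaces (Gamma M BG lt) j)%:R *: ('X^j * ('X + 1) ^+ (d - 2 * j))) `_ i)).
Proof.
move=> ll bs topBG sto cmp; split; last split; last split.
- move=> D D' /imsetP [S]; rewrite in_set => sS -> D'D.
  have [S' sS' <-] := Des_subset_stable ll bs topBG sto cmp sS D'D.
  by apply/imsetP; exists S'; rewrite // in_set.
- by move=> D /imsetP [S]; rewrite in_set => sS ->; apply: (Des_subset_V ll bs topBG sto sS).
- move=> j dj; rewrite (nfaces_Gamma ll bs topBG sto).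
  apply/eqP; rewrite cards_eq0 -subset0; apply/subsetP => S; rewrite in_set => /andP [sS /eqP cS].
  have := stable_card_Des ll bs topBG sto cmp sS.
  by rewrite cS leqNgt dj.
- by move=> i; apply: dimCH_gamma.
Qed.
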